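(* Let $\alpha\in(0,1)$. Then $\mathcal X$ localizes, i.e., for almost every realization of $\tau$, $\sup_{i\in\mathbb Z}P(\mathcal X_t=i\mid\tau)$ does not converge to $0$ as $t\to\infty$.
   Context: Let $\beta\in(1,2]$. Let $(\varepsilon_j)_{j\ge1}$ be i.i.d. integer-valued with $E\varepsilon_1=0$, $E(e^{it\varepsilon_1})=1$ iff $t\in2\pi\mathbb Z$, $P(\varepsilon_1<-x)\sim x^{-\beta}(c^-+o(1))h(x)$, $P(\varepsilon_1>x)\sim x^{-\beta}(c^++o(1))h(x)$, $c^\pm>0$, $h$ slowly varying; $X_0=0$, $X_n=\sum_{j\le n}\varepsilon_j$. Let $\tau=(\tau_i)_{i\in\mathbb Z}$ be i.i.d. positive random variables independent of $X$ with $P(\tau_0>x)\sim x^{-\alpha}(\kappa^++o(1))s(x)$, $\kappa^+>0$, $s$ positive slowly varying. The trap model $\mathcal X$ is the continuous-time random walk on $\mathbb Z$ with $\mathcal X_0=0$, embedded chain $X$, and jump rate $\tau_i^{-1}$ at site $i$ (holding times exponential with mean $\tau_i$, conditionally independent given $X,\tau$). *)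

(* Defs.v *)
From HB Require Import structures.
From mathcomp Require Import all_boot all_order all_algebra.
From mathcomp Require Import all_classical all_reals all_analysis.
Set Implicit Arguments. Unset Strict Implicit. Unset Printing Implicit Defensive.
Import Order.TTheory GRing.Theory Num.Theory.
Import numFieldNormedType.Exports.
Local Open Scope classical_set_scope.
Local Open Scope ring_scope.

(* Indices of all the primitive random variables of the construction:
   the increments eps_{j+1} (j : nat), the standard exponential clocks E_k
   (k : nat) and the traps tau_i (i : int). *)
Inductive tm_index := EpsIdx of nat | HoldIdx of nat | TrapIdx of int.

Section defs.
Context {R : realType} {d : measure_display} {T : measurableType d}.

Definition mutually_independent (P : probability T R) (I : Type)
    (X : I -> T -> R) : Prop :=
  forall (n : nat) (f : 'I_n -> I), injective f ->
  forall (B : 'I_n -> set R), (forall k, measurable (B k)) ->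
  P (\bigcap_(k in [set: 'I_n]) (X (f k) @^-1` B k)) =
  (\prod_(k < n) P (X (f k) @^-1` B k))%E.

Definition ident_distr (P : probability T R) (X Y : T -> R) : Prop :=
  forall B : set R, measurable B -> P (X @^-1` B) = P (Y @^-1` B).

Definition tm_family (eps : nat -> T -> int) (E : nat -> T -> R)
    (tau : int -> T -> R) (k : tm_index) : T -> R :=
  match k with
  | EpsIdx j => fun w => (eps j w)%:~R
  | HoldIdx n => E n
  | TrapIdx i => tau i
  end.

(* embedded chain: X_0 = 0, X_n = eps_1 + ... + eps_n  (eps j = eps_{j+1}) *)
Definition walk (eps : nat -> T -> int) (n : nat) (w : T) : int :=
  \sum_(j < n) eps j w.

(* jump times of the trap model in environment s : int -> R:
   holding time at the n-th visited site X_n is s(X_n) * E_n, E_n ~ Exp(1) *)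
Fixpoint jump_time (s : int -> R) (eps : nat -> T -> int) (E : nat -> T -> R)
    (n : nat) (w : T) : R :=
  match n with
  | 0%N => 0
  | m.+1 => jump_time s eps E m w + s (walk eps m w) * E m w
  end.

Definition trap_at (s : int -> R) (eps : nat -> T -> int) (E : nat -> T -> R)
    (t : R) (i : int) : set T :=
  [set w | exists n : nat, jump_time s eps E n w <= t < jump_time s eps E n.+1 w
                           /\ walk eps n w = i].

(* quenched probability P(X_t = i | tau = s) *)
Definition quenched_prob (P : probability T R) (s : int -> R)
    (eps : nat -> T -> int) (E : nat -> T -> R) (t : R) (i : int) : R :=
  fine (P (trap_at s eps E t i)).

End defs.

Section realdefs.
Context {R : realType}.

Definition slowly_varying (h : R -> R) : Prop :=
  measurable_fun setT h /\ (\forall x \near +oo, 0 < h x) /\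
  forall lam : R, 0 < lam -> h (lam * x) / h x @[x --> +oo] --> (1 : R).

Definition regular_tail (F : R -> R) (a c : R) (L : R -> R) : Prop :=
  exists g : R -> R, g x @[x --> +oo] --> (0 : R) /\
    \forall x \near +oo, F x = x `^ (- a) * (c + g x) * L x.

End realdefs.

(* Main.v *)
(* Fix an environment [s] and a scale [a = 2^m], and let [N] be the time at which
   the embedded walk has spread over distance of order [a]. A Fourier bound shows
   that every site is visited at most [C * N / a] times on average before time
   [N]; since the walk stays at distance [O(a)] with high probability, a positive
   proportion of the sites at distance [O(a)] have expected local time at least
   [c * N / a]. Let [i] be such a site and assume that [s i] exceeds a large
   multiple of the sum of the other traps within distance [K * a]. By
   Paley-Zygmund the clock of the walk then reaches [t = theta * s i * N / a]
   before step [N] with probability bounded below, and more than half of the time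
   up to [t] is spent at [i]; by Fubini some time in [[t / 4, t]] charges [i] with
   probability bounded below.
   As [alpha < 1], the traps of an annulus of size [a] are dominated by one of
   them, located at a well-visited site, with probability bounded below. Along
   rapidly growing scales these events are independent and the inner ball does
   not matter, so almost every environment has this property at infinitely many
   scales. *)
Require Import Defs.
From HB Require Import structures.
From mathcomp Require Import all_boot all_order all_algebra.
From mathcomp Require Import all_classical all_reals all_analysis.
From mathcomp Require Import measurable_realfun ring lra zify.
Import Order.TTheory GRing.Theory Num.Theory.
Import numFieldNormedType.Exports.
Local Open Scope classical_set_scope.
Local Open Scope ring_scope.
Set Implicit Arguments.
Unset Strict Implicit.
Unset Printing Implicit Defensive.

(** * Independence of sigma-algebras generated by disjoint blocks of variables *)

(** All that is kept of the tails is their behaviour when the level doubles: a ratio [r] in (1/4,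
    1/2) for the increments, available because beta > 1, and a ratio at least [rho] > 1/2 for the
    traps, available because alpha < 1. Every sum over dyadic scales is then comparable to a
    geometric series, and no constant depends on the scale. The time N is the integer part of the
    squared scale divided by the truncated variance, which puts beta = 2, with finite or infinite
    variance, on the same footing as beta < 2. The quenched estimate is proved for each
    deterministic positive environment with a dominating trap. It can therefore be applied at
    [tau ^~ w] for one fixed [w], while walk and clocks are integrated with the environment frozen.
    It yields an unspecified time in a window, which is enough to refute convergence as long as the
    windows move to infinity: N / a is at least of order (2r)^-m with 2r < 1, and the dominating
    traps stay bounded below. *)

Section independence.
Context {R : realType} {d : measure_display} {T : measurableType d}.
Context {I : eqType} (P : probability T R) (X : I -> T -> R).
Hypothesis mX : forall i, measurable_fun setT (X i).
Hypothesis indX : mutually_independent P X.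

Definition cylinder (J : set I) : set (set T) :=
  [set A | exists (l : seq I) (B : I -> set R),
     [/\ uniq l, {in l, forall i, J i}, forall i, measurable (B i) &
         A = \bigcap_(i in [set` l]) X i @^-1` B i]].

(** The sigma-algebra generated by the variables with index in [J], carried by a measurable type of
    its own: the usual closure lemmas for measurable functions then prove that an event depends on
    [J] alone. *)
Definition block (J : set I) := g_sigma_algebraType (cylinder J).

Lemma cylinder_setI (J : set I) : setI_closed (cylinder J).
Proof.
move=> _ _ [l [B [ul lJ mB ->]]] [l' [B' [ul' lJ' mB' ->]]].
exists (undup (l ++ l')), (fun i => (if i \in l then B i else setT) `&`
                                    (if i \in l' then B' i else setT)).
split; first exact: undup_uniq.
- by move=> i; rewrite mem_undup mem_cat => /orP[/lJ|/lJ'].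
- by move=> i; apply: measurableI; case: ifP.
- rewrite eqEsubset; split=> w.
    move=> [h1 h2] i /=; rewrite mem_undup mem_cat => _; split.
      by case: ifP => // /h1.
    by case: ifP => // /h2.
  move=> h; split=> i /= il.
    by have := h i; rewrite /= mem_undup mem_cat il => /(_ erefl)[].
  by have := h i; rewrite /= mem_undup mem_cat il orbT => /(_ erefl)[].
Qed.

Lemma measurable_cylinder (J : set I) A : cylinder J A -> measurable A.
Proof.
move=> [l [B [_ _ mB ->]]]; apply: fin_bigcap_measurable => // i _.
by rewrite -[X in measurable X]setTI; exact: mX.
Qed.

Lemma block_measurable (J : set I) A :
  measurable (A : set (block J)) -> d.-measurable A.
Proof.
move=> mA; apply: (smallest_sub _ _ mA); first exact: sigma_algebra_measurable.
exact: measurable_cylinder.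
Qed.

Lemma probability_cylinder (l : seq I) (B : I -> set R) :
  uniq l -> (forall i, measurable (B i)) ->
  (P (\bigcap_(i in [set` l]) X i @^-1` B i) =
   \prod_(i <- l) P (X i @^-1` B i))%E.
Proof.
move=> ul mB.
have := @indX (size l) (tnth (in_tuple l)).
move=> /(_ _ (fun k => B (tnth (in_tuple l) k)) (fun=> mB _)).
have inj : injective (tnth (in_tuple l)).
  by apply/tuple_uniqP.
move=> /(_ inj); rewrite (big_tnth _ _ l) => <-; congr (P _).
rewrite eqEsubset; split=> w h i /=.
  by move=> _; apply: h => /=; exact: mem_tnth.
by move=> /(tnthP (in_tuple l))[k ->]; exact: h.
Qed.

(** The Dynkin half of the pi-lambda argument; cylinders provide the pi-system. *)
Lemma dynkin_indep (B : set T) : d.-measurable B ->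
  lambda_system setT [set A | d.-measurable A /\ (P (A `&` B) = P A * P B)%E].
Proof.
move=> mB; apply/dynkin_lambda_system; split => /=.
- by rewrite setTI probability_setT mul1e.
- move=> A [mA AB]; split; first exact: measurableC.
  have mAB : d.-measurable (A `&` B) by exact: measurableI.
  have -> : ~` A `&` B = B `\` A `&` B by rewrite setDE setCI setIUr setICr setU0 setIC.
  rewrite measureD//; last by rewrite (le_lt_trans (probability_le1 _ _)) ?ltry.
  have -> : B `&` (A `&` B) = A `&` B by rewrite setICA setIid.
  rewrite [X in (_ - X)%E = _]AB probability_setC//.
  by rewrite muleBl ?mul1e ?fin_num_measure// fin_num_adde_defr// fin_num_measure.
- move=> F tF h; have mF i : d.-measurable (F i) by have [] := h i.
  split; first exact: bigcupT_measurable.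
  rewrite setI_bigcupl measure_bigcup//; last 2 first.
  + by move=> i _; exact: measurableI.
  + apply/trivIsetP => i j _ _ ij; rewrite setIACA setIid.
    by move/trivIsetP : tF => ->//; rewrite set0I.
  rewrite measure_bigcup// [RHS]muleC.
  have -> : P B = (fine (P B))%:E by rewrite fineK// fin_num_measure.
  rewrite -nneseriesZl//; apply: eq_eseriesr => i _.
  by have [_ E] := h i; rewrite [LHS]E muleC fineK// fin_num_measure.
Qed.

(** Two cylinders over disjoint index lists merge into one cylinder over the concatenated list,
    where the product formula applies to all factors at once. *)
Lemma cylinder_indep (J K : set I) A B : J `&` K = set0 ->
  cylinder J A -> cylinder K B -> (P (A `&` B) = P A * P B)%E.
Proof.
move=> JK0 [l [F [ul lJ mF ->]]] [l' [F' [ul' lJ' mF' ->]]].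
have disj i : i \in l -> i \in l' -> False.
  by move=> /lJ Ji /lJ' Ki; have : (J `&` K) i by []; rewrite JK0.
have E : \bigcap_(i in [set` l]) X i @^-1` F i `&`
    \bigcap_(i in [set` l']) X i @^-1` F' i =
  \bigcap_(i in [set` l ++ l']) X i @^-1` (if i \in l then F i else F' i).
  rewrite eqEsubset; split=> w.
    move=> [h1 h2] i /=; rewrite mem_cat; case: ifP => [il _|_ /= il']; first exact: h1.
    exact: h2.
  move=> h; split=> i /= il.
    by have := h i; rewrite /= mem_cat il; apply.
  have := h i; rewrite /= mem_cat il orbT => /(_ erefl).
  by case: ifP => // il2; case: (disj i).
rewrite E !probability_cylinder//; last 2 first.
- rewrite cat_uniq ul ul' andbT/=; apply/hasPn => i il'.
  by apply/negP => il; exact: (disj i).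
- by move=> i; case: ifP.
rewrite big_cat/=; congr (_ * _)%E.
  by apply: eq_big_seq => i il; rewrite il.
by apply: eq_big_seq => i il; case: ifP => // il2; case: (disj i).
Qed.

(** The pi-lambda theorem is used once per factor: first against a fixed cylinder of [K], then
    against a fixed event of the block of [J]. *)
Lemma block_indep (J K : set I) A B : J `&` K = set0 ->
  measurable (A : set (block J)) -> measurable (B : set (block K)) ->
  (P (A `&` B) = P A * P B)%E.
Proof.
move=> JK0 mA mB.
have step C : cylinder K C -> (P (A `&` C) = P A * P C)%E.
  move=> KC; have mC := measurable_cylinder KC.
  have [|//|//] := lambda_system_subset (@cylinder_setI J) (dynkin_indep mC) _ _ mA.
  move=> D JD; split; first exact: measurable_cylinder JD.
  exact: cylinder_indep JK0 JD KC.
have mA' := block_measurable mA.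
have [|//|_] := lambda_system_subset (@cylinder_setI K) (dynkin_indep mA') _ _ mB.
  move=> D KD; split; first exact: measurable_cylinder KD.
  by rewrite setIC step// muleC.
by rewrite setIC => ->; rewrite muleC.
Qed.

Lemma block_measurable_fun (J : set I) i : J i ->
  measurable_fun (setT : set (block J)) (X i : block J -> R).
Proof.
move=> Ji _ B mB; rewrite setTI; apply: sub_sigma_algebra.
exists [:: i], (fun=> B); split => //.
  by move=> j; rewrite inE => /eqP ->.
rewrite eqEsubset; split=> w.
  by move=> h j /=; rewrite inE => /eqP ->.
by move=> /(_ i); rewrite /= inE eqxx; exact.
Qed.

Lemma block_subset (J K : set I) A : J `<=` K ->
  measurable (A : set (block J)) -> measurable (A : set (block K)).
Proof.
move=> JK; apply: sub_smallest2r; first exact: smallest_sigma_algebra.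
move=> B [l [F [ul lJ mF ->]]].
by exists l, F; split => // i /lJ /JK.
Qed.

Lemma block_measurable_funW (J : set I) (f : T -> R) :
  measurable_fun (setT : set (block J)) (f : block J -> R) ->
  measurable_fun setT f.
Proof.
by move=> mf _ B mB; apply: block_measurable; exact: mf.
Qed.

End independence.

(** * Real-valued probabilities and expectations *)

Section expectation.
Context {R : realType} {d : measure_display} {T : measurableType d}.
Variable P : probability T R.

(** Real values keep the estimates within ordered-field arithmetic. [Ex] is to be trusted only under
    [intg], since an infinite integral becomes 0. *)
Definition Ex (f : T -> R) : R := \int[P]_w f w.
Definition Pr (A : set T) : R := fine (P A).
Definition intg (f : T -> R) : Prop := P.-integrable setT (EFin \o f).
(** Bounded measurable functions are closed under sums and products, so that integrability comes for
    free. *)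
Definition bmf (f : T -> R) : Prop :=
  measurable_fun setT f /\ exists M : R, forall w, `|f w| <= M.

Lemma Pr_ge0 A : 0 <= Pr A. Proof. exact: fine_ge0. Qed.

Lemma PrK A : d.-measurable A -> (Pr A)%:E = P A.
Proof. by move=> mA; rewrite fineK// fin_num_measure. Qed.

Lemma Pr_le1 A : d.-measurable A -> Pr A <= 1.
Proof. by move=> mA; rewrite -lee_fin PrK// probability_le1. Qed.

Lemma le_Pr A B : d.-measurable A -> d.-measurable B -> A `<=` B -> Pr A <= Pr B.
Proof. by move=> mA mB AB; rewrite -lee_fin !PrK// le_measure// inE. Qed.

Lemma PrU_le A B : d.-measurable A -> d.-measurable B -> Pr (A `|` B) <= Pr A + Pr B.
Proof.
move=> mA mB; rewrite -lee_fin EFinD !PrK//; last exact: measurableU.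
exact: measureU2.
Qed.

Lemma PrT : Pr setT = 1. Proof. by rewrite /Pr probability_setT. Qed.

Lemma Pr0 : Pr set0 = 0. Proof. by rewrite /Pr measure0. Qed.

Lemma PrC A : d.-measurable A -> Pr (~` A) = 1 - Pr A.
Proof.
move=> mA; apply: EFin_inj; rewrite EFinB !PrK//; last exact: measurableC.
by rewrite probability_setC.
Qed.

Lemma Pr_bigcup_le (n : nat) (A : nat -> set T) : (forall k, d.-measurable (A k)) ->
  Pr (\bigcup_(k < n) A k) <= \sum_(k < n) Pr (A k).
Proof.
move=> mA; rewrite -lee_fin PrK; last by exact: bigcup_measurable.
rewrite -sumEFin (eq_bigr (fun k : 'I_n => P (A k))); last by move=> k _; rewrite PrK.
rewrite bigcup_mkord; apply: Boole_inequality => // i _; exact: mA.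
Qed.

Lemma Pr_bigcup (n : nat) (A : nat -> set T) : (forall k, d.-measurable (A k)) ->
  trivIset setT A ->
  Pr (\bigcup_(k < n) A k) = \sum_(k < n) Pr (A k).
Proof.
move=> mA tA; apply: EFin_inj; rewrite PrK; last by exact: bigcup_measurable.
rewrite -sumEFin (eq_bigr (fun k : 'I_n => P (A k))); last by move=> k _; rewrite PrK.
rewrite bigcup_mkord measure_semi_additive//; exact: bigsetU_measurable.
Qed.

Lemma bmf_intg f : bmf f -> intg f.
Proof.
move=> [mf [M fM]]; apply: measurable_bounded_integrable => //.
  by apply: (le_lt_trans (probability_le1 P measurableT)); rewrite ltry.
by exists M; split; [exact: num_real|move=> x Mx w _ /=; apply: le_trans (ltW Mx)].
Qed.

Lemma bmf_cst c : bmf (fun=> c).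
Proof. by split; [exact: measurable_cst|exists `|c|]. Qed.

Lemma bmf_indic (A : set T) : d.-measurable A -> bmf (\1_A).
Proof.
move=> mA; split; first by apply: measurable_indic.
by exists 1 => w; rewrite indicE; case: (_ \in _); rewrite ?normr1 ?normr0.
Qed.

Lemma bmfD f g : bmf f -> bmf g -> bmf (fun w => f w + g w).
Proof.
move=> [mf [M fM]] [mg [N gN]]; split; first exact: measurable_funD.
by exists (M + N) => w; apply: (le_trans (ler_normD _ _)); exact: lerD.
Qed.

Lemma bmfM f g : bmf f -> bmf g -> bmf (fun w => f w * g w).
Proof.
move=> [mf [M fM]] [mg [N gN]]; split; first exact: measurable_funM.
by exists (M * N) => w; rewrite normrM; exact: ler_pM.
Qed.

Lemma bmfZ c f : bmf f -> bmf (fun w => c * f w).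
Proof. by move=> bf; apply: bmfM => //; exact: bmf_cst. Qed.

Lemma bmfB f g : bmf f -> bmf g -> bmf (fun w => f w - g w).
Proof.
move=> bf bg; have := bmfD bf (bmfZ (-1) bg); congr bmf.
by apply/funext => w; rewrite mulN1r.
Qed.

Lemma bmf_sum (J : Type) (l : seq J) (f : J -> T -> R) :
  (forall j, bmf (f j)) -> bmf (fun w => \sum_(j <- l) f j w).
Proof.
move=> bf; elim: l => [|j l IH].
  by under eq_fun do rewrite big_nil; exact: bmf_cst.
by under eq_fun do rewrite big_cons; exact: bmfD.
Qed.

Lemma ExD f g : intg f -> intg g -> Ex (fun w => f w + g w) = Ex f + Ex g.
Proof. by move=> ? ?; rewrite /Ex RintegralD. Qed.

Lemma ExB f g : intg f -> intg g -> Ex (fun w => f w - g w) = Ex f - Ex g.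
Proof. by move=> ? ?; rewrite /Ex RintegralB. Qed.

Lemma ExZ c f : intg f -> Ex (fun w => c * f w) = c * Ex f.
Proof. by move=> ?; rewrite /Ex RintegralZl. Qed.

Lemma Ex_cst c : Ex (fun=> c) = c.
Proof. by rewrite /Ex Rintegral_cst// [fine _]PrT mulr1. Qed.

Lemma Ex_indic A : d.-measurable A -> Ex (\1_A) = Pr A.
Proof. by move=> mA; rewrite /Ex /Rintegral integral_indic// setIT. Qed.

Lemma Ex_le f g : intg f -> intg g -> (forall w, f w <= g w) -> Ex f <= Ex g.
Proof. by move=> ? ? fg; rewrite /Ex le_Rintegral. Qed.

Lemma Ex_ge0 f : (forall w, 0 <= f w) -> 0 <= Ex f.
Proof. by move=> f0; exact: Rintegral_ge0. Qed.

Lemma eq_Ex f g : f =1 g -> Ex f = Ex g.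
Proof. by move=> fg; congr Ex; exact/funext. Qed.

Lemma normr_Ex f : intg f -> `|Ex f| <= Ex (fun w => `|f w|).
Proof. by move=> ?; exact: le_normr_Rintegral. Qed.

Lemma Ex_sum (J : Type) (l : seq J) (f : J -> T -> R) : (forall j, bmf (f j)) ->
  Ex (fun w => \sum_(j <- l) f j w) = \sum_(j <- l) Ex (f j).
Proof.
move=> bf; elim: l => [|j l IH].
  by under [LHS]eq_Ex do rewrite big_nil; rewrite big_nil Ex_cst.
under [LHS]eq_Ex do rewrite big_cons.
rewrite ExD ?IH ?big_cons//; first exact: bmf_intg.
by apply: bmf_intg; exact: bmf_sum.
Qed.

(** Independence identifies the joint law of [f] and [g] with the product of the marginals; Fubini
    then factorizes the integral. *)
Lemma Ex_indep f g : bmf f -> bmf g ->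
  (forall A B : set R, measurable A -> measurable B ->
     P (f @^-1` A `&` g @^-1` B) = P (f @^-1` A) * P (g @^-1` B))%E ->
  Ex (fun w => f w * g w) = Ex f * Ex g.
Proof.
move=> bf bg ind; have [mf _] := bf; have [mg _] := bg.
pose F : {mfun T >-> R} := HB.pack f (isMeasurableFun.Build _ _ _ _ f mf).
pose G : {mfun T >-> R} := HB.pack g (isMeasurableFun.Build _ _ _ _ g mg).
have mfg : measurable_fun setT (fun w => (f w, g w)) by exact: measurable_fun_pair.
pose H : {mfun T >-> (R * R)%type} :=
  HB.pack (fun w => (f w, g w)) (isMeasurableFun.Build _ _ _ _ _ mfg).
have E1 (X : set (R * R)) : measurable X ->
    ((distribution P F) \x (distribution P G))%E X = distribution P H X.
  by apply: product_measure_unique => A B mA mB; exact: ind.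
have mM : measurable_fun setT (fun z : R * R => (z.1 * z.2)%:E).
  by apply/measurable_EFinP; exact: measurable_funM.
have ifg := bmf_intg (bmfM bf bg).
have iX : ((distribution P F) \x (distribution P G))%E.-integrable setT
     (fun z : R * R => (z.1 * z.2)%:E).
  apply/integrableP; split => //.
  rewrite (eq_measure_integral (distribution P H)); last by move=> A mA _; exact: E1.
  rewrite ge0_integral_distribution//; last exact: measurableT_comp.
  by have /integrableP[] := ifg.
have iF : P.-integrable setT (EFin \o F) by exact: bmf_intg.
have iG : P.-integrable setT (EFin \o G) by exact: bmf_intg.
have step : (\int[P]_w (f w * g w)%:E = (Ex f * Ex g)%:E)%E.
  transitivity (\int[distribution P H]_z (z.1 * z.2)%:E)%E.
    by rewrite integral_distribution.
  transitivity (\int[((distribution P F) \x (distribution P G))%E]_z (z.1 * z.2)%:E)%E.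
    by apply: eq_measure_integral => A mA _; exact/esym/E1.
  rewrite -integral12_prod_meas1//=.
  transitivity (\int[distribution P F]_x (x%:E * (Ex g)%:E))%E.
    apply: eq_integral => x _.
    rewrite /fubini_F /=.
    under eq_integral do rewrite EFinM.
    have iGd : (distribution P G).-integrable setT (EFin : R -> \bar R).
      apply/integrableP; split => //.
      rewrite ge0_integral_distribution//; last exact: measurableT_comp.
      by have /integrableP[] := iG.
    rewrite integralZl//; congr (_ * _)%E.
    by rewrite integral_distribution// /Ex /Rintegral fineK//; exact: integrable_fin_num.
  have iFd : (distribution P F).-integrable setT (EFin : R -> \bar R).
    apply/integrableP; split => //.
    rewrite ge0_integral_distribution//; last exact: measurableT_comp.
    by have /integrableP[] := iF.
  rewrite integralZr// EFinM; congr (_ * _)%E.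
  by rewrite integral_distribution// /Ex /Rintegral fineK//; exact: integrable_fin_num.
by rewrite /Ex /Rintegral step.
Qed.

Lemma Ex_ident (X Y : T -> R) (f : R -> R) :
  measurable_fun setT X -> measurable_fun setT Y -> ident_distr P X Y ->
  measurable_fun setT f -> intg (f \o Y) -> intg (f \o X) /\ Ex (f \o X) = Ex (f \o Y).
Proof.
move=> mX mY XY mf iY.
pose F : {mfun T >-> R} := HB.pack X (isMeasurableFun.Build _ _ _ _ X mX).
pose G : {mfun T >-> R} := HB.pack Y (isMeasurableFun.Build _ _ _ _ Y mY).
have mEf : measurable_fun setT (EFin \o f) by exact/measurable_EFinP.
have iX : intg (f \o X).
  apply/integrableP; split; first by apply/measurable_EFinP; exact: measurableT_comp.
  have /integrableP[_] := iY; congr (_ < _)%E.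
  rewrite -[LHS](@ge0_integral_distribution _ _ _ _ _ P G (fun x => `|(f x)%:E|%E))//; last exact: measurableT_comp.
  rewrite -[RHS](@ge0_integral_distribution _ _ _ _ _ P F (fun x => `|(f x)%:E|%E))//; last exact: measurableT_comp.
  by apply: eq_measure_integral => A mA _ /=; rewrite /distribution /pushforward /= XY.
split => //; rewrite /Ex /Rintegral; congr fine.
rewrite -[LHS](@integral_distribution _ _ _ _ _ P F (fun x => (f x)%:E))//.
rewrite -[RHS](@integral_distribution _ _ _ _ _ P G (fun x => (f x)%:E))//.
by apply: eq_measure_integral => A mA _ /=; rewrite /distribution /pushforward /= XY.
Qed.

End expectation.

Section measurable_sets.
Context {R : realType} {d : measure_display} {T : measurableType d}.
Implicit Types f g : T -> R.

Lemma measurable_le f g : measurable_fun setT f -> measurable_fun setT g ->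
  measurable [set w | f w <= g w].
Proof.
move=> mf mg; have := measurable_fun_ler mf mg => /(_ measurableT [set true] I).
by rewrite setTI; congr (measurable _); apply/seteqP; split => w.
Qed.

Lemma measurable_lt f g : measurable_fun setT f -> measurable_fun setT g ->
  measurable [set w | f w < g w].
Proof.
move=> mf mg; have := measurable_fun_ltr mf mg => /(_ measurableT [set true] I).
by rewrite setTI; congr (measurable _); apply/seteqP; split => w.
Qed.

Lemma measurable_eq f c : measurable_fun setT f -> measurable [set w | f w = c].
Proof.
move=> mf; have := mf measurableT [set c] (measurable_set1 c).
by rewrite setTI.
Qed.

End measurable_sets.

(** * The law of one increment *)

Section trigonometric_bounds.
Context {R : realType}.
Implicit Types u v c : R.

Lemma sin_mvt u : 0 <= u -> exists c, 0 <= c <= u /\ sin u = cos c * u.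
Proof.
move=> u0; have [|c cu] := @MVT_segment R sin cos 0 u u0 (fun x _ => is_derive_sin x).
  by apply: continuous_subspaceT => x; exact: continuous_sin.
rewrite sin0 !subr0 => E.
by exists c.
Qed.

Lemma normr_sin_le u : `|sin u| <= `|u|.
Proof.
wlog u0 : u / 0 <= u.
  move=> h; have [/h//|/ltW u0] := leP 0 u.
  by rewrite -[u]opprK sinN normrN [X in _ <= X]normrN; apply: h; rewrite oppr_ge0.
have [c [_ ->]] := sin_mvt u0.
by rewrite normrM ler_piMl// cos_max.
Qed.

Lemma cos_half u : cos u = 1 - 2 * sin (u / 2) ^+ 2.
Proof.
have E : u = (u / 2) *+ 2 by rewrite -mulr_natr; field.
by rewrite {1}E cos_mulr2n cos2sin2 -mulr_natr; ring.
Qed.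

Lemma cos_ge_sqr u : 1 - u ^+ 2 / 2 <= cos u.
Proof.
rewrite cos_half; have := normr_sin_le (u / 2).
rewrite -ler_sqr ?nnegrE// !real_normK ?num_real// => h; nra.
Qed.

(** By the mean value theorem sin (u / 2) = cos c * u / 2 with 0 <= c <= 1/2, and there cos c >=
    7/8. *)
Lemma cos_le_sqr u : `|u| <= 1 -> cos u <= 1 - u ^+ 2 / 4.
Proof.
wlog u0 : u / 0 <= u.
  move=> h; have [/h//|/ltW u0] := leP 0 u.
  by move=> u1; rewrite -cosN -sqrrN; apply: h; rewrite ?oppr_ge0// normrN.
rewrite ger0_norm// => u1; rewrite cos_half.
have [|c [/andP[c0 cu] ->]] := @sin_mvt (u / 2); first by lra.
have c1 := cos_ge_sqr c.
have c2 : 7 / 8 <= cos c by apply: le_trans c1; nra.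
have c3 : 1 / 2 <= cos c ^+ 2 by nra.
by rewrite exprMn; nra.
Qed.

Lemma sin_sub_le u : `|u| <= 1 -> `|sin u - u| <= u ^+ 2.
Proof.
wlog u0 : u / 0 <= u.
  move=> h; have [/h//|/ltW u0] := leP 0 u.
  have := h (- u); rewrite sinN opprK normrN sqrrN oppr_ge0 => h1 u1.
  by rewrite distrC addrC; exact: h1.
rewrite ger0_norm// => u1; have [c [/andP[c0 cu] ->]] := sin_mvt u0.
have c1 := cos_ge_sqr c; have c2 := cos_le1 c.
rewrite ler0_norm; last by nra.
have c3 : c ^+ 2 / 2 <= 1 by nra.
have : 1 - cos c <= u by nra.
nra.
Qed.

Lemma sin_sub_le2 u : `|sin u - u| <= 2 * `|u|.
Proof.
apply: (le_trans (ler_normB _ _)); have := normr_sin_le u; lra.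
Qed.

End trigonometric_bounds.

(** * Truncated moments and characteristic function of one increment *)

Section one_step_law.
Context {R : realType} {d : measure_display} {T : measurableType d}.
Variables (P : probability T R) (e : T -> R) (x0 r : R).
Hypothesis me : measurable_fun setT e.
Hypothesis ie : intg P e.
Hypothesis e0 : Ex P e = 0.
Hypothesis x0_gt0 : 0 < x0.
Hypotheses (r14 : 1 / 4 < r) (r12 : r < 1 / 2).

Definition tail (x : R) : R := Pr P [set w | x < `|e w|].
Hypothesis tail2 : forall x, x0 / 2 <= x -> tail (2 * x) <= r * tail x.

Definition scale (j : nat) : R := x0 * 2 ^+ j.
Definition core (j : nat) : set T := [set w | `|e w| <= scale j].
Definition trunc_var (j : nat) : R := Ex P (fun w => e w ^+ 2 * \1_(core j) w).
(** Its inverse is the order of the number of steps in which the walk spreads over distance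
    [scale j]. *)
Definition rate (j : nat) : R := trunc_var j / scale j ^+ 2.
Definition trunc_tail_mean (j : nat) : R :=
  Ex P (fun w => `|e w| * \1_(~` core j) w).

Lemma scale_gt0 j : 0 < scale j.
Proof. by rewrite mulr_gt0// exprn_gt0. Qed.

Lemma scaleS j : scale j.+1 = 2 * scale j.
Proof. by rewrite /scale exprS; ring. Qed.

Lemma scaleD j k : scale (j + k) = scale j * 2 ^+ k.
Proof. by rewrite /scale exprD mulrA. Qed.

Lemma scale_ge j : x0 <= scale j.
Proof. by rewrite ler_peMr ?(ltW x0_gt0)// exprn_ege1// ler1n. Qed.

Lemma measurable_core j : d.-measurable (core j).
Proof.
by apply: measurable_le => //; exact: measurableT_comp.
Qed.

Lemma measurable_coreC j : d.-measurable (~` core j).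
Proof. by apply: measurableC; exact: measurable_core. Qed.

Lemma coreCE j : ~` core j = [set w | scale j < `|e w|].
Proof. by apply/seteqP; split => w /=; rewrite /core /=; [move/negP; rewrite -ltNge|move=> h; apply/negP; rewrite -ltNge]. Qed.

Lemma tail_scale j : tail (scale j) = Pr P (~` core j).
Proof. by rewrite coreCE. Qed.

Lemma indicCE (A : set T) w : (\1_(~` A) w : R) = 1 - \1_A w.
Proof.
by rewrite !indicE in_setC; case: (w \in A); rewrite /= ?subr0 ?subrr.
Qed.

Lemma bmf_trunc2 j : bmf (fun w => e w ^+ 2 * \1_(core j) w).
Proof.
split.
  apply: measurable_funM; first exact: measurable_funX.
  exact/measurable_indic/measurable_core.
exists (scale j ^+ 2) => w; rewrite normrM normrX indicE.
case: (boolP (w \in core j)) => [|_]; last by rewrite /= normr0 mulr0 sqr_ge0.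
rewrite inE /core /= => h; rewrite normr1 mulr1.
by rewrite ler_sqr ?nnegrE// ltW// scale_gt0.
Qed.

Lemma intg_coreC j : intg P (fun w => `|e w| * \1_(~` core j) w).
Proof.
have ie' : P.-integrable setT (fun w => `|(e w)%:E|)%E by exact: integrable_abse.
apply: (le_integrable _ _ _ ie') => //.
  apply/measurable_EFinP; apply: measurable_funM.
    exact: measurableT_comp.
  exact/measurable_indic/measurable_coreC.
move=> w _ /=; rewrite lee_fin normrM !normr_id ler_piMr// indicE.
by case: (_ \in _); rewrite ?normr1 ?normr0.
Qed.


Lemma tail_ge0 x : 0 <= tail x. Proof. exact: Pr_ge0. Qed.

Lemma tail_decay j k : tail (scale (j + k)) <= r ^+ k * tail (scale j).
Proof.
elim: k => [|k IH]; first by rewrite addn0 expr0 mul1r.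
rewrite addnS scaleS; apply: (le_trans (tail2 _)).
  by have := scale_ge (j + k); have := x0_gt0; lra.
by rewrite exprS -mulrA ler_wpM2l//; have := r14; lra.
Qed.

Lemma trunc_var_ge0 j : 0 <= trunc_var j.
Proof. by apply: Ex_ge0 => w; rewrite mulr_ge0 ?sqr_ge0// indicE. Qed.

Lemma indic_in (A : set T) w : A w -> (\1_A w : R) = 1.
Proof. by move=> Aw; rewrite indicE mem_set. Qed.

Lemma indic_notin (A : set T) w : ~ A w -> (\1_A w : R) = 0.
Proof. by move=> Aw; rewrite indicE memNset. Qed.

Lemma trunc_varS j :
  trunc_var j.+1 <= trunc_var j + 4 * scale j ^+ 2 * tail (scale j).
Proof.
rewrite tail_scale -Ex_indic; last exact: measurable_coreC.
have b1 := bmf_trunc2 j.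
have b2 : bmf (fun w => 4 * scale j ^+ 2 * \1_(~` core j) w).
  by apply: bmfZ; apply: bmf_indic; exact: measurable_coreC.
rewrite -ExZ; last by apply: bmf_intg; apply: bmf_indic; exact: measurable_coreC.
rewrite -ExD; [|exact: bmf_intg..].
apply: Ex_le; [exact/bmf_intg/bmf_trunc2|exact/bmf_intg/bmfD|move=> w].
have s0 := scale_gt0 j; rewrite indicCE.
have [h|h] := pselect (core j w).
  rewrite (indic_in h) (@indic_in (core j.+1)); first by rewrite mulr1 subrr mulr0 addr0.
  by move: h; rewrite /core /= scaleS; lra.
rewrite (indic_notin h) mulr0 add0r subr0 mulr1.
have [h1|h1] := pselect (core j.+1 w); last by rewrite (indic_notin h1) mulr0 mulr_ge0// sqr_ge0.
rewrite (indic_in h1) mulr1; move: h1; rewrite /core /= scaleS => h1.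
by rewrite -real_normK ?num_real//; have := normr_ge0 (e w); nra.
Qed.

(** Let y be half of [scale j]. Values of modulus between y and 2y contribute at least y^2 each to
    the truncated variance, and as r < 1/2 the doubling bound makes their probability at least
    [tail (2 * y)]. *)
Lemma tail_le_rate j : tail (scale j) <= 4 * rate j.
Proof.
have s0 := scale_gt0 j; rewrite /rate mulrA ler_pdivlMr ?exprn_gt0//.
pose y := scale j / 2; pose B := [set w | y < `|e w|].
have mB : d.-measurable B.
  by apply: measurable_lt => //; exact: measurableT_comp.
have mC := measurable_coreC j.
have b1 := @bmf_indic R _ _ _ mB; have b2 := @bmf_indic R _ _ _ mC.
have : (scale j ^+ 2 / 4) * (tail y - tail (scale j)) <= trunc_var j.
  rewrite tail_scale -(Ex_indic _ mC) /tail -(Ex_indic _ mB) -ExB; [|exact: bmf_intg..].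
  have b3 : bmf (fun w => \1_B w - \1_(~` core j) w : R).
    exact: (bmfB b1 b2).
  rewrite -ExZ; last exact: bmf_intg.
  apply: Ex_le; [exact/bmf_intg/bmfZ|exact/bmf_intg/bmf_trunc2|move=> w].
  have [h|h] := pselect (core j w); last first.
    rewrite (@indic_in (~` core j))// (indic_notin h) mulr0.
    have [h1|h1] := pselect (B w); first by rewrite indic_in// subrr mulr0.
    by rewrite indic_notin// sub0r mulrN1 oppr_le0 divr_ge0// sqr_ge0.
  rewrite (@indic_notin (~` core j))// subr0 (indic_in h) mulr1.
  have [h1|h1] := pselect (B w); last by rewrite indic_notin// mulr0 sqr_ge0.
  rewrite indic_in// mulr1 -[X in _ <= X]real_normK ?num_real//.
  by move: h1; rewrite /B /= /y; nra.
have h2 : tail (scale j) <= r * tail y.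
  have E : scale j = 2 * y by rewrite /y; field.
  by rewrite {1}E; apply: tail2; rewrite /y; have := scale_ge j; lra.
have t0 := tail_ge0 y; have r2 := r12.
have h3 : tail (scale j) <= tail y - tail (scale j).
  have : r * tail y <= 1 / 2 * tail y by rewrite ler_wpM2r// ltW.
  lra.
move=> h4; have : scale j ^+ 2 / 4 * tail (scale j) <= trunc_var j.
  by apply: le_trans h4; rewrite ler_wpM2l// divr_ge0// sqr_ge0.
lra.
Qed.

Definition Cdecay : R := 1 + 16 / (4 * r - 1).

Lemma Cdecay_ge1 : 1 <= Cdecay.
Proof. by rewrite /Cdecay lerDl divr_ge0//; have := r14; lra. Qed.

(** From scale j + n to the next one the truncated variance gains at most 16 (4r)^n times its value
    at j. As 4r > 1, the sum of these gains is of the order of the last one. *)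
Lemma trunc_var_growth j k : trunc_var (j + k) <= Cdecay * (4 * r) ^+ k * trunc_var j.
Proof.
have r4 := r14; have V0 := trunc_var_ge0 j.
have z1 n : 1 <= (4 * r) ^+ n by rewrite exprn_ege1//; lra.
have H n : trunc_var (j + n) <=
    trunc_var j * (1 + 16 * ((4 * r) ^+ n - 1) / (4 * r - 1)).
  elim: n => [|n IH]; first by rewrite addn0 expr0 subrr mulr0 mul0r addr0 mulr1.
  rewrite addnS; apply: (le_trans (trunc_varS _)).
  have s2 : scale (j + n) ^+ 2 = scale j ^+ 2 * 4 ^+ n.
    by rewrite scaleD [(_ * 2 ^+ n) ^+ 2]exprMn -[(2 ^+ n) ^+ 2]exprM mulnC exprM; congr (_ * _ ^+ _); ring.
  have h1 : scale (j + n) ^+ 2 * tail (scale (j + n)) <= (4 * r) ^+ n * (4 * trunc_var j).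
    rewrite s2; apply: (@le_trans _ _ (scale j ^+ 2 * 4 ^+ n * (r ^+ n * tail (scale j)))).
      by rewrite ler_wpM2l ?tail_decay// mulr_ge0 ?sqr_ge0// exprn_ge0.
    rewrite [(4 * r) ^+ n]exprMn.
    have -> : scale j ^+ 2 * 4 ^+ n * (r ^+ n * tail (scale j)) =
      4 ^+ n * r ^+ n * (scale j ^+ 2 * tail (scale j)) by ring.
    rewrite ler_wpM2l//; first by rewrite mulr_ge0// exprn_ge0//; lra.
    have := tail_le_rate j; rewrite /rate mulrA ler_pdivlMr ?exprn_gt0 ?scale_gt0//.
    lra.
  rewrite -mulrA; apply: (@le_trans _ _ (trunc_var j *
    (1 + 16 * ((4 * r) ^+ n - 1) / (4 * r - 1)) + 4 * ((4 * r) ^+ n * (4 * trunc_var j)))).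
    by rewrite lerD// ler_wpM2l.
  rewrite le_eqVlt; apply/orP; left; apply/eqP; rewrite exprS; field.
  lra.
apply: (le_trans (H k)); rewrite mulrC ler_wpM2r// /Cdecay.
have := z1 k; set z := (4 * r) ^+ k => z1'.
have i0 : 0 < (4 * r - 1)^-1 by rewrite invr_gt0; lra.
by move: i0; set i := (4 * r - 1)^-1 => i0; nra.
Qed.

(** The factor r^k of [rate_decay] below is the growth (4r)^k of the truncated variance divided by
    the growth 4^k of the squared scale. *)
Lemma rate_ge0 j : 0 <= rate j.
Proof. by rewrite divr_ge0 ?trunc_var_ge0// sqr_ge0. Qed.

Lemma rate_decay j k : rate (j + k) <= Cdecay * r ^+ k * rate j.
Proof.
have s0 := scale_gt0 j.
rewrite /rate scaleD [(_ * 2 ^+ k) ^+ 2]exprMn -[(2 ^+ k) ^+ 2]exprM mulnC exprM.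
have -> : (2 ^+ 2 : R) = 4 by ring.
rewrite ler_pdivrMr; last by rewrite mulr_gt0// exprn_gt0.
apply: (le_trans (trunc_var_growth j k)).
rewrite [(4 * r) ^+ k]exprMn le_eqVlt; apply/orP; left; apply/eqP; field.
by rewrite gt_eqF.
Qed.

Lemma trunc_tail_mean_cvg : trunc_tail_mean j @[j --> \oo] --> (0 : R).
Proof.
have ie' : P.-integrable setT (fun w => `|(e w)%:E|)%E by exact: integrable_abse.
have h : (\int[P]_w (`|e w| * \1_(~` core j) w)%:E @[j --> \oo] -->
   \int[P]_w (cst 0%:E w))%E.
  apply: (dominated_cvg _ _ _ _ ie') => //.
  - by move=> n; have /integrableP[] := intg_coreC n.
  - move=> w _; apply: cvg_near_cst; near=> j.
    have hj : core j w.
      rewrite /core /=; have : `|e w| / x0 <= j%:R by near: j; exact: nbhs_infty_ger.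
      rewrite ler_pdivrMr// => h; apply: (le_trans h).
      rewrite /scale mulrC ler_wpM2l ?(ltW x0_gt0)//.
      by rewrite -natrX ler_nat ltnW// ltn_expl.
    by rewrite indicCE (indic_in hj) subrr mulr0.
  - move=> n w _ /=; rewrite lee_fin normrM normr_id ler_piMr// indicE.
    by case: (_ \in _); rewrite ?normr1 ?normr0.
move: h; rewrite integral_cst// mul0e => h.
exact: (fine_cvg h).
Unshelve. all: by end_near. Qed.

(** Each step up loses at most [2 * scale n * tail (scale n)], which decays like (2r)^n because r <
    1/2. The remainder of the telescoping sum vanishes by dominated convergence. *)
Lemma trunc_tail_mean_le j :
  trunc_tail_mean j <= 2 / (1 - 2 * r) * (scale j * tail (scale j)).
Proof.
have r2 := r12; have r4 := r14.
have step n : trunc_tail_mean n <= 2 * scale n * tail (scale n) + trunc_tail_mean n.+1.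
  have mC := measurable_coreC n.
  rewrite tail_scale -(Ex_indic _ mC) -ExZ; last exact/bmf_intg/bmf_indic.
  have b : bmf (fun w => 2 * scale n * \1_(~` core n) w) by exact/bmfZ/bmf_indic.
  have i1 := bmf_intg P b; have i2 := intg_coreC n.+1.
  rewrite -ExD//; apply: Ex_le; [exact: intg_coreC| |move=> w].
    by have := integrableD measurableT i1 i2.
  have s0 := scale_gt0 n; rewrite !indicCE.
  have [h|h] := pselect (core n w).
    rewrite (indic_in h) (@indic_in (core n.+1)) ?subrr ?mulr0 ?addr0//.
    by move: h; rewrite /core /= scaleS; lra.
  rewrite (indic_notin h) subr0 !mulr1.
  have [h1|h1] := pselect (core n.+1 w).
    rewrite (indic_in h1) subrr mulr0 addr0.
    by move: h1; rewrite /core /= scaleS.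
  by rewrite (indic_notin h1) subr0 mulr1 lerDr mulr_ge0// ltW.
have H n : trunc_tail_mean j <= 2 / (1 - 2 * r) * (scale j * tail (scale j)) +
    trunc_tail_mean (j + n).
  have H' : trunc_tail_mean j <= 2 * (scale j * tail (scale j)) * ((1 - (2 * r) ^+ n) / (1 - 2 * r)) +
    trunc_tail_mean (j + n).
    elim: n => [|n IH]; first by rewrite expr0 subrr mul0r mulr0 add0r addn0.
    apply: (le_trans IH); have := step (j + n)%N; rewrite -addnS => h.
    apply: (le_trans (lerD (lexx _) h)); rewrite addrA lerD//.
    have h3 : 2 * scale (j + n) * tail (scale (j + n)) <=
       2 * (scale j * tail (scale j)) * (2 * r) ^+ n.
      have -> : 2 * (scale j * tail (scale j)) * (2 * r) ^+ n =
        2 * scale (j + n) * (r ^+ n * tail (scale j)) by rewrite scaleD exprMn; ring.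
      by rewrite ler_wpM2l ?tail_decay// mulr_ge0// ltW// scale_gt0.
    apply: (le_trans (lerD (lexx _) h3)).
    rewrite le_eqVlt; apply/orP; left; apply/eqP; rewrite exprS; field; lra.
  apply: (le_trans H'); rewrite lerD//.
  have t0 := tail_ge0 (scale j); have s0 := scale_gt0 j.
  have -> : 2 / (1 - 2 * r) * (scale j * tail (scale j)) =
    2 * (scale j * tail (scale j)) * (1 / (1 - 2 * r)) by field; lra.
  rewrite ler_wpM2l//; first by rewrite mulr_ge0// mulr_ge0// ltW.
  rewrite ler_wpM2r ?invr_ge0; [by []|lra|].
  by rewrite gerBl exprn_ge0//; lra.
have c1 : 2 / (1 - 2 * r) * (scale j * tail (scale j)) +
    trunc_tail_mean (j + n) @[n --> \oo] --> 2 / (1 - 2 * r) * (scale j * tail (scale j)) + 0.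
  apply: cvgD; first exact: cvg_cst.
  under eq_fun do rewrite addnC.
  by have := trunc_tail_mean_cvg; rewrite -(cvg_shiftn j).
by rewrite -[X in _ <= X]addr0; apply: (cvgr_to_ge c1); exact: nearW.
Qed.


Definition Cmean : R := 8 / (1 - 2 * r).

Lemma Cmean_ge0 : 0 <= Cmean.
Proof. by rewrite divr_ge0//; have := r12; lra. Qed.

Lemma trunc_tail_mean_rate j : trunc_tail_mean j <= Cmean * (scale j * rate j).
Proof.
apply: (le_trans (trunc_tail_mean_le j)).
have -> : Cmean * (scale j * rate j) = 2 / (1 - 2 * r) * (scale j * (4 * rate j)).
  by rewrite /Cmean; ring.
rewrite ler_wpM2l//; first by rewrite divr_ge0//; have := r12; lra.
by rewrite ler_wpM2l ?tail_le_rate// ltW// scale_gt0.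
Qed.

Lemma bmf_trunc j : bmf (fun w => e w * \1_(core j) w).
Proof.
split.
  by apply: measurable_funM => //; exact/measurable_indic/measurable_core.
exists (scale j) => w; rewrite normrM.
have [h|h] := pselect (core j w); first by rewrite indic_in// normr1 mulr1.
by rewrite indic_notin// normr0 mulr0 ltW// scale_gt0.
Qed.

(** As the increment is centered, its truncated mean is the opposite of the mean that truncation
    discards. *)
Lemma trunc_mean_le j : `|Ex P (fun w => e w * \1_(core j) w)| <= Cmean * (scale j * rate j).
Proof.
have i1 := bmf_intg P (bmf_trunc j).
have -> : Ex P (fun w => e w * \1_(core j) w) =
    - Ex P (fun w => e w - e w * \1_(core j) w) by rewrite ExB// e0 sub0r opprK.
rewrite normrN; apply: (le_trans (normr_Ex _)).
  by have := integrableB measurableT ie i1.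
apply: le_trans (trunc_tail_mean_rate j).
rewrite le_eqVlt; apply/orP; left; apply/eqP; apply: eq_Ex => w.
rewrite indicCE -{1}[e w]mulr1 -mulrBr normrM; congr (_ * _).
by rewrite indicE; case: (_ \in _); rewrite ?subrr ?normr0// subr0 normr1.
Qed.

Lemma bmf_cos t : bmf (fun w => cos (t * e w)).
Proof.
split; last by exists 1 => w; exact: cos_max.
apply: measurableT_comp; first by apply: continuous_measurable_fun; exact: continuous_cos.
by apply: measurable_funM => //; exact: measurable_cst.
Qed.

Lemma bmf_sin t : bmf (fun w => sin (t * e w)).
Proof.
split; last by exists 1 => w; exact: sin_max.
apply: measurableT_comp; first by apply: continuous_measurable_fun; exact: continuous_sin.
by apply: measurable_funM => //; exact: measurable_cst.
Qed.

(** The core alone pushes the mean cosine down to 1 - rate / 16. Centering makes the mean sine of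
    order [rate], so its square is of second order, and the smallness assumption brings it below
    rate / 32. *)
Lemma char_bound j t : 1 / 2 <= t * scale j <= 1 -> 9 * rate j <= 1 ->
  32 * (1 + 2 * Cmean) ^+ 2 * rate j <= 1 ->
  Ex P (fun w => cos (t * e w)) ^+ 2 + Ex P (fun w => sin (t * e w)) ^+ 2 <=
  1 - rate j / 32.
Proof.
move=> /andP[ts1 ts2] q1 q2; have s0 := scale_gt0 j; have q0 := rate_ge0 j.
have t0 : 0 < t by rewrite -(pmulr_lgt0 _ s0); lra.
have mC := measurable_coreC j.
have bV := bmf_trunc2 j; have bC := @bmf_indic R _ _ _ mC.
have VE : trunc_var j = rate j * scale j ^+ 2.
  by rewrite /rate mulrVK// unitfE expf_neq0// gt_eqF.
have tV1 : t ^+ 2 * trunc_var j <= rate j.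
  rewrite VE mulrCA -exprMn ler_piMr// expr_le1//.
  by rewrite mulr_ge0// ltW.
have tV2 : rate j / 4 <= t ^+ 2 * trunc_var j.
  rewrite VE mulrCA -exprMn ler_wpM2l//.
  have -> : 4^-1 = (1 / 2) ^+ 2 :> R by field.
  by rewrite ler_sqr ?nnegrE//; lra.
have small w : core j w -> `|t * e w| <= 1.
  rewrite /core /= => h; rewrite normrM gtr0_norm//.
  by apply: le_trans ts2; rewrite ler_wpM2l// ltW.
have c_le : Ex P (fun w => cos (t * e w)) <= 1 - rate j / 16.
  have b1 : bmf (fun w => t ^+ 2 / 4 * (e w ^+ 2 * \1_(core j) w)) by exact: bmfZ.
  apply: (@le_trans _ _ (Ex P (fun w => 1 - t ^+ 2 / 4 * (e w ^+ 2 * \1_(core j) w)))).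
    apply: Ex_le; [exact/bmf_intg/bmf_cos|by apply/bmf_intg/bmfB => //; exact: bmf_cst|move=> w].
    have [h|h] := pselect (core j w); last by rewrite indic_notin// !mulr0 subr0 cos_le1.
    rewrite indic_in// mulr1; apply: (le_trans (cos_le_sqr (small w h))).
    by rewrite exprMn; lra.
  rewrite ExB; [|exact/bmf_intg/bmf_cst|exact: bmf_intg].
  rewrite Ex_cst ExZ; last exact: bmf_intg.
  rewrite -/(trunc_var j); lra.
(* Nonnegativity allows bounding the squared cosine mean by the mean itself. The core costs rate / 2
   and its complement 2 * (4 * rate), in total less than 9 * rate. *)
have c_ge : 0 <= Ex P (fun w => cos (t * e w)).
  have b1 : bmf (fun w => t ^+ 2 / 2 * (e w ^+ 2 * \1_(core j) w)) by exact: bmfZ.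
  have b2 : bmf (fun w => 2 * \1_(~` core j) w : R) by exact: bmfZ.
  apply: (@le_trans _ _ (Ex P (fun w => 1 - (t ^+ 2 / 2 * (e w ^+ 2 * \1_(core j) w) + 2 * \1_(~` core j) w)))); last first.
    apply: Ex_le; [apply/bmf_intg/bmfB; [exact: bmf_cst|exact: bmfD]|exact/bmf_intg/bmf_cos|move=> w].
    rewrite indicCE; have [h|h] := pselect (core j w).
      rewrite indic_in// subrr mulr0 addr0 mulr1.
      by have := cos_ge_sqr (t * e w); rewrite exprMn; lra.
    by rewrite indic_notin// !mulr0 add0r subr0 mulr1; have := cos_geN1 (t * e w); lra.
  rewrite ExB; [|exact/bmf_intg/bmf_cst|exact/bmf_intg/bmfD].
  rewrite Ex_cst ExD; [|exact: bmf_intg..].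
  rewrite !ExZ; [|exact: bmf_intg..].
  rewrite Ex_indic// -tail_scale -/(trunc_var j).
  have := tail_le_rate j; lra.
(* Subtracting t * e, of mean 0, leaves an error of at most (t * e)^2 on the core and 2 * t * |e|
   off it. *)
have s_le : `|Ex P (fun w => sin (t * e w))| <= (1 + 2 * Cmean) * rate j.
  have ite : intg P (fun w => t * e w).
    by have := integrableZl measurableT t ie.
  have -> : Ex P (fun w => sin (t * e w)) = Ex P (fun w => sin (t * e w) - t * e w).
    by rewrite ExB//; [rewrite ExZ// e0 mulr0 subr0|exact/bmf_intg/bmf_sin].
  have isub : intg P (fun w => sin (t * e w) - t * e w).
    by have := integrableB measurableT (bmf_intg P (bmf_sin t)) ite.
  apply: (le_trans (normr_Ex isub)).
  have iW := intg_coreC j.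
  have i2 : intg P (fun w => (2 * t) * (`|e w| * \1_(~` core j) w)).
    by have := integrableZl measurableT (2 * t) iW.
  have b1 : bmf (fun w => t ^+ 2 * (e w ^+ 2 * \1_(core j) w)) by exact: bmfZ.
  have i1 := bmf_intg P b1.
  have i12 : intg P (fun w => t ^+ 2 * (e w ^+ 2 * \1_(core j) w) +
       (2 * t) * (`|e w| * \1_(~` core j) w)).
    by have := integrableD measurableT i1 i2.
  apply: (@le_trans _ _ (Ex P (fun w => t ^+ 2 * (e w ^+ 2 * \1_(core j) w) +
       (2 * t) * (`|e w| * \1_(~` core j) w)))).
    apply: Ex_le => //.
      by have := integrable_abse isub; congr (P.-integrable _ _).
    move=> w; rewrite indicCE; have [h|h] := pselect (core j w).
      rewrite indic_in// subrr !mulr0 addr0 mulr1 -exprMn.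
      exact: sin_sub_le (small w h).
    rewrite indic_notin// !mulr0 add0r subr0 mulr1.
    apply: (le_trans (sin_sub_le2 _)).
    by rewrite normrM (gtr0_norm t0) mulrA.
  rewrite ExD// ExZ; last exact: bmf_intg.
  rewrite ExZ// -/(trunc_var j) -/(trunc_tail_mean j).
  have W1 := trunc_tail_mean_rate j; have C0 := Cmean_ge0.
  have : 2 * t * trunc_tail_mean j <= 2 * Cmean * rate j.
    apply: (@le_trans _ _ (2 * t * (Cmean * (scale j * rate j)))).
      by rewrite ler_wpM2l// mulr_ge0// ltW.
    have -> : 2 * t * (Cmean * (scale j * rate j)) = 2 * Cmean * rate j * (t * scale j) by ring.
    by rewrite ler_piMr// mulr_ge0// mulr_ge0.
  lra.
move: c_le c_ge s_le; set c := Ex P _; set s := Ex P _ => c1 c2 s1.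
have s2 : s ^+ 2 <= (1 + 2 * Cmean) ^+ 2 * rate j * rate j.
  rewrite -real_normK ?num_real//.
  have -> : (1 + 2 * Cmean) ^+ 2 * rate j * rate j = ((1 + 2 * Cmean) * rate j) ^+ 2 by ring.
  rewrite ler_sqr ?nnegrE// mulr_ge0//; have := Cmean_ge0; lra.
have s3 : (1 + 2 * Cmean) ^+ 2 * rate j * rate j <= rate j / 32.
  rewrite [X in _ <= X]mulrC ler_wpM2r//; lra.
have : c ^+ 2 <= c by rewrite expr2 ler_piMl//; lra.
lra.
Qed.

End one_step_law.

(** * Sums of increments: local bound and maximal inequality *)

HB.instance Definition _ := gen_eqMixin tm_index.

(** * Finite sums behind Fejer's kernel, and the geometric series *)

Section big_dist.
Context {R : realType}.

(** With truncated subtraction [(j - l) + (l - j)] is the distance of [j] and [l], and at most two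
    values of [l] share a distance. *)
Lemma sum_dist_le (f : nat -> R) (M j : nat) : (j < M)%N -> (forall l, 0 <= f l) ->
  \sum_(0 <= l < M) f ((j - l) + (l - j))%N <= 2 * \sum_(0 <= l < M) f l.
Proof.
move=> jM f0; rewrite (@big_cat_nat _ _ _ j)//=; last exact: ltnW.
rewrite mulr_natl mulr2n; apply: lerD.
  rewrite big_nat_rev/= add0n.
  rewrite (eq_big_nat _ _ (F2 := fun l => f l.+1)); last first.
    move=> l /andP[_ lj]; congr f; lia.
  rewrite -(big_add1 _ _ 0 j.+1 xpredT f) [X in _ <= X](@big_cat_nat _ _ _ j.+1)//=.
  rewrite [X in _ <= X + _]big_ltn// -addrA addrCA.
  by rewrite lerDl addr_ge0// sumr_ge0.
rewrite -{1}[j]add0n big_addn.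
rewrite (eq_big_nat _ _ (F2 := f)); last by move=> l _; congr f; lia.
by rewrite [X in _ <= X](@big_cat_nat _ _ _ (M - j))//= ?leq_subr// lerDl sumr_ge0.
Qed.

(** The squared modulus of the sum of e^(ijx), expanded over pairs; cosine is even, so only the
    distance of the two indices matters. *)
Lemma sqr_sum_cosDsin (M : nat) (x : R) :
  (\sum_(0 <= j < M) cos (j%:R * x)) ^+ 2 + (\sum_(0 <= j < M) sin (j%:R * x)) ^+ 2 =
  \sum_(0 <= j < M) \sum_(0 <= l < M) cos (((j - l) + (l - j))%N%:R * x).
Proof.
rewrite !expr2 !mulr_suml -big_split/=; apply: eq_bigr => j _.
rewrite !mulr_sumr -big_split/=; apply: eq_bigr => l _.
rewrite -cosB -mulrBl; have [jl|lj] := leqP j l.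
  have -> : (j - l)%N = 0%N by apply/eqP; rewrite subn_eq0.
  by rewrite add0n natrB// -cosN -mulNr opprB.
have -> : (l - j)%N = 0%N by apply/eqP; rewrite subn_eq0 ltnW.
by rewrite addn0 natrB// ltnW.
Qed.

Lemma geometric_le (z : R) (N : nat) : 0 <= z < 1 ->
  \sum_(0 <= k < N) z ^+ k <= (1 - z)^-1.
Proof.
move=> /andP[z0 z1]; rewrite -[_^-1]mul1r ler_pdivlMr ?subr_gt0//.
have -> : (\sum_(0 <= k < N) z ^+ k) * (1 - z) = 1 - z ^+ N.
  elim: N => [|N IH]; first by rewrite big_geq// mul0r expr0 subrr.
  by rewrite big_nat_recr//= mulrDl IH exprS; ring.
by rewrite gerBl exprn_ge0.
Qed.

End big_dist.

Section walk.
Context {R : realType} {d : measure_display} {T : measurableType d}.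
Variables (P : probability T R) (eps : nat -> T -> int) (E : nat -> T -> R).
Variables (tau : int -> T -> R) (x0 r : R).
Let X := tm_family eps E tau.
Hypothesis mX : forall i, measurable_fun setT (X i).
Hypothesis indX : mutually_independent P X.
Let er (j : nat) (w : T) : R := (eps j w)%:~R.
Hypothesis eps_ident : forall j, ident_distr P (er j) (er 0).
Hypothesis ie : intg P (er 0).
Hypothesis e0 : Ex P (er 0) = 0.
Hypothesis x0_gt0 : 0 < x0.
Hypotheses (r14 : 1 / 4 < r) (r12 : r < 1 / 2).
Let tl := tail P (er 0).
Hypothesis tail2 : forall x, x0 / 2 <= x -> tl (2 * x) <= r * tl x.
Let sc := scale x0.
Let q := rate P (er 0) x0.
Hypothesis q1 : forall j, 9 * q j <= 1.
Hypothesis q2 : forall j, 32 * (1 + 2 * Cmean r) ^+ 2 * q j <= 1.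
Hypothesis q_gt0 : forall j, 0 < q j.

(** Sums from an arbitrary starting index replace the Markov property: what follows step [n] is
    [block_sum n], independent of the first [n] increments. *)
Definition block_sum (n k : nat) (w : T) : R := \sum_(j < k) (eps (n + j) w)%:~R.

Definition eps_between (n m : nat) : set tm_index :=
  [set i | exists j, i = EpsIdx j /\ (n <= j < m)%N].

Lemma mer j : measurable_fun setT (er j). Proof. exact: (mX (EpsIdx j)). Qed.

Lemma block_sumS n k w : block_sum n k.+1 w = block_sum n k w + er (n + k) w.
Proof. by rewrite /block_sum big_ord_recr. Qed.

Lemma block_sum0 n w : block_sum n 0 w = 0.
Proof. by rewrite /block_sum big_ord0. Qed.

Lemma walkE n w : (walk eps n w)%:~R = block_sum 0 n w.
Proof. by rewrite /walk /block_sum rmorph_sum/=; apply: eq_bigr => j _; rewrite add0n. Qed.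

Lemma block_sumD n k l w : block_sum n (k + l) w = block_sum n k w + block_sum (n + k) l w.
Proof.
rewrite /block_sum big_split_ord/=; congr (_ + _).
by apply: eq_bigr => j _; rewrite addnA.
Qed.

Lemma block_sum_block (J : set tm_index) n k :
  (forall j, (n <= j < n + k)%N -> J (EpsIdx j)) ->
  measurable_fun (setT : set (block X J)) (block_sum n k : block X J -> R).
Proof.
move=> h; apply: measurable_sum => j.
apply: (@block_measurable_fun _ _ _ _ X J (EpsIdx (n + j))).
by apply: h; rewrite leq_addr ltn_add2l/=.
Qed.

Lemma measurable_block_sum n k : measurable_fun setT (block_sum n k).
Proof. by apply: measurable_sum => j; exact: mer. Qed.

Lemma Ex_block_indep (J K : set tm_index) (f g : T -> R) : J `&` K = set0 ->
  measurable_fun (setT : set (block X J)) (f : block X J -> R) ->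
  measurable_fun (setT : set (block X K)) (g : block X K -> R) ->
  (exists M, forall w, `|f w| <= M) -> (exists M, forall w, `|g w| <= M) ->
  Ex P (fun w => f w * g w) = Ex P f * Ex P g.
Proof.
move=> JK mf mg bf bg; apply: Ex_indep.
- by split => //; exact: (block_measurable_funW mX mf).
- by split => //; exact: (block_measurable_funW mX mg).
- move=> A B mA mB; apply: (block_indep mX indX JK).
  + by have := mf measurableT A mA; rewrite setTI.
  + by have := mg measurableT B mB; rewrite setTI.
Qed.

(** Real and imaginary parts of the characteristic function of a block. *)
Definition char_cos n k t := Ex P (fun w => cos (t * block_sum n k w)).
Definition char_sin n k t := Ex P (fun w => sin (t * block_sum n k w)).

Lemma measurable_cosM d' (S : measurableType d') (f : S -> R) t :
  measurable_fun setT f -> measurable_fun setT (fun w => cos (t * f w)).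
Proof.
move=> mf; apply: measurableT_comp.
  by apply: continuous_measurable_fun; exact: continuous_cos.
by apply: measurable_funM => //; exact: measurable_cst.
Qed.

Lemma measurable_sinM d' (S : measurableType d') (f : S -> R) t :
  measurable_fun setT f -> measurable_fun setT (fun w => sin (t * f w)).
Proof.
move=> mf; apply: measurableT_comp.
  by apply: continuous_measurable_fun; exact: continuous_sin.
by apply: measurable_funM => //; exact: measurable_cst.
Qed.

Lemma bmf_cosM (f : T -> R) (t : R) : measurable_fun setT f -> bmf (fun w : T => cos (t * f w) : R).
Proof. by move=> mf; split; [exact: measurable_cosM|exists 1 => w; exact: cos_max]. Qed.

Lemma bmf_sinM (f : T -> R) (t : R) : measurable_fun setT f -> bmf (fun w : T => sin (t * f w) : R).
Proof. by move=> mf; split; [exact: measurable_sinM|exists 1 => w; exact: sin_max]. Qed.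

(** The addition formulas reproduce complex multiplication, under which squared moduli multiply. *)
Lemma char_modulus n k t :
  char_cos n k t ^+ 2 + char_sin n k t ^+ 2 =
  (Ex P (fun w => cos (t * er 0 w)) ^+ 2 + Ex P (fun w => sin (t * er 0 w)) ^+ 2) ^+ k.
Proof.
elim: k => [|k IH].
  rewrite expr0 /char_cos /char_sin.
  under eq_Ex do rewrite block_sum0 mulr0 cos0.
  under [X in _ + X ^+ 2]eq_Ex do rewrite block_sum0 mulr0 sin0.
  by rewrite !Ex_cst expr1n expr0n/= addr0.
rewrite [RHS]exprSr -IH.
have mS := measurable_block_sum n k; have me := mer (n + k).
have mSb : measurable_fun (setT : set (block X (eps_between n (n + k)))) (block_sum n k : block X (eps_between n (n + k)) -> R).
  have h j : (n <= j < n + k)%N -> eps_between n (n + k) (EpsIdx j) by exists j.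
  exact: (block_sum_block h).
have meb : measurable_fun (setT : set (block X (eps_between (n + k) (n + k).+1)))
    (er (n + k) : block X (eps_between (n + k) (n + k).+1) -> R).
  have h : eps_between (n + k) (n + k).+1 (EpsIdx (n + k)).
    by exists (n + k)%N; rewrite leqnn ltnSn.
  exact: (block_measurable_fun h).
have disj : eps_between n (n + k) `&` eps_between (n + k) (n + k).+1 = set0.
  by rewrite -subset0 => i [[j [-> j1]] [l [[jl]]]]; rewrite -jl; lia.
have bc (f : T -> R) : (exists M, forall w, `|cos (t * f w)| <= M) by exists 1 => w; exact: cos_max.
have bs (f : T -> R) : (exists M, forall w, `|sin (t * f w)| <= M) by exists 1 => w; exact: sin_max.
have idc : Ex P (fun w => cos (t * er (n + k) w)) = Ex P (fun w => cos (t * er 0 w)).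
  have [| |_ //] := @Ex_ident _ _ _ P _ _ (fun x : R => cos (t * x)) me (mer 0) (eps_ident (n + k)) _ _.
    exact: (@measurable_cosM _ _ (fun x : R => x)).
  by apply: bmf_intg; exact: bmf_cosM (mer 0).
have ids : Ex P (fun w => sin (t * er (n + k) w)) = Ex P (fun w => sin (t * er 0 w)).
  have [| |_ //] := @Ex_ident _ _ _ P _ _ (fun x : R => sin (t * x)) me (mer 0) (eps_ident (n + k)) _ _.
    exact: (@measurable_sinM _ _ (fun x : R => x)).
  by apply: bmf_intg; exact: bmf_sinM (mer 0).
have Ec : char_cos n k.+1 t =
    char_cos n k t * Ex P (fun w => cos (t * er 0 w)) - char_sin n k t * Ex P (fun w => sin (t * er 0 w)).
  rewrite /char_cos; under eq_Ex do rewrite block_sumS mulrDr cosD.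
  rewrite ExB; last 2 first.
  - by apply: bmf_intg; apply: bmfM; apply: bmf_cosM.
  - by apply: bmf_intg; apply: bmfM; apply: bmf_sinM.
  by rewrite !(Ex_block_indep disj) ?idc ?ids//; (exact: measurable_cosM || exact: measurable_sinM).
have Es : char_sin n k.+1 t =
    char_sin n k t * Ex P (fun w => cos (t * er 0 w)) + char_cos n k t * Ex P (fun w => sin (t * er 0 w)).
  rewrite /char_sin; under eq_Ex do rewrite block_sumS mulrDr sinD.
  rewrite ExD; last 2 first.
  - by apply: bmf_intg; apply: bmfM; [apply: bmf_sinM|apply: bmf_cosM].
  - by apply: bmf_intg; apply: bmfM; [apply: bmf_cosM|apply: bmf_sinM].
  by rewrite !(Ex_block_indep disj) ?idc ?ids//; (exact: measurable_cosM || exact: measurable_sinM).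
by rewrite Ec Es; ring.
Qed.

(** The left-hand side is the absolute value of the real part of the characteristic function times
    e^(-ity), hence at most its modulus. *)
Lemma char_shift_le n k t y j : 1 / 2 <= t * sc j <= 1 ->
  `|Ex P (fun w => cos (t * (block_sum n k w - y)))| <= (1 - q j / 64) ^+ k.
Proof.
move=> tj; have mS := measurable_block_sum n k.
have q0 := q_gt0 j; have q9 := q1 j.
have Z0 : 0 <= 1 - q j / 64 by lra.
have -> : Ex P (fun w => cos (t * (block_sum n k w - y))) =
    cos (t * y) * char_cos n k t + sin (t * y) * char_sin n k t.
  under eq_Ex do rewrite mulrBr cosB [cos _ * _]mulrC [sin _ * _]mulrC.
  have bC : bmf (fun w => cos (t * block_sum n k w) : R) by exact: bmf_cosM.
  have bS : bmf (fun w => sin (t * block_sum n k w) : R) by exact: bmf_sinM.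
  rewrite ExD; [|exact/bmf_intg/bmfZ..].
  by rewrite !ExZ//; exact: bmf_intg.
have H := char_modulus n k t.
(* The halved constant serves to take a square root: (1 - q/64)^2 >= 1 - q/32. *)
have H2 : Ex P (fun w => cos (t * er 0 w)) ^+ 2 + Ex P (fun w => sin (t * er 0 w)) ^+ 2 <= (1 - q j / 64) ^+ 2.
  apply: (le_trans (char_bound (mer 0) ie e0 x0_gt0 r14 r12 tail2 tj (q1 j) (q2 j))).
  rewrite -/q; nra.
have H3 : char_cos n k t ^+ 2 + char_sin n k t ^+ 2 <= ((1 - q j / 64) ^+ k) ^+ 2.
  rewrite H exprAC lerXn2r// nnegrE ?sqr_ge0//.
  by rewrite addr_ge0// sqr_ge0.
rewrite -ler_sqr ?nnegrE ?exprn_ge0// real_normK ?num_real//; apply: le_trans H3.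
have := cos2Dsin2 (t * y); move: (char_cos n k t) (char_sin n k t) (cos (t * y)) (sin (t * y)).
move=> a b c s cs.
have -> : a ^+ 2 + b ^+ 2 = (c * a + s * b) ^+ 2 + (c * b - s * a) ^+ 2.
  by rewrite -[LHS]mul1r -cs; ring.
by rewrite lerDl sqr_ge0.
Qed.


(** Sum over i of 2^i * 64 * Cdecay * r^(i+1): the frequencies in [2^i, 2^(i+1)[ number 2^i, and
    [char_sum_le] bounds each. *)
Definition Cgreen : R := 64 * Cdecay r * r / (1 - 2 * r).

Lemma Cgreen_ge0 : 0 <= Cgreen.
Proof.
have C1 := Cdecay_ge1 r14.
rewrite divr_ge0//; last by have := r12; lra.
by rewrite mulr_ge0//; [rewrite mulr_ge0//; lra|have := r14; lra].
Qed.

(** * Expected number of visits to a point within [N] steps *)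

Section green.
Variables (n N m : nat) (y : R).
Let M := (2 ^ m)%N.

Definition char_sum (l : nat) : R := \sum_(0 <= k < N)
  `|Ex P (fun w => cos (l%:R / sc m * (block_sum n k w - y)))|.

Lemma char_sum_ge0 l : 0 <= char_sum l. Proof. exact: sumr_ge0. Qed.

Lemma char_sum0 : char_sum 0 <= N%:R.
Proof.
rewrite /char_sum; under eq_bigr do under eq_Ex do rewrite mul0r mul0r cos0.
under eq_bigr do rewrite Ex_cst normr1.
by rewrite big_const_nat subn0 iter_addr addr0.
Qed.

(** The frequency [l / sc m] is comparable to the inverse of the scale j = m - i - 1. There the
    geometric series sums to 64 / q j, and [rate_decay] turns 1 / q j into at most Cdecay * r^(i+1)
    / q m. *)
Lemma char_sum_le l i : (i < m)%N -> (2 ^ i <= l < 2 ^ i.+1)%N ->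
  char_sum l <= 64 * Cdecay r * r ^+ i.+1 / q m.
Proof.
move=> im /andP[il li]; pose j := (m - i.+1)%N.
have mE : m = (j + i.+1)%N by rewrite /j subnK.
have sj := scale_gt0 x0_gt0 j.
have p0 : 0 < (2 ^+ i.+1 : R) by rewrite exprn_gt0.
have tE : l%:R / sc m * sc j = l%:R / 2 ^+ i.+1.
  rewrite {1}mE /sc scaleD; field; rewrite !gt_eqF//.
have tj : 1 / 2 <= l%:R / sc m * sc j <= 1.
  rewrite tE; apply/andP; split; last by rewrite ler_pdivrMr// mul1r -natrX ler_nat ltnW.
  by rewrite ler_pdivlMr// -natrX expnS natrM mulrA divfK// mul1r ler_nat.
have q0 := q_gt0 j; have q9 := q1 j.
apply: (@le_trans _ _ (\sum_(0 <= k < N) (1 - q j / 64) ^+ k)).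
  by apply: ler_sum => k _; exact: char_shift_le.
apply: (le_trans (geometric_le _ _)); first by apply/andP; split; lra.
have -> : (1 - (1 - q j / 64))^-1 = 64 / q j by field; rewrite ?gt_eqF//.
have H := rate_decay (mer 0) x0_gt0 r14 r12 tail2 j i.+1.
rewrite -mE -/q in H.
rewrite ler_pdivrMr//.
have -> : 64 * Cdecay r * r ^+ i.+1 / q m * q j = 64 * Cdecay r * r ^+ i.+1 * q j / q m.
  by ring.
by rewrite ler_pdivlMr ?q_gt0//; lra.
Qed.

(** Frequency 0 contributes at most N. The dyadic blocks contribute a geometric series of ratio 2r <
    1, which is kept in closed form for the induction. *)
Lemma char_sum_total m' : (m' <= m)%N ->
  \sum_(0 <= l < 2 ^ m') char_sum l <= N%:R + Cgreen / q m * (1 - (2 * r) ^+ m').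
Proof.
have r4 := r14; have r2 := r12.
elim: m' => [|m' IH] mm.
  by rewrite expn0 big_nat1 expr0 subrr mulr0 addr0 char_sum0.
rewrite (@big_cat_nat _ _ _ (2 ^ m')%N)//=; last by rewrite leq_exp2l.
apply: (le_trans (lerD (IH (ltnW mm)) (lexx _))).
have H : \sum_(2 ^ m' <= l < 2 ^ m'.+1) char_sum l <=
    (2 ^ m')%:R * (64 * Cdecay r * r ^+ m'.+1 / q m).
  apply: (@le_trans _ _ (\sum_(2 ^ m' <= l < 2 ^ m'.+1) (64 * Cdecay r * r ^+ m'.+1 / q m))).
    rewrite !big_nat; apply: ler_sum => l h; exact: char_sum_le.
  have E2 : (2 ^ m'.+1 - 2 ^ m' = 2 ^ m')%N by rewrite expnS mul2n -addnn addnK.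
  move: (64 * _ * _ / _) => c; rewrite sumr_const_nat E2 -[c *+ _]mulr_natl.
  exact: lexx.
apply: (le_trans (lerD (lexx _) H)).
rewrite le_eqVlt; apply/orP; left; apply/eqP.
rewrite /Cgreen natrX !exprS exprMn; field.
have n1 : q m != 0 by rewrite gt_eqF ?q_gt0.
have n2 : 1 - 2 * r != 0 by rewrite gt_eqF//; lra.
by rewrite ?n1 ?n2.
Qed.

(* Fejer's kernel [|2^-m * sum_(j < 2^m) e^(i j x / sc m)|^2] is nonnegative and
   equals 1 at [x = 0], so its mean at [block_sum n k - y] dominates the
   probability that [block_sum n k = y]. It only involves frequencies up to
   [1 / x0], hence no aperiodicity of the increments is needed. *)
Lemma green_le : \sum_(0 <= k < N) Pr P [set w | block_sum n k w = y] <=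
  2 * (N%:R + Cgreen / q m) / (2 ^ m)%:R.
Proof.
have M0 : 0 < (M%:R : R) by rewrite ltr0n expn_gt0.
have step k : Pr P [set w | block_sum n k w = y] <=
   M%:R ^- 2 * \sum_(0 <= j < M) \sum_(0 <= l < M)
      `|Ex P (fun w => cos (((j - l) + (l - j))%N%:R / sc m * (block_sum n k w - y)))|.
  have mA : d.-measurable [set w | block_sum n k w = y].
    by apply: measurable_eq; exact: measurable_block_sum.
  have msy : measurable_fun setT (fun w => block_sum n k w - y).
    by apply: measurable_funB; [exact: measurable_block_sum|exact: measurable_cst].
  rewrite -(Ex_indic P mA).
  pose K w := M%:R ^- 2 * \sum_(0 <= j < M) \sum_(0 <= l < M)
      cos (((j - l) + (l - j))%N%:R / sc m * (block_sum n k w - y)).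
  have bK : bmf K.
    by apply: bmfZ; apply: bmf_sum => j; apply: bmf_sum => l; exact: bmf_cosM.
  apply: (@le_trans _ _ (Ex P K)).
    apply: Ex_le; [exact/bmf_intg/bmf_indic|exact: bmf_intg|move=> w].
    have KE : K w = M%:R ^- 2 * ((\sum_(0 <= j < M) cos (j%:R * ((block_sum n k w - y) / sc m))) ^+ 2 +
       (\sum_(0 <= j < M) sin (j%:R * ((block_sum n k w - y) / sc m))) ^+ 2).
      rewrite sqr_sum_cosDsin /K; congr (_ * _).
      by apply: eq_bigr => j _; apply: eq_bigr => l _; congr cos; ring.
    rewrite KE; have [h|h] := pselect (block_sum n k w = y); last first.
      by rewrite indic_notin// mulr_ge0 ?addr_ge0 ?sqr_ge0// invr_ge0 sqr_ge0.
    rewrite indic_in// h subrr mul0r.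
    under eq_bigr do rewrite mulr0 cos0.
    under [X in _ + X ^+ 2]eq_bigr do rewrite mulr0 sin0.
    rewrite big1_eq expr0n/= addr0 big_const_nat subn0 iter_addr addr0.
    by rewrite mulVf// gt_eqF// exprn_gt0.
  rewrite /K ExZ; last first.
    by apply: bmf_intg; apply: bmf_sum => j; apply: bmf_sum => l; exact: bmf_cosM.
  rewrite ler_wpM2l ?invr_ge0 ?sqr_ge0//.
  rewrite Ex_sum; last by move=> j; apply: bmf_sum => l; exact: bmf_cosM.
  apply: ler_sum => j _; rewrite Ex_sum; last by move=> l; exact: bmf_cosM.
  by apply: ler_sum => l _; exact: ler_norm.
apply: (le_trans (ler_sum _ (fun k _ => step k))).
rewrite -mulr_sumr exchange_big/=.
have inner j : (j < M)%N -> \sum_(0 <= k < N) \sum_(0 <= l < M)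
      `|Ex P (fun w => cos (((j - l) + (l - j))%N%:R / sc m * (block_sum n k w - y)))|
    <= 2 * (N%:R + Cgreen / q m).
  move=> jM; rewrite exchange_big/=.
  apply: (le_trans (@sum_dist_le _ char_sum M j jM char_sum_ge0)).
  rewrite ler_wpM2l//; apply: (le_trans (char_sum_total (leqnn m))).
  rewrite lerD// ler_piMr//.
    by rewrite divr_ge0 ?Cgreen_ge0// ltW// q_gt0.
  by rewrite gerBl exprn_ge0//; have := r14; lra.
apply: (@le_trans _ _ (M%:R ^- 2 * \sum_(0 <= j < M) (2 * (N%:R + Cgreen / q m)))).
  rewrite ler_wpM2l ?invr_ge0 ?sqr_ge0// !big_nat.
  by apply: ler_sum => j /andP[_]; exact: inner.
rewrite big_const_nat subn0 iter_addr addr0 -mulr_natr -/M.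
rewrite le_eqVlt; apply/orP; left; apply/eqP; field.
have n1 : q m != 0 by rewrite gt_eqF ?q_gt0.
have n2 : (M%:R : R) != 0 by rewrite gt_eqF.
by rewrite ?n1 ?n2.
Qed.

End green.

(** Truncation as a function on the line, so that [Ex_ident] transfers its moments from [er 0] to
    every increment. *)
Definition cut (j : nat) (x : R) : R := if `|x| <= sc j then x else 0.

Lemma cutE j i w : cut j (er i w) = er i w * \1_(core (er i) x0 j) w.
Proof.
rewrite /cut; case: ifPn => h; first by rewrite indic_in ?mulr1.
by rewrite indic_notin ?mulr0//; exact/negP.
Qed.

Lemma measurable_cut j : measurable_fun setT (cut j).
Proof.
apply: measurable_fun_ifT => //.
by apply: measurable_fun_ler => //; exact: measurableT_comp.
Qed.

Lemma bmf_cut j i : bmf (fun w => cut j (er i w)).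
Proof.
split; first by apply: measurableT_comp; [exact: measurable_cut|exact: mer].
exists (sc j) => w; rewrite /cut; case: ifPn => // _.
by rewrite normr0 ltW// scale_gt0.
Qed.

Lemma Ex_cut j i : Ex P (fun w => cut j (er i w)) = Ex P (fun w => cut j (er 0 w)).
Proof.
by have [|_ //] := Ex_ident (mer i) (mer 0) (eps_ident i) (measurable_cut j) _;
  exact: (bmf_intg P (bmf_cut j 0)).
Qed.

Lemma Ex_cut_sqr j i : Ex P (fun w => cut j (er i w) * cut j (er i w)) = trunc_var P (er 0) x0 j.
Proof.
have m2 : measurable_fun setT (fun x => cut j x * cut j x).
  by apply: measurable_funM; exact: measurable_cut.
have [|_] := Ex_ident (mer i) (mer 0) (eps_ident i) m2 _.
  exact: (bmf_intg P (bmfM (bmf_cut j 0) (bmf_cut j 0))).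
rewrite /= => H; transitivity (Ex P (fun w => cut j (er 0 w) * cut j (er 0 w))) => //.
apply: eq_Ex => w; rewrite cutE /core.
by rewrite indicE; case: (_ \in _); rewrite ?mulr1 ?mulr0 ?expr2//.
Qed.

Lemma Pr_large j i : Pr P [set w | sc j < `|er i w|] = tl (sc j).
Proof.
rewrite /tl /tail /Pr; congr fine.
have mB : measurable [set x : R | sc j < `|x|] by apply: measurable_lt => //; exact: measurableT_comp.
exact: (eps_ident i mB).
Qed.

(* Truncate the increments at [sc j] and apply Chebyshev's inequality without
   centering: the truncated means are negligible. *)
Lemma block_sum_tail n k j :
  Pr P [set w | sc j < `|block_sum n k w|] <=
  5 * (k%:R * q j) + (Cmean r * (k%:R * q j)) ^+ 2.
Proof.
have s0 := scale_gt0 x0_gt0 j.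
pose S w := \sum_(0 <= i < k) cut j (er (n + i) w).
have bS : bmf S by apply: bmf_sum => i; exact: bmf_cut.
pose A i := [set w | sc j < `|er (n + i) w|].
have mA i : d.-measurable (A i).
  by apply: measurable_lt => //; apply: measurableT_comp => //; exact: mer.
pose B := [set w | sc j < `|S w|].
have mB : d.-measurable B.
  by apply: measurable_lt => //; apply: measurableT_comp => //; case: bS.
have mU : d.-measurable (\bigcup_(i < k) A i) by exact: bigcup_measurable.
apply: (@le_trans _ _ (Pr P (\bigcup_(i < k) A i `|` B))).
  apply: le_Pr.
  - by apply: measurable_lt => //; apply: measurableT_comp => //; exact: measurable_block_sum.
  - exact: measurableU.
  move=> w /= h; have [[i /= ik Ai]|h2] := pselect (exists2 i, (i < k)%N & A i w).
    by left; exists i.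
  right; rewrite /B /=; have -> : S w = block_sum n k w.
    rewrite /S /block_sum big_mkord; apply: eq_bigr => i _; rewrite /cut.
    rewrite ifT// leNgt; apply/negP => hh; apply: h2; exists i => //.
  by [].
apply: (le_trans (PrU_le _ mU mB)).
(* Of the constant 5, a jump larger than [sc j] accounts for 4 and the variance of the truncated sum
   for 1. *)
have p1 : Pr P (\bigcup_(i < k) A i) <= 4 * (k%:R * q j).
  apply: (le_trans (Pr_bigcup_le _ _ mA)).
  under eq_bigr do rewrite Pr_large.
  rewrite sumr_const card_ord -[_ *+ _]mulr_natl [4 * _]mulrCA ler_wpM2l//.
  exact: (tail_le_rate (mer 0) x0_gt0 r12 tail2 j).
suff p2 : Pr P B <= k%:R * q j + (Cmean r * (k%:R * q j)) ^+ 2 by lra.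
have H : sc j ^+ 2 * Pr P B <= Ex P (fun w => S w * S w).
  rewrite -Ex_indic// -ExZ; last exact/bmf_intg/bmf_indic.
  apply: Ex_le; [exact/bmf_intg/bmfZ/bmf_indic|exact/bmf_intg/bmfM|move=> w].
  have [h|h] := pselect (B w); last by rewrite indic_notin// mulr0 -expr2 sqr_ge0.
  rewrite indic_in// mulr1 -expr2 -[X in _ <= X]real_normK ?num_real//.
  by rewrite ler_sqr ?nnegrE// ltW.
pose mu := Ex P (fun w => cut j (er 0 w)).
have cross i l : i != l ->
    Ex P (fun w => cut j (er (n + i) w) * cut j (er (n + l) w)) = mu ^+ 2.
  move=> il; rewrite (@Ex_block_indep [set EpsIdx (n + i)] [set EpsIdx (n + l)]).
  - by rewrite !Ex_cut expr2.
  - by rewrite -subset0 => _ [->] [] /= h; move: il; rewrite -(eqn_add2l n) h eqxx.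
  - apply: measurableT_comp; first exact: measurable_cut.
    exact: (@block_measurable_fun _ _ _ _ X [set EpsIdx (n + i)] (EpsIdx (n + i))).
  - apply: measurableT_comp; first exact: measurable_cut.
    exact: (@block_measurable_fun _ _ _ _ X [set EpsIdx (n + l)] (EpsIdx (n + l))).
  - by case: (bmf_cut j (n + i)).
  - by case: (bmf_cut j (n + l)).
(* The diagonal gives [k] truncated variances; every other pair factorizes into mu^2, and |mu| is at
   most Cmean * sc j * q j. *)
have ES : Ex P (fun w => S w * S w) <= k%:R * trunc_var P (er 0) x0 j + k%:R ^+ 2 * mu ^+ 2.
  under eq_Ex do rewrite {1}/S mulr_suml.
  rewrite Ex_sum; last by move=> i; apply: bmfM => //; exact: bmf_cut.
  have row i : (i < k)%N ->
      Ex P (fun w => cut j (er (n + i) w) * S w) <= trunc_var P (er 0) x0 j + k%:R * mu ^+ 2.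
    move=> ik; under eq_Ex do rewrite /S mulr_sumr.
    rewrite Ex_sum; last by move=> l; apply: bmfM; exact: bmf_cut.
    apply: (@le_trans _ _ (\sum_(0 <= l < k) ((if l == i then trunc_var P (er 0) x0 j else 0) + mu ^+ 2))).
      apply: ler_sum => l _; case: eqVneq => [->|li].
        by rewrite Ex_cut_sqr lerDl sqr_ge0.
      by rewrite cross 1?eq_sym// add0r.
    rewrite big_split/= sumr_const_nat subn0 -[mu ^+ 2 *+ k]mulr_natl lerD2r.
    by rewrite -big_mkcond/= big_nat1_eq ik.
  apply: (@le_trans _ _ (\sum_(0 <= i < k) (trunc_var P (er 0) x0 j + k%:R * mu ^+ 2))).
    by apply: ler_sum_nat => i /andP[_]; exact: row.
  move: (trunc_var P (er 0) x0 j) => V.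
  by rewrite sumr_const_nat subn0 -[(V + _) *+ k]mulr_natl mulrDr mulrA -expr2.
have VE : trunc_var P (er 0) x0 j = q j * sc j ^+ 2.
  by rewrite /q /rate mulrVK// unitfE expf_neq0// gt_eqF.
have muE : mu ^+ 2 <= (Cmean r * (sc j * q j)) ^+ 2.
  rewrite -[X in X <= _]real_normK ?num_real// ler_sqr ?nnegrE//.
    rewrite /mu; under eq_Ex do rewrite cutE.
    exact: (trunc_mean_le (mer 0) ie e0 x0_gt0 r14 r12 tail2 j).
  by rewrite mulr_ge0 ?(Cmean_ge0 r12)// mulr_ge0// ltW// q_gt0.
rewrite -(ler_pM2l (exprn_gt0 2 s0)); apply: (le_trans H); apply: (le_trans ES).
apply: (@le_trans _ _ (k%:R * (q j * sc j ^+ 2) + k%:R ^+ 2 * (Cmean r * (sc j * q j)) ^+ 2)).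
  by rewrite VE lerD// ler_wpM2l// sqr_ge0.
by rewrite le_eqVlt; apply/orP; left; apply/eqP; rewrite -/sc; ring.
Qed.

(* Ottaviani's inequality. *)
Lemma block_sum_max N L p : p <= 1 / 2 ->
  (forall n k, (n + k <= N)%N -> Pr P [set w | L < `|block_sum n k w|] <= p) ->
  Pr P [set w | exists2 k, (k < N)%N & 2 * L < `|block_sum 0 k w|] <= 2 * p.
Proof.
clear -mX indX er tl sc q.
move=> p12 hp.
pose G k := [set w | 2 * L < `|block_sum 0 k w|].
(* Decomposition by the first step [k] at which the walk is farther than 2L from the origin. *)
pose H k := G k `&` ~` \bigcup_(l < k) G l.
have mGb k (J : set tm_index) : eps_between 0 k `<=` J -> measurable (G k : set (block X J)).
  move=> h; apply: (@measurable_lt R _ (block X J)) => //.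
  apply: measurableT_comp => //; apply: block_sum_block => j jk; apply: h.
  by exists j.
have mHb k : measurable (H k : set (block X (eps_between 0 k))).
  apply: measurableI; first exact: mGb.
  apply: measurableC; apply: bigcup_measurable => l /= lk; apply: mGb.
  by move=> i [j [-> jl]]; exists j; split => //; lia.
have mH k : d.-measurable (H k) by exact: (block_measurable mX (mHb k)).
have tH : trivIset setT H.
  apply/trivIsetP => i j _ _ ij; rewrite -subset0 => w [[Gi ni] [Gj nj]].
  have [lij|lij] := ltnP i j; first by apply: nj; exists i.
  by apply: ni; exists j => //=; rewrite ltn_neqAle eq_sym ij.
pose F k := [set w | `|block_sum k (N - k) w| <= L].
have mF k : d.-measurable (F k).
  by apply: measurable_le => //; apply: measurableT_comp => //; exact: measurable_block_sum.
have mFb k : measurable (F k : set (block X (eps_between k (k + (N - k))))).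
  apply: (@measurable_le R _ (block X (eps_between k (k + (N - k))))) => //.
  by apply: measurableT_comp => //; apply: block_sum_block => j jk; exists j.
have mHF k : d.-measurable (H k `&` F k) by exact: measurableI.
(* After the first exit the remaining increments move the walk by at most L with probability at
   least 1/2, and then the walk is still farther than L at step N. *)
have half k : (k < N)%N -> Pr P (H k) <= 2 * Pr P (H k `&` F k).
  move=> kN; have disj : eps_between 0 k `&` eps_between k (k + (N - k)) = set0.
    by rewrite -subset0 => i [[j [-> j1]] [l [[jl]]]]; rewrite -jl; lia.
  have -> : Pr P (H k `&` F k) = Pr P (H k) * Pr P (F k).
    apply: EFin_inj; rewrite EFinM !PrK//.
    exact: (block_indep mX indX disj (mHb k) (mFb k)).
  have F12 : 1 / 2 <= Pr P (F k).
    have -> : F k = ~` [set w | L < `|block_sum k (N - k) w|].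
      apply/seteqP; split => w /=; rewrite /F /= leNgt; first by move/negP.
      by move=> h; apply/negP.
    rewrite PrC; last first.
      by apply: measurable_lt => //; apply: measurableT_comp => //; exact: measurable_block_sum.
    have := hp k (N - k)%N; rewrite subnKC ?(ltnW kN)// => /(_ (leqnn _)); lra.
  have := Pr_ge0 P (H k); nra.
have EH : [set w | exists2 k, (k < N)%N & 2 * L < `|block_sum 0 k w|] = \bigcup_(k < N) H k.
  apply/seteqP; split => w /=.
    move=> [k kN Gk].
    have ex : exists k, `[< G k w >] by exists k; apply/asboolP.
    case: (ex_minnP ex) => l /asboolP Gl lmin; exists l.
      by apply: leq_ltn_trans kN; apply: lmin; apply/asboolP.
    split => // -[i /= il Gi]; have := lmin i; rewrite leqNgt il => h.
    by have /h : `[< G i w >] by apply/asboolP.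
  by move=> [k kN [Gk _]]; exists k.
rewrite EH Pr_bigcup//.
apply: (@le_trans _ _ (\sum_(k < N) 2 * Pr P (H k `&` F k))).
  by apply: ler_sum => k _; exact: half.
have tHF : trivIset setT (fun k => H k `&` F k).
  by apply/trivIsetP => i j _ _ ij; rewrite setIACA; move/trivIsetP : tH => ->//; rewrite set0I.
rewrite -mulr_sumr ler_wpM2l// -(Pr_bigcup P N mHF tHF).
apply: le_trans (hp 0 N (leqnn _)); apply: le_Pr.
- exact: bigcup_measurable.
- by apply: measurable_lt => //; apply: measurableT_comp => //; exact: measurable_block_sum.
- move=> w [k /= kN [[Gk _] Fk]] /=.
  have -> : N = (k + (N - k))%N by rewrite subnKC// ltnW.
  rewrite block_sumD add0n; move: Gk Fk; rewrite /G /F /=.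
  set a := block_sum 0 k w; set b := block_sum _ _ w => h1 h2.
  have := lerB_normD a b; lra.
Qed.

End walk.

(** * The quenched walk in an environment dominated by one trap *)

Section quenched.
Context {R : realType} {d : measure_display} {T : measurableType d}.
Variables (P : probability T R) (eps : nat -> T -> int) (E : nat -> T -> R).
Variables (tau : int -> T -> R).
Let X := tm_family eps E tau.
Hypothesis mX : forall i, measurable_fun setT (X i).
Hypothesis indX : mutually_independent P X.
Hypothesis E_exp : forall n x, 0 <= x -> Pr P [set w | x < E n w] = expR (- x).
Let S (n k : nat) : T -> R := block_sum eps n k.

Variables (N : nat) (L g gb : R) (i : int).
Let ir : R := i%:~R.
(** [eta] is the probability that a clock exceeds 1. Below, [p] is the Paley-Zygmund bound mu^2 /
    (2M), with mean mu = eta * G, second moment at most M = 2 * G * gb, and G >= g. *)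
Let eta : R := expR (-1).
Let kap : R := g / gb.
Let p : R := eta ^+ 2 * kap / 4.
Hypothesis g_gt0 : 0 < g.
Hypothesis gb_gt0 : 0 < gb.
Hypothesis gbP : forall n y, \sum_(0 <= k < N) Pr P [set w | S n k w = y] <= gb.
Hypothesis gP : g <= \sum_(0 <= k < N) Pr P [set w | S 0 k w = ir].
Hypothesis LP : Pr P [set w | exists2 k, (k < N)%N & L < `|S 0 k w|] <= p / 4.

Let mS n k : measurable_fun setT (S n k).
Proof. exact: (measurable_block_sum mX). Qed.
Let mE n : measurable_fun setT (E n). Proof. exact: (mX (HoldIdx n)). Qed.
Let mSeq n k y : d.-measurable [set w | S n k w = y].
Proof. exact: measurable_eq. Qed.
Let mEgt n x : d.-measurable [set w | x < E n w].
Proof. exact: measurable_lt. Qed.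

Let eta_gt0 : 0 < eta. Proof. exact: expR_gt0. Qed.
Let eta_le : eta <= 1 / 2.
Proof.
rewrite /eta expRN div1r lef_pV2 ?posrE ?expR_gt0//.
by have := expR_ge1Dx (1 : R); rewrite [1 + 1](_ : _ = 2)//; ring.
Qed.
Let kap_gt0 : 0 < kap. Proof. exact: divr_gt0. Qed.
Let p_gt0 : 0 < p. Proof. by rewrite divr_gt0// mulr_gt0// exprn_gt0. Qed.

Lemma Pr_walk_clock k y x : 0 <= x ->
  Pr P ([set w | S 0 k w = y] `&` [set w | x < E k w]) =
  Pr P [set w | S 0 k w = y] * expR (- x).
Proof.
move=> x0; rewrite -(E_exp k x0); apply: EFin_inj; rewrite EFinM !PrK//; last exact: measurableI.
have disj : eps_between 0 k `&` [set HoldIdx k] = set0.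
  by rewrite -subset0 => j [[l [-> _]]].
apply: (block_indep mX indX disj).
  have h j : (0 <= j < 0 + k)%N -> eps_between 0 k (EpsIdx j) by exists j.
  exact: (@measurable_eq R _ (block X (eps_between 0 k)) _ y (block_sum_block h)).
apply: (@measurable_lt R _ (block X [set HoldIdx k])) => //.
exact: (@block_measurable_fun _ _ _ _ X [set HoldIdx k] (HoldIdx k)).
Qed.

(** The Markov property at step [n]: to be back at [y] means that the next [k] increments sum to
    0. *)
Lemma Pr_revisit n k y :
  Pr P ([set w | S 0 n w = y] `&` [set w | S 0 (n + k) w = y]) =
  Pr P [set w | S 0 n w = y] * Pr P [set w | S n k w = 0].
Proof.
have -> : [set w | S 0 n w = y] `&` [set w | S 0 (n + k) w = y] =
    [set w | S 0 n w = y] `&` [set w | S n k w = 0].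
  apply/seteqP; split => w [/= h1 h2]; split => //; move: h2; rewrite /S block_sumD add0n -/(S 0 n) h1.
    by move=> h; apply: (addrI y); rewrite addr0.
  by move=> ->; rewrite addr0.
apply: EFin_inj; rewrite EFinM !PrK//; last exact: measurableI.
have disj : eps_between 0 n `&` eps_between n (n + k) = set0.
  by rewrite -subset0 => j [[l [-> j1]] [m [[jl]]]]; rewrite -jl; lia.
apply: (block_indep mX indX disj).
  have h j : (0 <= j < 0 + n)%N -> eps_between 0 n (EpsIdx j) by exists j.
  exact: (@measurable_eq R _ (block X (eps_between 0 n)) _ y (block_sum_block h)).
have h j : (n <= j < n + k)%N -> eps_between n (n + k) (EpsIdx j) by exists j.
exact: (@measurable_eq R _ (block X (eps_between n (n + k))) _ 0 (block_sum_block h)).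
Qed.

Let G := \sum_(0 <= k < N) Pr P [set w | S 0 k w = ir].
(** Only visits whose clock exceeds 1 are counted: their number [Z] is bounded, and [s i * Z] is a
    lower bound for the time spent at [i]. *)
Let A k := [set w | S 0 k w = ir] `&` [set w | 1 < E k w].
Let mA k : d.-measurable (A k). Proof. exact: measurableI. Qed.
Let Z (w : T) : R := \sum_(0 <= k < N) \1_(A k) w.
Let bZ : bmf Z. Proof. by apply: bmf_sum => k; exact: bmf_indic. Qed.

Let ExZ1 : Ex P Z = eta * G.
Proof.
rewrite Ex_sum; last by move=> k; exact: bmf_indic.
rewrite /G mulr_sumr; apply: eq_bigr => k _.
by rewrite Ex_indic// Pr_walk_clock// mulrC.
Qed.

(** Order the two visits. Given the first one, the expected number of later returns before step N is
    at most [gb]. *)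
Let ExZ2 : Ex P (fun w => Z w * Z w) <= 2 * (G * gb).
Proof.
pose c k l := Pr P ([set w | S 0 k w = ir] `&` [set w | S 0 l w = ir]).
have mc k l : d.-measurable ([set w | S 0 k w = ir] `&` [set w | S 0 l w = ir]).
  exact: measurableI.
apply: (@le_trans _ _ (\sum_(0 <= k < N) \sum_(0 <= l < N) c k l)).
  have b k l : bmf (\1_([set w | S 0 k w = ir] `&` [set w | S 0 l w = ir]) : T -> R).
    exact: bmf_indic.
  apply: (@le_trans _ _ (Ex P (fun w => \sum_(0 <= k < N) \sum_(0 <= l < N)
      \1_([set w | S 0 k w = ir] `&` [set w | S 0 l w = ir]) w))).
    apply: Ex_le; [exact/bmf_intg/bmfM|by apply: bmf_intg; do 2! apply: bmf_sum => ?|move=> w].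
    rewrite {1}/Z mulr_suml; apply: ler_sum => k _; rewrite mulr_sumr.
    apply: ler_sum => l _.
    have [[Sk Ek]|h] := pselect (A k w); last by rewrite indic_notin// mul0r indicE.
    have [[Sl El]|h] := pselect (A l w); last by rewrite (indic_notin h) mulr0 indicE.
    by rewrite !indic_in// mulr1.
  rewrite Ex_sum; last by move=> k; apply: bmf_sum.
  apply: ler_sum => k _; rewrite Ex_sum//; apply: ler_sum => l _.
  by rewrite Ex_indic.
have c0 k l : 0 <= c k l by exact: Pr_ge0.
have cC k l : c k l = c l k by rewrite /c setIC.
have half : \sum_(0 <= k < N) \sum_(k <= l < N) c k l <= G * gb.
  rewrite /G mulr_suml; apply: ler_sum_nat => k /andP[_ kN].
  rewrite -{1}[k]add0n big_addn.
  under eq_bigr do rewrite /c addnC Pr_revisit.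
  rewrite -mulr_sumr ler_wpM2l ?Pr_ge0//.
  apply: le_trans (gbP k 0); rewrite [X in _ <= X](@big_cat_nat _ _ _ (N - k))//= ?leq_subr//.
  by rewrite lerDl sumr_ge0// => *; exact: Pr_ge0.
have split2 : \sum_(0 <= k < N) \sum_(0 <= l < N) c k l <=
   \sum_(0 <= k < N) \sum_(k <= l < N) c k l + \sum_(0 <= k < N) \sum_(k <= l < N) c k l.
  have -> : \sum_(0 <= k < N) \sum_(k <= l < N) c k l =
      \sum_(0 <= k < N) \sum_(0 <= l < N) (if (k <= l)%N then c k l else 0).
    apply: eq_big_nat => k /andP[_ kN]; rewrite -big_mkcond/=.
    by rewrite big_geq_mkord/= big_mkord.
  rewrite [X in _ <= _ + X]exchange_big -big_split/=; apply: ler_sum => k _.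
  rewrite -big_split/=; apply: ler_sum => l _.
  case: leqP => kl; first by rewrite lerDl; case: ifP.
  by rewrite ltnW// add0r cC.
by apply: (le_trans split2); rewrite mulr_natl mulr2n lerD.
Qed.

Let B0 := [set w | eta * g / 4 < Z w].
Let mB0 : d.-measurable B0. Proof. by apply: measurable_lt => //; case: bZ. Qed.

Let gG : g <= G. Proof. exact: gP. Qed.

(** Instead of the Cauchy-Schwarz inequality, the pointwise bound Z <= mu/4 + lam/2 * Z^2 + 1/(2
    lam) on B1, without the last term off B1, is integrated. With lam = mu / M it leaves mu/4 <= M /
    (2 mu) * P(B1). *)
Lemma paley_zygmund_visits : p <= Pr P B0.
Proof.
have G0 : 0 < G := lt_le_trans g_gt0 gG.
pose mu := eta * G; have mu0 : 0 < mu by exact: mulr_gt0.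
pose M := 2 * (G * gb); have M0 : 0 < M by rewrite mulr_gt0// mulr_gt0.
pose lam := mu / M; have lam0 : 0 < lam by exact: divr_gt0.
pose B1 := [set w | mu / 4 < Z w].
have mB1 : d.-measurable B1 by apply: measurable_lt => //; case: bZ.
have B10 : Pr P B1 <= Pr P B0.
  apply: le_Pr => // w; rewrite /B1 /B0 /=; apply: le_lt_trans.
  by rewrite ler_wpM2r// ler_wpM2l// ltW.
apply: le_trans B10.
have bB1 : bmf (fun w => mu / 4 + (lam / 2 * (Z w * Z w) + (2 * lam)^-1 * \1_B1 w)).
  by apply: bmfD; [exact: bmf_cst|apply: bmfD; apply: bmfZ; [exact: bmfM|exact: bmf_indic]].
have H : mu <= mu / 4 + (lam / 2 * M + (2 * lam)^-1 * Pr P B1).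
  rewrite {1}/mu -ExZ1.
  apply: (@le_trans _ _ (Ex P (fun w => mu / 4 + (lam / 2 * (Z w * Z w) + (2 * lam)^-1 * \1_B1 w)))).
    apply: Ex_le; [exact: bmf_intg|exact: bmf_intg|move=> w].
    have Z0 : 0 <= lam / 2 * (Z w * Z w) by rewrite mulr_ge0 ?divr_ge0 -?expr2 ?sqr_ge0// ltW.
    have [h|h] := pselect (B1 w).
      rewrite indic_in// mulr1.
      have E1 : lam / 2 * (Z w * Z w) + (2 * lam)^-1 - Z w = (lam * Z w - 1) ^+ 2 / (2 * lam).
        by field; rewrite gt_eqF.
      have : 0 <= (lam * Z w - 1) ^+ 2 / (2 * lam).
        by rewrite divr_ge0 ?sqr_ge0// mulr_ge0// ltW.
      lra.
    rewrite indic_notin// mulr0 addr0; apply: ler_wpDr => //.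
    by rewrite leNgt; apply/negP.
  rewrite ExD; [|exact/bmf_intg/bmf_cst|]; last first.
    by apply: bmf_intg; apply: bmfD; apply: bmfZ; [exact: bmfM|exact: bmf_indic].
  rewrite Ex_cst lerD2l ExD; last 2 first.
  - by apply: bmf_intg; apply: bmfZ; exact: bmfM.
  - by apply: bmf_intg; apply: bmfZ; exact: bmf_indic.
  rewrite !ExZ; [|exact/bmf_intg/bmf_indic|exact/bmf_intg/bmfM].
  rewrite Ex_indic// lerD2r ler_wpM2l//; first by rewrite divr_ge0// ltW.
have E1 : lam / 2 * M = mu / 2 by rewrite /lam; field; rewrite gt_eqF.
have E2 : (2 * lam)^-1 = M / (2 * mu) by rewrite /lam; field; rewrite !gt_eqF.
rewrite E1 E2 in H.
have H2 : mu / 4 <= M / (2 * mu) * Pr P B1 by lra.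
have H3 : mu ^+ 2 / (2 * M) <= Pr P B1.
  have -> : mu ^+ 2 / (2 * M) = mu / 4 * ((2 * mu) / M) by field; rewrite gt_eqF.
  apply: (@le_trans _ _ (M / (2 * mu) * Pr P B1 * ((2 * mu) / M))).
    by rewrite ler_wpM2r// divr_ge0// ?mulr_ge0// ltW.
  by rewrite le_eqVlt; apply/orP; left; apply/eqP; field; rewrite !gt_eqF.
apply: le_trans H3.
have -> : mu ^+ 2 / (2 * M) = eta ^+ 2 * (G / gb) / 4.
  by rewrite /mu /M; field; rewrite !gt_eqF.
by rewrite /p /kap ler_wpM2r// ler_wpM2l ?sqr_ge0// ler_wpM2r ?invr_ge0 ?(ltW gb_gt0).
Qed.


(** * The environment and the time spent away from its dominant trap *)

Variable s : int -> R.
Hypothesis s_gt0 : forall j, 0 < s j.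
Variable ball : seq int.
Hypothesis ball_uniq : uniq ball.
Hypothesis ballP : forall j : int, `|j%:~R| <= L -> j \in ball.
(** Chosen so that Markov's inequality at level Tm / 2, with mean at most 2 * gb * delta * s i,
    gives exactly p / 8. *)
Let delta : R := eta ^+ 3 * kap ^+ 2 / 512.
Hypothesis sP : \sum_(j <- ball | j != i) s j <= delta * s i.
Let theta : R := eta * g / 4.
Let Tm : R := s i * theta.

Let theta_gt0 : 0 < theta. Proof. by rewrite divr_gt0// mulr_gt0. Qed.
Let Tm_gt0 : 0 < Tm. Proof. exact: mulr_gt0. Qed.

Section clocks.
Variable K : nat.

(* A bounded majorant of the clock [E n] on the event [E n <= K], which keeps
   all expectations in the realm of bounded functions. *)
Definition clock_steps (n : nat) (w : T) : R := \sum_(0 <= k < K) \1_[set w | k%:R < E n w] w.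

Lemma clock_steps_ge n w : 0 < E n w <= K%:R -> E n w <= clock_steps n w.
Proof.
move=> /andP[E0 EK]; rewrite /clock_steps.
suff H m : (E n w <= m%:R -> E n w <= \sum_(0 <= k < m) (\1_[set w | k%:R < E n w] w : R)).
  exact: H.
elim: m => [|m IH] Em; first by move: E0; rewrite ltNge Em.
rewrite big_nat_recr//=; have [h|h] := leP (E n w) m%:R.
  by rewrite (le_trans (IH h))// lerDl indicE.
rewrite (@indic_in R _ _ [set w | m%:R < E n w])//.
have -> : \sum_(0 <= k < m) (\1_[set w | k%:R < E n w] w : R) = m%:R.
  rewrite (eq_big_nat _ _ (F2 := fun=> 1)); first by rewrite sumr_const_nat subn0.
  move=> k /andP[_ km]; rewrite indic_in//=; apply: le_lt_trans h.
  by rewrite ler_nat ltnW.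
by rewrite -[1]/(1%:R) -natrD addn1.
Qed.

Definition other_time (w : T) : R :=
  \sum_(0 <= n < N) \sum_(j <- ball | j != i) s j * (\1_[set w | S 0 n w = j%:~R] w * clock_steps n w).

Let bclock n : bmf (clock_steps n).
Proof. by apply: bmf_sum => k; exact: bmf_indic. Qed.

Let bterm n j : bmf (fun w => s j * (\1_[set w | S 0 n w = j%:~R] w * clock_steps n w)).
Proof. by apply: bmfZ; apply: bmfM => //; exact: bmf_indic. Qed.

Lemma bmf_other_time : bmf other_time.
Proof.
apply: bmf_sum => n; under eq_fun do rewrite -big_filter.
by apply: bmf_sum.
Qed.

(** The majorant of a clock has mean at most 1 / (1 - eta) <= 2 and is independent of the position
    of the walk; each site is visited at most [gb] times on average. *)
Lemma Ex_other_time : Ex P other_time <= 2 * gb * (delta * s i).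
Proof.
rewrite /other_time Ex_sum; last first.
  by move=> n; under eq_fun do rewrite -big_filter; apply: bmf_sum.
under eq_bigr do under eq_Ex do rewrite -big_filter.
under eq_bigr do rewrite Ex_sum//.
have term n j : Ex P (fun w => s j * (\1_[set w | S 0 n w = j%:~R] w * clock_steps n w)) <=
    2 * s j * Pr P [set w | S 0 n w = j%:~R].
  rewrite ExZ; last by apply: bmf_intg; apply: bmfM => //; exact: bmf_indic.
  rewrite [2 * s j]mulrC -mulrA ler_wpM2l ?(ltW (s_gt0 j))//.
  under eq_Ex do rewrite /clock_steps mulr_sumr.
  rewrite Ex_sum; last by move=> k; apply: bmfM; exact: bmf_indic.
  apply: (@le_trans _ _ (\sum_(0 <= k < K) Pr P [set w | S 0 n w = j%:~R] * eta ^+ k)).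
    apply: ler_sum => k _; rewrite -[eta ^+ k]expRM_natl mulrN1 -Pr_walk_clock//.
    rewrite -Ex_indic; last exact: measurableI.
    by rewrite le_eqVlt; apply/orP; left; apply/eqP; apply: eq_Ex => w; rewrite indicI.
  rewrite -mulr_sumr mulrC ler_wpM2r ?Pr_ge0//.
  have e1 := eta_le; have e0 := eta_gt0.
  apply: (le_trans (geometric_le _ _)); first by apply/andP; split; lra.
  have h : 0 < 1 - eta by lra.
  by rewrite -[_^-1]mul1r ler_pdivrMr//; lra.
apply: (@le_trans _ _ (\sum_(0 <= n < N) \sum_(j <- ball | j != i) 2 * s j * Pr P [set w | S 0 n w = j%:~R])).
  apply: ler_sum => n _; rewrite -[X in _ <= X]big_filter; apply: ler_sum => j _; exact: term.
rewrite exchange_big/=.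
apply: (@le_trans _ _ (\sum_(j <- ball | j != i) 2 * s j * gb)).
  by apply: ler_sum => j _; rewrite -mulr_sumr ler_wpM2l// mulr_ge0// ltW.
rewrite -mulr_suml -mulr_sumr [_ * gb]mulrAC ler_wpM2l//.
by rewrite mulr_ge0// ltW.
Qed.

(** Clocks are positive only almost surely, so their positivity, which makes the jump times
    increase, is part of the event. The bound [K] makes [clock_steps] a majorant. *)
Definition typical : set T :=
  B0 `&` ~` [set w | exists2 k, (k < N)%N & L < `|S 0 k w|] `&`
  \bigcap_(n < N) [set w | 0 < E n w <= K%:R] `&`
  [set w | other_time w <= Tm / 2].

Lemma measurable_clock n : d.-measurable [set w | 0 < E n w <= K%:R].
Proof.
have -> : [set w | 0 < E n w <= K%:R] = [set w | 0 < E n w] `&` [set w | E n w <= K%:R].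
  by apply/seteqP; split => w /=; [move/andP|move=> []] => //; move=> -> ->.
by apply: measurableI => //; exact: measurable_le.
Qed.

Lemma measurable_exceed : d.-measurable [set w | exists2 k, (k < N)%N & L < `|S 0 k w|].
Proof.
have -> : [set w | exists2 k, (k < N)%N & L < `|S 0 k w|] =
  \bigcup_(k < N) [set w | L < `|S 0 k w|] by [].
apply: bigcup_measurable => k _; apply: measurable_lt => //.
by apply: measurableT_comp => //; exact: mS.
Qed.

Lemma measurable_typical : d.-measurable typical.
Proof.
apply: measurableI; last by apply: measurable_le => //; case: bmf_other_time.
apply: measurableI; last by apply: bigcap_measurableType => n _; exact: measurable_clock.
by apply: measurableI => //; apply: measurableC; exact: measurable_exceed.
Qed.

(** The budget is p - p/4 - p/8 - p/8: visits, exit from the ball, clocks out of range, time at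
    other sites. *)
Lemma Pr_typical : N%:R * eta ^+ K <= p / 8 -> p / 2 <= Pr P typical.
Proof.
move=> NK; have p0 := p_gt0.
pose D1 := [set w | exists2 k, (k < N)%N & L < `|S 0 k w|].
pose D2 := \bigcup_(n < N) ~` [set w | 0 < E n w <= K%:R].
pose D3 := [set w | Tm / 2 < other_time w].
have mD1 : d.-measurable D1 := measurable_exceed.
have mD2 : d.-measurable D2.
  by apply: bigcup_measurable => n _; apply: measurableC; exact: measurable_clock.
have mD3 : d.-measurable D3 by apply: measurable_lt => //; case: bmf_other_time.
have sub : B0 `<=` typical `|` (D1 `|` (D2 `|` D3)).
  move=> w Bw; have [h1|h1] := pselect (D1 w); first by right; left.
  have [h2|h2] := pselect (D2 w); first by right; right; left.
  have [h3|h3] := pselect (D3 w); first by right; right; right.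
  left; split; last by rewrite /= leNgt; apply/negP.
  split=> // n /= nN; apply: contrapT => h; apply: h2; exists n => //.
have mty := measurable_typical.
have mD23 : d.-measurable (D2 `|` D3) by exact: measurableU.
have mD123 : d.-measurable (D1 `|` (D2 `|` D3)) by exact: measurableU.
have l0 := le_Pr P mB0 (measurableU _ _ mty mD123) sub.
have l1 := PrU_le P mty mD123; have l2 := PrU_le P mD1 mD23; have l3 := PrU_le P mD2 mD3.
have e1 := paley_zygmund_visits; have e2 := LP; rewrite -/D1 in e2.
have e3 : Pr P D2 <= p / 8.
  apply: (le_trans (Pr_bigcup_le _ _ _)).
    by move=> n; apply: measurableC; exact: measurable_clock.
  apply: le_trans NK; rewrite -[N in leRHS]card_ord -sum1_card natr_sum mulr_suml.
  apply: ler_sum => n _; rewrite mul1r.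
  rewrite PrC; last exact: measurable_clock.
  have : 1 <= Pr P [set w | 0 < E n w <= K%:R] + Pr P [set w | K%:R < E n w].
    apply: (@le_trans _ _ (Pr P [set w | 0 < E n w])).
      by rewrite E_exp// oppr0 expR0.
    apply: le_trans (PrU_le P (measurable_clock n) (mEgt n K%:R)).
    apply: le_Pr => //; first by apply: measurableU => //; exact: measurable_clock.
    by move=> w /= h; rewrite h; have [|] := leP (E n w) K%:R; [left|right].
  by rewrite E_exp// -[eta ^+ K]expRM_natl mulrN1; lra.
have e4 : Pr P D3 <= p / 8.
  have H : Tm / 2 * Pr P D3 <= 2 * gb * (delta * s i).
    apply: le_trans Ex_other_time; rewrite -Ex_indic// -ExZ; last exact/bmf_intg/bmf_indic.
    apply: Ex_le; [exact/bmf_intg/bmfZ/bmf_indic|exact/bmf_intg/bmf_other_time|move=> w].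
    have [h|h] := pselect (D3 w); first by rewrite indic_in// mulr1 ltW.
    rewrite indic_notin// mulr0; apply: sumr_ge0 => n _; apply: sumr_ge0 => j _.
    rewrite mulr_ge0 ?(ltW (s_gt0 j))// mulr_ge0 ?indicE//.
    by apply: sumr_ge0 => k _; rewrite indicE.
  have T2 : 0 < Tm / 2 by rewrite divr_gt0.
  rewrite -(ler_pM2l T2); apply: (le_trans H).
  rewrite le_eqVlt; apply/orP; left; apply/eqP.
  rewrite /delta /Tm /theta /p /kap; field; rewrite gt_eqF//.
lra.
Qed.

Lemma jump_timeS n w : jump_time s eps E n.+1 w = jump_time s eps E n w + s (walk eps n w) * E n w.
Proof. by []. Qed.

Lemma jump_time_sum n w : jump_time s eps E n w = \sum_(0 <= k < n) s (walk eps k w) * E k w.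
Proof.
elim: n => [|n IH]; first by rewrite big_geq.
by rewrite jump_timeS IH big_nat_recr.
Qed.

Lemma typical_clock w : typical w -> forall n, (n < N)%N -> 0 < E n w <= K%:R.
Proof. by move=> [[_ h] _] n nN; exact: h. Qed.

Lemma typical_total w : typical w -> Tm <= jump_time s eps E N w.
Proof.
move=> tw; have [[[Bw _] _] _] := tw; have Ew := typical_clock tw.
apply: (@le_trans _ _ (s i * Z w)).
  by rewrite /Tm ler_wpM2l// ltW.
rewrite jump_time_sum /Z mulr_sumr; apply: ler_sum_nat => n /andP[_ nN].
have /andP[E0 _] := Ew n nN.
have [[h1 h2]|h] := pselect (A n w); last by rewrite indic_notin// mulr0 mulr_ge0// ltW.
have wi : walk eps n w = i by apply: (@intr_inj R); rewrite walkE.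
by rewrite wi indic_in// ler_wpM2l// ltW.
Qed.

Lemma typical_other w : typical w ->
  \sum_(0 <= n < N | walk eps n w != i) s (walk eps n w) * E n w <= Tm / 2.
Proof.
move=> tw; have [[[Bw Lw] _] ow] := tw; have Ew := typical_clock tw.
apply: le_trans ow; rewrite /other_time big_mkcond/=.
apply: ler_sum_nat => n /andP[_ nN].
have t0 j : 0 <= s j * (\1_[set w | S 0 n w = j%:~R] w * clock_steps n w).
  rewrite mulr_ge0 ?(ltW (s_gt0 j))// mulr_ge0 ?indicE//.
  by apply: sumr_ge0 => k _; rewrite indicE.
case: ifPn => [wi|_]; last by apply: sumr_ge0.
have wb : walk eps n w \in ball.
  apply: ballP; rewrite walkE leNgt; apply/negP => h; apply: Lw; exists n => //.
rewrite -big_filter (bigD1_seq (walk eps n w)) ?mem_filter ?wi ?filter_uniq//=.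
apply: ler_wpDr; first by apply: sumr_ge0.
rewrite ler_wpM2l ?(ltW (s_gt0 _))// indic_in ?mul1r; first exact/clock_steps_ge/Ew.
by rewrite /= walkE.
Qed.

End clocks.


(** * Occupation of the site [i] during a window of times *)

Let mwalk n z : d.-measurable [set w | walk eps n w = z].
Proof.
have -> : [set w | walk eps n w = z] = [set w | S 0 n w = z%:~R].
  by apply/seteqP; split => w /=; rewrite /S -walkE; [move=> -> | move=> /intr_inj].
exact: mSeq.
Qed.

Lemma measurable_trap_walk n : measurable_fun setT (fun w => s (walk eps n w)).
Proof.
move=> _ B mB; rewrite setTI.
have -> : (fun w => s (walk eps n w)) @^-1` B =
    \bigcup_(z : int) ([set w | walk eps n w = z] `&` [set _ | B (s z)]).
  apply/seteqP; split => w /=; first by move=> Bw; exists (walk eps n w).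
  by move=> [z _ [<-]].
apply: countable_bigcupT_measurable => // z; apply: measurableI => //.
have [h|h] := pselect (B (s z)).
  by rewrite (_ : [set _ | _] = setT)//; apply/seteqP; split.
by rewrite (_ : [set _ | _] = set0)//; apply/seteqP; split.
Qed.

Lemma measurable_jump_time n : measurable_fun setT (jump_time s eps E n).
Proof.
elim: n => [|n IH]; first exact: measurable_cst.
apply: measurable_funD => //; apply: measurable_funM => //.
exact: measurable_trap_walk.
Qed.

(** The event as a set of pairs (time, outcome), on which Tonelli's theorem exchanges time and
    probability. *)
Let occupation : set (R * T) :=
  \bigcup_n ([set z | jump_time s eps E n z.2 <= z.1] `&`
    [set z | z.1 < jump_time s eps E n.+1 z.2] `&` [set z | walk eps n z.2 = i]).

Let occupationE t w : occupation (t, w) <-> trap_at s eps E t i w.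
Proof.
split; first by move=> [n _ [[/= h1 h2] h3]]; exists n; rewrite h1 h2.
by move=> [n [/andP[h1 h2] h3]]; exists n.
Qed.

Let moccupation : measurable occupation.
Proof.
apply: bigcupT_measurable => n; apply: measurableI.
  apply: measurableI.
    apply: measurable_le; last exact: measurable_fst.
    by apply: measurableT_comp; [exact: measurable_jump_time|exact: measurable_snd].
  apply: measurable_lt; first exact: measurable_fst.
  by apply: measurableT_comp; [exact: measurable_jump_time|exact: measurable_snd].
have := @measurable_snd _ _ R T measurableT _ (mwalk n i).
by rewrite setTI.
Qed.

Lemma measurable_trap_at t : d.-measurable (trap_at s eps E t i).
Proof.
have -> : trap_at s eps E t i = xsection occupation t.
  by apply/seteqP; split => w; rewrite /xsection /= inE => /occupationE.
exact: measurable_xsection.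
Qed.

(** Starting at a fixed fraction of [Tm] keeps the times large; the length 3 Tm / 4 still exceeds
    the Tm / 2 that other sites may take. *)
Let window : set R := [set` `[Tm / 4, Tm[].
Let Aw : set (R * T) := occupation `&` (window `*` setT).
Let mAw : measurable Aw.
Proof.
apply: measurableI; first exact: moccupation.
by apply: measurableX => //; exact: measurable_itv.
Qed.

Let mu := @lebesgue_measure R.

Let mu_itv (a b : R) : a < b -> mu [set` `[a, b[] = (b - a)%:E.
Proof. by move=> ab; rewrite /mu lebesgue_measure_itv /= lte_fin ab EFinB. Qed.

Lemma jump_interval m w t : 0 <= t < jump_time s eps E m w ->
  exists2 n, (n < m)%N & jump_time s eps E n w <= t < jump_time s eps E n.+1 w.
Proof.
elim: m => [|m IH] /andP[t0 tm]; first by move: tm; rewrite ltNge t0.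
have [h|h] := leP (jump_time s eps E m w) t; first by exists m => //; rewrite h.
have [|n nm hn] := IH; first by rewrite t0.
by exists n => //; exact: ltnW.
Qed.

(** The holding intervals before step N cover the window, and those away from [i] have total length
    at most Tm / 2. *)
Lemma occupation_time K w : typical K w -> ((Tm / 4)%:E <= mu (ysection Aw w))%E.
Proof.
move=> tw; have T0 := Tm_gt0.
pose Zn n : set R := if walk eps n w != i then
  [set` `[jump_time s eps E n w, jump_time s eps E n.+1 w[] else set0.
have mZn n : measurable (Zn n) by rewrite /Zn; case: ifP.
have mY : measurable (ysection Aw w) by exact: measurable_ysection.
have mU : measurable (\bigcup_(n < N) Zn n) by exact: bigcup_measurable.
have sub : window `<=` ysection Aw w `|` \bigcup_(n < N) Zn n.
  move=> t; rewrite /window /= in_itv/= => /andP[t1 t2].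
  have [|n nN hn] := @jump_interval N w t.
    rewrite (lt_le_trans t2 (typical_total tw)) andbT; apply: le_trans t1.
    by rewrite divr_ge0// ltW.
  have [wi|wi] := eqVneq (walk eps n w) i.
    left; rewrite /ysection /= inE; split; last by rewrite /window /= in_itv/= t1.
    by apply/occupationE; exists n.
  by right; exists n => //; rewrite /Zn wi.
have muW : mu window = (Tm * 3 / 4)%:E.
  rewrite [LHS]mu_itv; last by lra.
  by congr EFin; field.
have muZ : (mu (\bigcup_(n < N) Zn n) <= (Tm / 2)%:E)%E.
  rewrite bigcup_mkord.
  have := @Boole_inequality _ _ _ (@lebesgue_measure R) Zn N (fun n _ => mZn n).
  move=> /le_trans; apply.
  apply: le_trans (_ : (\sum_(n < N) (if walk eps n w != i then s (walk eps n w) * E n w else 0)%:E <= _)%E).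
    apply: lee_sum => n _; rewrite /Zn; case: ifP => _; last by rewrite measure0.
    have /andP[E0 _] := typical_clock tw (ltn_ord n).
    have jj : jump_time s eps E n w < jump_time s eps E n.+1 w.
      by rewrite jump_timeS ltrDl mulr_gt0.
    rewrite [X in (X <= _)%E](mu_itv jj) jump_timeS.
    by rewrite lee_fin addrAC subrr add0r.
  rewrite sumEFin lee_fin; apply: le_trans (typical_other tw).
  by rewrite big_mkord -big_mkcond.
have H : ((Tm * 3 / 4)%:E <= mu (ysection Aw w) + (Tm / 2)%:E)%E.
  rewrite -muW; apply: (@le_trans _ _ (mu (ysection Aw w `|` \bigcup_(n < N) Zn n))).
    apply: le_measure; rewrite ?inE//; last exact: measurableU.
    exact: measurable_itv.
  apply: (le_trans (measureU2 _ _ _)) => //.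
  by rewrite leeD2l.
have -> : (Tm / 4 = Tm * 3 / 4 - Tm / 2) by field.
by rewrite EFinB leeBlDr.
Qed.

Lemma exists_many_clocks : exists K, N%:R * eta ^+ K <= p / 8.
Proof.
have p0 := p_gt0; have e0 := eta_gt0; have e1 := eta_le.
have [K hK] : exists K : nat, N%:R * 8 / p <= K%:R.
  exists (Num.truncn (N%:R * 8 / p)).+1; apply: ltW.
  exact: truncnS_gt.
exists K; have h2 : 2 ^+ K * eta ^+ K <= 1.
  rewrite -exprMn exprn_ile1//; lra.
have h3 : (K%:R : R) <= 2 ^+ K by rewrite -natrX ler_nat ltnW// ltn_expl.
rewrite ler_pdivrMr// in hK.
have h4 : 0 <= eta ^+ K by rewrite exprn_ge0// ltW.
have : N%:R * 8 * eta ^+ K <= p * (2 ^+ K * eta ^+ K).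
  rewrite mulrA; apply: ler_wpM2r => //.
  by apply: (le_trans hK); rewrite mulrC ler_wpM2l// ltW.
have : p * (2 ^+ K * eta ^+ K) <= p by rewrite ler_piMr// ltW.
lra.
Qed.

(** If each time of the window charged [i] with probability below p / 8, the expected time at [i]
    within the window would be at most 3 p Tm / 32, while typical outcomes alone contribute (p / 2)
    * (Tm / 4). *)
Lemma quenched_lower_bound :
  exists t, s i * (eta * g / 16) <= t /\ p / 8 <= quenched_prob P s eps E t i.
Proof.
have T0 := Tm_gt0; have p0 := p_gt0.
have [K NK] := exists_many_clocks.
have mt := measurable_trap_at.
apply: contrapT => no.
have small t : window t -> quenched_prob P s eps E t i < p / 8.
  rewrite /window /= in_itv/= => /andP[t1 _]; rewrite ltNge; apply/negP => h.
  apply: no; exists t; split => //; apply: le_trans t1.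
  by rewrite le_eqVlt; apply/orP; left; apply/eqP; rewrite /Tm /theta; field.
have mW : measurable window by exact: measurable_itv.
have fub : (\int[mu]_t P (xsection Aw t) = \int[P]_w mu (ysection Aw w))%E.
  transitivity (\int[mu]_t fubini_F P (EFin \o \1_Aw) t)%E.
    apply: eq_integral => t _.
    exact: (esym (congr1 (fun f => f t) (indic_fubini_tonelli_FE P mAw))).
  rewrite [LHS](indic_fubini_tonelli (@lebesgue_measure R) P mAw).
  apply: eq_integral => w _.
  exact: (congr1 (fun f => f w) (indic_fubini_tonelli_GE (@lebesgue_measure R) mAw)).
have up : (\int[mu]_t P (xsection Aw t) <= (p / 8 * (Tm * 3 / 4))%:E)%E.
  apply: (@le_trans _ _ (\int[mu]_t ((p / 8)%:E * (\1_window t)%:E)))%E.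
    apply: ge0_le_integral => //.
    - exact: (measurable_fun_xsection P mAw).
    - by apply/measurable_EFinP; apply: measurable_funM => //; exact: measurable_indic.
    - move=> t _; have [h|h] := pselect (window t).
        rewrite indic_in// mule1; apply: (@le_trans _ _ (P (trap_at s eps E t i))).
          apply: le_measure; rewrite ?inE//; first exact: measurable_xsection.
          by move=> w; rewrite /xsection /= inE => -[/occupationE].
        by rewrite -PrK// lee_fin ltW//; exact: small.
      rewrite (_ : xsection Aw t = set0) ?measure0; last first.
        by apply/seteqP; split => w //; rewrite /xsection /= inE => -[_ []].
      by rewrite lee_fin mulr_ge0 ?indicE// ltW// divr_gt0.
  rewrite ge0_integralZl//; last 2 first.
  - by apply/measurable_EFinP; exact: measurable_indic.
  - by rewrite lee_fin ltW// divr_gt0.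
  rewrite integral_indic// setIT [X in (_ * X)%E]mu_itv; last by lra.
  rewrite -EFinM lee_fin ler_wpM2l//; first by rewrite ltW// divr_gt0.
  lra.
have mty := measurable_typical K.
have low : ((Tm / 4 * (p / 2))%:E <= \int[P]_w mu (ysection Aw w))%E.
  apply: (@le_trans _ _ (\int[P]_w ((Tm / 4)%:E * (\1_(typical K) w)%:E)))%E.
    rewrite ge0_integralZl//; last 2 first.
    - by apply/measurable_EFinP; exact: measurable_indic.
    - by rewrite lee_fin ltW// divr_gt0.
    rewrite integral_indic// setIT.
    rewrite [X in (_ <= _ * X)%E](_ : _ = (Pr P (typical K))%:E); last by rewrite PrK.
    rewrite -EFinM lee_fin ler_wpM2l//.
      by rewrite ltW// divr_gt0.
    exact: Pr_typical.
  apply: ge0_le_integral => //.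
  - by move=> w _; rewrite lee_fin mulr_ge0 ?indicE// ltW// divr_gt0.
  - by apply/measurable_EFinP; apply: measurable_funM => //; exact: measurable_indic.
  - exact: (measurable_fun_ysection (@lebesgue_measure R) mAw).
  - move=> w _; have [h|h] := pselect (typical K w).
      by rewrite indic_in// mule1; exact: occupation_time h.
    by rewrite indic_notin// mule0.
have : Tm / 4 * (p / 2) <= p / 8 * (Tm * 3 / 4).
  by rewrite -lee_fin (le_trans low)// -fub.
have : 0 < p * Tm by exact: mulr_gt0.
nra.
Qed.

End quenched.

(** * Sites that are visited often *)

Definition int_ball (n : nat) : seq int := [seq k%:Z - n%:Z | k <- iota 0 n.*2.+1].

Lemma mem_int_ball n (j : int) : (j \in int_ball n) = (absz j <= n)%N.
Proof.
apply/mapP/idP => [[k]|h].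
  by rewrite mem_iota => /andP[_ kn] ->; lia.
exists (absz (j + n%:Z)); last by lia.
by rewrite mem_iota; lia.
Qed.

Lemma int_ball_uniq n : uniq (int_ball n).
Proof. by rewrite map_inj_uniq ?iota_uniq// => x y; lia. Qed.

Lemma size_int_ball n : size (int_ball n) = n.*2.+1.
Proof. by rewrite size_map size_iota. Qed.

Lemma int_ball_normr (R : realType) n (j : int) : `|j%:~R : R| <= n%:R -> j \in int_ball n.
Proof.
by rewrite mem_int_ball -intr_norm -[n%:R]/(n%:Z%:~R) ler_int; lia.
Qed.

Lemma doubleS_le z : (0 < z)%N -> (z.*2.+1 <= 3 * z)%N.
Proof. by lia. Qed.

Section good_sites.
Context {R : realType} {d : measure_display} {T : measurableType d}.
Variables (P : probability T R) (eps : nat -> T -> int) (E : nat -> T -> R).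
Variables (tau : int -> T -> R) (x0n : nat) (r : R).
Let X := tm_family eps E tau.
Hypothesis mX : forall i, measurable_fun setT (X i).
Hypothesis indX : mutually_independent P X.
Let er (j : nat) (w : T) : R := (eps j w)%:~R.
Hypothesis eps_ident : forall j, ident_distr P (er j) (er 0).
Hypothesis ie : intg P (er 0).
Hypothesis e0 : Ex P (er 0) = 0.
Hypothesis x0n_gt0 : (0 < x0n)%N.
Let x0 : R := x0n%:R.
Hypotheses (r14 : 1 / 4 < r) (r12 : r < 1 / 2).
Let tl := tail P (er 0).
Hypothesis tail2 : forall x, x0 / 2 <= x -> tl (2 * x) <= r * tl x.
Let sc := scale x0.
Let q := rate P (er 0) x0.
Hypothesis q1 : forall j, 9 * q j <= 1.
Hypothesis q2 : forall j, 32 * (1 + 2 * Cmean r) ^+ 2 * q j <= 1.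
Hypothesis q_gt0 : forall j, 0 < q j.
Hypothesis E_exp : forall n x, 0 <= x -> Pr P [set w | x < E n w] = expR (- x).

Let x0_gt0 : 0 < x0. Proof. by rewrite ltr0n. Qed.

(** The rounding is harmless: [Nm m * q m] stays between 1/2 and 1. *)
Let Nm (m : nat) : nat := Num.truncn (q m)^-1.

Let Nq_le m : (Nm m)%:R * q m <= 1.
Proof.
apply: (@le_trans _ _ ((q m)^-1 * q m)); last by rewrite mulVf// lt0r_neq0.
by rewrite ler_wpM2r ?(ltW (q_gt0 m))// truncn_le invr_ge0 ltW.
Qed.

Let Nq_ge m : 1 <= 2 * (Nm m)%:R * q m.
Proof.
have h : 1 < ((Nm m)%:R + 1) * q m.
  apply: (@le_lt_trans _ _ ((q m)^-1 * q m)); first by rewrite mulVf// lt0r_neq0.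
  rewrite ltr_pM2r//.
  by have := truncnS_gt (q m)^-1; rewrite -natr1.
have := q1 m; lra.
Qed.

Let N_gt0 m : 0 < ((Nm m)%:R : R).
Proof. by rewrite ltr0n lt0n; apply/eqP => h; have := Nq_ge m; rewrite h; lra. Qed.

Let Cg : R := 2 * (1 + 2 * Cgreen r).
Let Cg_ge : 2 <= Cg.
Proof. by have := Cgreen_ge0 r14 r12; rewrite /Cg; lra. Qed.

Let greenb m n (y : R) :
  \sum_(0 <= k < Nm m) Pr P [set w | block_sum eps n k w = y] <= Cg * (Nm m)%:R / (2 ^ m)%:R.
Proof.
apply: (le_trans (green_le mX indX eps_ident ie e0 x0_gt0 r14 r12 tail2 q1 q2 q_gt0 n (Nm m) m y)).
rewrite ler_wpM2r ?invr_ge0// -/q -/x0 /Cg -mulrA ler_wpM2l// mulrDl mul1r lerD2l.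
rewrite ler_pdivrMr//.
have C0 := Cgreen_ge0 r14 r12.
have -> : 2 * Cgreen r * (Nm m)%:R * q m = Cgreen r * (2 * (Nm m)%:R * q m) by ring.
by rewrite ler_peMr.
Qed.

Let Ct : R := 5 * Cdecay r + (Cmean r * Cdecay r) ^+ 2.

(** By [rate_decay], k * q (m + l) is at most Cdecay * r^l, and r < 1/2. *)
Let tailb m l n k : (k <= Nm m)%N ->
  Pr P [set w | sc (m + l) < `|block_sum eps n k w|] <= Ct / 2 ^+ l.
Proof.
move=> kN; have Cd1 := Cdecay_ge1 r14; have Cm0 := Cmean_ge0 r12.
apply: (le_trans (block_sum_tail mX indX eps_ident ie e0 x0_gt0 r14 r12 tail2 q_gt0 n k (m + l))).
rewrite -/q; set z := k%:R * q (m + l).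
have z0 : 0 <= z by rewrite mulr_ge0// ltW.
have zb : z <= Cdecay r * r ^+ l.
  apply: (@le_trans _ _ ((Nm m)%:R * (Cdecay r * r ^+ l * q m))).
    apply: ler_pM => //; [exact: ltW|by rewrite ler_nat|].
    exact: (rate_decay (mer mX 0) x0_gt0 r14 r12 tail2 m l).
  rewrite mulrCA ler_piMr// mulr_ge0 ?exprn_ge0//; first lra.
  by have := r14; lra.
have rl : r ^+ l <= 2 ^- l.
  rewrite -exprVn lerXn2r ?nnegrE//; have := r14; have := r12; lra.
have p2 : 0 < (2 ^- l : R) by rewrite invr_gt0 exprn_gt0.
have p21 : (2 ^- l : R) <= 1 by rewrite invf_le1 ?exprn_gt0// exprn_ege1// ler1n.
have zb2 : z <= Cdecay r * 2 ^- l.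
  by apply: (le_trans zb); rewrite ler_wpM2l//; lra.
rewrite /Ct [X in _ <= X]mulrDl; apply: lerD; first by rewrite -mulrA ler_wpM2l.
apply: (@le_trans _ _ ((Cmean r * (Cdecay r * 2 ^- l)) ^+ 2)).
  have a1 : 0 <= Cmean r * z by exact: mulr_ge0.
  have a2 : Cmean r * z <= Cmean r * (Cdecay r * 2 ^- l) by exact: ler_wpM2l.
  by rewrite ler_sqr ?nnegrE// (le_trans a1 a2).
rewrite mulrA exprMn ler_wpM2l ?sqr_ge0// expr2.
by rewrite ler_piMr// ltW.
Qed.

Let tail_small (e : R) : 0 < e -> exists l, Ct / 2 ^+ l <= e.
Proof.
move=> e_gt0; have p2 l : 0 < (2 ^+ l : R) by rewrite exprn_gt0.
pose l := (Num.truncn (Ct / e)).+1; exists l.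
have : Ct / e < l%:R by exact: truncnS_gt.
rewrite ltr_pdivrMr// => h; rewrite ler_pdivrMr//; apply: (le_trans (ltW h)).
by rewrite mulrC ler_wpM2l ?(ltW e_gt0)// -natrX ler_nat ltnW// ltn_expl.
Qed.

(** All constants are uniform in [m], and the sites [I] are chosen before the environment [s]. Since
    2r < 1, the lower bound for [t] grows with [m] when [s i] is bounded below. *)
Lemma good_sites : exists (K : nat) (c delta p theta : R),
  [/\ (0 < K)%N, 0 < c, 0 < delta, 0 < p & 0 < theta] /\
  forall m, exists I : seq int,
  [/\ uniq I, c * (2 ^ m)%:R <= (size I)%:R,
      {in I, forall i, i \in int_ball (K * 2 ^ m)} &
      forall (s : int -> R) i, (forall j, 0 < s j) -> i \in I ->
        \sum_(j <- int_ball (K * 2 ^ m) | j != i) s j <= delta * s i ->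
        exists t, s i * (theta / (2 * r) ^+ m) <= t /\
                  p <= quenched_prob P s eps E t i].
Proof.
have [l1 hl1] : exists l, Ct / 2 ^+ l <= 1 / 2 by apply: tail_small; lra.
have Cd1 := Cdecay_ge1 r14.
pose K1 : nat := (x0n * 2 ^ l1)%N.
have K1_gt0 : (0 < K1)%N by rewrite muln_gt0 x0n_gt0 expn_gt0.
(* With this threshold the at most 3 * K1 * 2^m sites below [g] carry at most N / 4 visits. *)
pose c' : R := (12 * K1%:R)^-1.
have K1R : 0 < (K1%:R : R) by rewrite ltr0n.
have c'_gt0 : 0 < c' by rewrite invr_gt0 mulr_gt0.
have Cg_gt0 : 0 < Cg by have := Cg_ge; lra.
pose kap := c' / Cg; have kap_gt0 : 0 < kap by exact: divr_gt0.
pose eta : R := expR (-1); have eta_gt0 : 0 < eta by exact: expR_gt0.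
pose p := eta ^+ 2 * kap / 4.
have p_gt0 : 0 < p by rewrite divr_gt0// mulr_gt0// exprn_gt0.
(* Ottaviani's inequality requires the bound 1/2 and doubles both the probability p / 8, giving the
   required p / 4, and the radius, whence the last factor of [K2]. *)
have [l2 hl2] : exists l, Ct / 2 ^+ l <= Num.min (1 / 2) (p / 8).
  by apply: tail_small; rewrite lt_min; apply/andP; split; [lra|rewrite divr_gt0].
move: hl2; rewrite le_min => /andP[hl2 hl2'].
pose K2 := (x0n * 2 ^ l2 * 2)%N.
pose K := (K1 + K2)%N.
exists K, (4 * Cg)^-1, (eta ^+ 3 * kap ^+ 2 / 512), (p / 8), (eta * c' / (32 * Cdecay r)).
split.
  split; first by rewrite addn_gt0 K1_gt0.
  - by rewrite invr_gt0 mulr_gt0.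
  - by apply: divr_gt0; [apply: mulr_gt0; exact: exprn_gt0|rewrite ltr0n].
  - by rewrite divr_gt0.
  - by rewrite divr_gt0 ?mulr_gt0//; lra.
move=> m; have M0 : 0 < ((2 ^ m)%:R : R) by rewrite ltr0n expn_gt0.
have scE l : sc (m + l) = (x0n * 2 ^ l * 2 ^ m)%:R.
  by rewrite /sc /scale /x0 !natrM !natrX exprD; ring.
pose G (i : int) : R := \sum_(0 <= k < Nm m) Pr P [set w | block_sum eps 0 k w = i%:~R :> R].
pose g := c' * (Nm m)%:R / (2 ^ m)%:R.
pose gb := Cg * (Nm m)%:R / (2 ^ m)%:R.
have g_gt0 : 0 < g by rewrite divr_gt0// mulr_gt0.
have gb_gt0 : 0 < gb by rewrite divr_gt0// mulr_gt0.
have ggb : g / gb = kap by rewrite /g /gb /kap; field; rewrite !gt_eqF.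
exists [seq i <- int_ball (K1 * 2 ^ m) | g <= G i].
(* At each step before N the walk lies in the ball of radius K1 * 2^m with probability at least
   1/2. *)
have sumG : (Nm m)%:R / 2 <= \sum_(i <- int_ball (K1 * 2 ^ m)) G i.
  rewrite exchange_big/=.
  apply: (@le_trans _ _ (\sum_(0 <= k < Nm m) (1 / 2))).
    by rewrite sumr_const_nat subn0 -[X in _ <= X]mulr_natl div1r.
  apply: ler_sum_nat => k /andP[_ kN].
  pose ev := [set w | sc (m + l1) < `|block_sum eps 0 k w|].
  have mev : d.-measurable ev.
    by apply: measurable_lt => //; apply: measurableT_comp => //; exact: (measurable_block_sum mX).
  have h1 : Pr P ev <= 1 / 2 by apply: le_trans hl1; apply: tailb; exact: ltnW.
  have mi (i : int) : d.-measurable [set w | block_sum eps 0 k w = i%:~R :> R].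
    by apply: measurable_eq; exact: (measurable_block_sum mX).
  have h2 : 1 / 2 <= Pr P (~` ev) by rewrite PrC//; lra.
  apply: (le_trans h2); pose D (l : seq int) := \big[setU/set0]_(i <- l) [set w | block_sum eps 0 k w = i%:~R :> R].
  have mD l : d.-measurable (D l) by exact: bigsetU_measurable.
  have hD l : Pr P (D l) <= \sum_(i <- l) Pr P [set w | block_sum eps 0 k w = i%:~R :> R].
    elim: l => [|a l IH]; first by rewrite /D !big_nil Pr0.
    rewrite /D !big_cons; apply: (le_trans (PrU_le _ (mi a) (mD l))).
    by rewrite lerD2l.
  apply: le_trans (hD _); apply: le_Pr => //; first exact: measurableC.
  move=> w /= h; rewrite /D -bigcup_seq; exists (walk eps k w); last by rewrite /= walkE.
  apply: (@int_ball_normr R); rewrite walkE; move: h; rewrite /ev /= scE => /negP.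
  by rewrite -leNgt.
have Gub i : G i <= gb by exact: greenb.
have G0 i : 0 <= G i by apply: sumr_ge0 => k _; exact: Pr_ge0.
have pgm_ge1 : (1 <= K1 * 2 ^ m)%N by rewrite muln_gt0 K1_gt0 expn_gt0.
split.
- by rewrite filter_uniq// int_ball_uniq.
- have bad : \sum_(i <- int_ball (K1 * 2 ^ m) | ~~ (g <= G i)) G i <= (Nm m)%:R / 4.
    apply: (@le_trans _ _ (\sum_(i <- int_ball (K1 * 2 ^ m)) g)).
      rewrite big_mkcond/=; apply: ler_sum => i _; case: ifPn => [|_]; last exact: ltW.
      by rewrite -ltNge; exact: ltW.
    rewrite big_const_seq count_predT iter_addr addr0 size_int_ball.
    apply: (@le_trans _ _ ((3 * (K1 * 2 ^ m))%:R * g)).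
      by rewrite -[g *+ _]mulr_natl ler_wpM2r ?(ltW g_gt0)// ler_nat doubleS_le.
    rewrite le_eqVlt; apply/orP; left; apply/eqP.
    rewrite /g /c' !natrM; field; by rewrite !gt_eqF.
  have good : \sum_(i <- int_ball (K1 * 2 ^ m) | g <= G i) G i <=
      (size [seq i <- int_ball (K1 * 2 ^ m) | g <= G i])%:R * gb.
    rewrite -big_filter; apply: (@le_trans _ _ (\sum_(i <- [seq i <- int_ball (K1 * 2 ^ m) | g <= G i]) gb)).
      exact: ler_sum.
    by rewrite big_const_seq count_predT iter_addr addr0 -[gb *+ _]mulr_natl.
  (* The good sites carry the other N / 4 visits, at most [gb] each, so there are at least 2^m / (4
     Cg) of them. *)
  have tot : (Nm m)%:R / 4 <= (size [seq i <- int_ball (K1 * 2 ^ m) | g <= G i])%:R * gb.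
    apply: le_trans good; move: sumG; rewrite (bigID (fun i => g <= G i))/=; lra.
  rewrite -(ler_pM2r gb_gt0); apply: le_trans tot.
  rewrite le_eqVlt; apply/orP; left; apply/eqP.
  by rewrite /gb; field; rewrite !gt_eqF.
- move=> i; rewrite mem_filter !mem_int_ball => /andP[_ /leq_trans]; apply.
  by rewrite leq_mul2r /K leq_addr orbT.
- move=> s i s0; rewrite mem_filter => /andP[gi iI] hs.
  have LP : Pr P [set w | exists2 k, (k < Nm m)%N & ((K * 2 ^ m)%:R : R) < `|block_sum eps 0 k w|] <=
      eta ^+ 2 * (g / gb) / 4 / 4.
    rewrite ggb -/p.
    have hp n k : (n + k <= Nm m)%N -> Pr P [set w | sc (m + l2) < `|block_sum eps n k w|] <= p / 8.
      by move=> nk; apply: le_trans hl2'; apply: tailb; apply: leq_trans nk; exact: leq_addl.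
    have hp2 n k : (n + k <= Nm m)%N -> Pr P [set w | sc (m + l2) < `|block_sum eps n k w|] <= Num.min (1 / 2) (p / 8).
      move=> nk; rewrite le_min hp// andbT; apply: le_trans hl2; apply: tailb.
      by apply: leq_trans nk; exact: leq_addl.
    have m12 : Num.min (1 / 2) (p / 8) <= 1 / 2 by rewrite ge_min lexx.
    have := block_sum_max mX indX m12 hp2.
    move=> H; apply: (@le_trans _ _ (2 * Num.min (1 / 2) (p / 8))); last first.
      have : Num.min (1 / 2) (p / 8) <= p / 8 by rewrite ge_min lexx orbT.
      lra.
    apply: le_trans H; apply: le_Pr; try exact: (measurable_exceed mX).
    move=> w [k kN hk]; exists k => //; apply: le_lt_trans hk.
    rewrite scE /K /K2 mulnDl natrD; apply: ler_wpDl => //.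
    by rewrite -natrM ler_nat [(2 * _)%N]mulnC mulnAC.
  have hs' : \sum_(j <- int_ball (K * 2 ^ m) | j != i) s j <=
      eta ^+ 3 * (g / gb) ^+ 2 / 512 * s i by rewrite ggb.
  have [t [t1 t2]] := quenched_lower_bound mX indX E_exp g_gt0 gb_gt0
    (fun n y => greenb m n y) gi LP s0 (int_ball_uniq _) (@int_ball_normr R _) hs'.
  exists t; split; last by rewrite /p -ggb.
  apply: le_trans t1; rewrite ler_wpM2l ?(ltW (s0 i))//.
  have r0 : 0 < 2 * r by have := r14; lra.
  have rm0 : 0 < (2 * r) ^+ m by rewrite exprn_gt0.
  (* N is of order 1 / q m, and q m is at most Cdecay * r^m because q 0 <= 1. *)
  have H1 : (2 ^ m)%:R <= 2 * Cdecay r * (2 * r) ^+ m * (Nm m)%:R.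
    have qm : q m <= Cdecay r * r ^+ m.
      have := rate_decay (mer mX 0) x0_gt0 r14 r12 tail2 0 m; rewrite add0n -/q => h.
      apply: (le_trans h); rewrite ler_piMr//; last by have := q1 0; have := q_gt0 0; lra.
      by rewrite mulr_ge0 ?exprn_ge0//; have := r14; lra.
    have h2 := Nq_ge m.
    have h3 : 1 <= 2 * (Nm m)%:R * (Cdecay r * r ^+ m).
      by apply: (le_trans h2); rewrite ler_wpM2l// mulr_ge0.
    rewrite natrX exprMn -[X in X <= _]mulr1.
    have -> : 2 * Cdecay r * (2 ^+ m * r ^+ m) * (Nm m)%:R =
      2 ^+ m * (2 * (Nm m)%:R * (Cdecay r * r ^+ m)) by ring.
    by rewrite ler_wpM2l// exprn_ge0.
  rewrite ler_pdivrMr// /g.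
  have -> : eta * (c' * (Nm m)%:R / (2 ^ m)%:R) / 16 * (2 * r) ^+ m =
     eta * c' / (32 * Cdecay r) * ((2 * Cdecay r * (2 * r) ^+ m * (Nm m)%:R) / (2 ^ m)%:R).
    by field; rewrite gt_eqF//= gt_eqF//; lra.
  rewrite ler_peMr//; first by rewrite divr_ge0 ?mulr_ge0 ?ltW//; lra.
  by rewrite ler_pdivlMr// mul1r.
Qed.

End good_sites.

(** * Dominant traps in an independent environment *)

Section environment.
Context {R : realType} {d : measure_display} {T : measurableType d}.
Variables (P : probability T R) (eps : nat -> T -> int) (E : nat -> T -> R).
Variables (tau : int -> T -> R) (x0 rho : R).
Let X := tm_family eps E tau.
Hypothesis mX : forall i, measurable_fun setT (X i).
Hypothesis indX : mutually_independent P X.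
Hypothesis tau_gt0 : forall j w, 0 < tau j w.
Let F (x : R) : R := Pr P [set w | x < tau 0 w].
Hypothesis tau_tail : forall j x, Pr P [set w | x < tau j w] = F x.
Hypothesis x0_gt0 : 0 < x0.
Hypothesis rho12 : 1 / 2 < rho.
Hypothesis F2 : forall x, x0 <= x -> rho * F x <= F (2 * x).
Hypothesis F_gt0 : forall x, x0 <= x -> 0 < F x.
Let u (k : nat) : R := scale x0 k.

Let u_gt0 k : 0 < u k. Proof. exact: scale_gt0. Qed.
Let u_ge k : x0 <= u k. Proof. exact: scale_ge. Qed.
Let mtau j : measurable_fun setT (tau j). Proof. exact: (mX (TrapIdx j)). Qed.
Let mtau_gt j x : d.-measurable [set w | x < tau j w].
Proof. exact: measurable_lt. Qed.

Lemma PrU_disj A B : d.-measurable A -> d.-measurable B -> A `&` B = set0 ->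
  Pr P (A `|` B) = Pr P A + Pr P B.
Proof.
move=> mA mB AB; apply: EFin_inj; rewrite EFinD !PrK//; last exact: measurableU.
by rewrite measureU.
Qed.

Let bmin j k : bmf (fun w => Num.min (tau j w) (u k)).
Proof.
split; first by apply: measurable_minr => //; exact: measurable_cst.
exists (u k) => w; rewrite ger0_norm ?ge_min ?lexx ?orbT// le_min.
by rewrite !ltW.
Qed.

(** The first term starts the induction of [Ex_min_le]; the second one ensures Cmin + 1 <= 2 * rho *
    Cmin, which closes it. *)
Definition Cmin : R := (F x0)^-1 + (2 * rho - 1)^-1.

Lemma Cmin_gt0 : 0 < Cmin.
Proof. by rewrite addr_gt0// invr_gt0 ?F_gt0//; have := rho12; lra. Qed.

(** A Karamata-type bound: raising the truncation level to [u k.+1] adds at most [u k * F (u k)],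
    and this quantity grows at each step by a factor at least 2 rho > 1. *)
Lemma Ex_min_le j k : Ex P (fun w => Num.min (tau j w) (u k)) <= Cmin * (u k * F (u k)).
Proof.
have r12 := rho12; have C0 := Cmin_gt0.
have F0 : 0 < F x0 by exact: F_gt0.
have i0 : 0 < (2 * rho - 1)^-1 by rewrite invr_gt0; lra.
elim: k => [|k IH].
  have -> : u 0 = x0 by rewrite /u /scale expr0 mulr1.
  apply: (@le_trans _ _ x0).
    rewrite -[X in _ <= X](Ex_cst P); apply: Ex_le; [|exact/bmf_intg/bmf_cst|].
      by have := bmf_intg P (bmin j 0); rewrite /u /scale expr0 mulr1.
    by move=> w; rewrite ge_min lexx orbT.
  rewrite mulrCA ler_peMr ?(ltW x0_gt0)// /Cmin mulrDl mulVf ?gt_eqF// lerDl.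
  by rewrite mulr_ge0// ltW.
have uS : u k.+1 = 2 * u k by exact: scaleS.
have step : Ex P (fun w => Num.min (tau j w) (u k.+1)) <=
    Ex P (fun w => Num.min (tau j w) (u k)) + u k * F (u k).
  have bi : bmf (fun w => u k * \1_[set w | u k < tau j w] w : R).
    by apply: bmfZ; exact: bmf_indic.
  rewrite -(tau_tail j) -Ex_indic// -ExZ; last exact/bmf_intg/bmf_indic.
  rewrite -ExD; [|exact: bmf_intg..].
  apply: Ex_le; [exact: bmf_intg|exact/bmf_intg/bmfD|move=> w].
  have uk := u_gt0 k; have [h|h] := ltP (u k) (tau j w).
    rewrite indic_in// mulr1 uS minElt; case: ifPn; rewrite -?leNgt => h2; lra.
  rewrite indic_notin ?mulr0 ?addr0//=; last by apply/negP; rewrite -leNgt.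
  by rewrite min_l// uS; lra.
apply: (le_trans step); apply: (@le_trans _ _ ((Cmin + 1) * (u k * F (u k)))).
  by rewrite mulrDl mul1r lerD2r.
have h1 : u k * F (u k) <= (2 * rho)^-1 * (u k.+1 * F (u k.+1)).
  have := F2 (u_ge k); rewrite -uS => h.
  have -> : u k * F (u k) = (2 * rho)^-1 * (u k.+1 * (rho * F (u k))).
    by rewrite uS; field; lra.
  rewrite ler_wpM2l ?invr_ge0//; first lra.
  by rewrite ler_wpM2l// ltW.
apply: (@le_trans _ _ ((Cmin + 1) * ((2 * rho)^-1 * (u k.+1 * F (u k.+1))))).
  by rewrite ler_wpM2l// addr_ge0// ltW.
have : 0 <= u k.+1 * F (u k.+1) by rewrite mulr_ge0 ?Pr_ge0// ltW.
move: (u k.+1 * _) => z z0; rewrite [X in X <= _]mulrA ler_wpM2r//.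
rewrite ler_pdivrMr; last lra.
have h2 : 1 <= Cmin * (2 * rho - 1).
  rewrite /Cmin mulrDl mulVf; last lra.
  by rewrite lerDr mulr_ge0// ?invr_ge0 ?(ltW F0)//; lra.
lra.
Qed.

Lemma bmf_sum_min (S : seq int) k : bmf (fun w => \sum_(j <- S) Num.min (tau j w) (u k)).
Proof. exact: bmf_sum. Qed.

Lemma measurable_sum_tau (S : seq int) (Q : pred int) :
  measurable_fun setT (fun w => \sum_(j <- S | Q j) tau j w).
Proof.
under eq_fun do rewrite -big_filter.
exact: measurable_sum.
Qed.

(** Markov's inequality for the traps truncated at [u k]. Truncation does not hide the event: a
    single trap above [u k] makes the truncated sum at least u k >= v * u k. *)
Lemma sum_tau_tail (S : seq int) (Q : pred int) v k : 0 < v <= 1 ->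
  Pr P [set w | v * u k < \sum_(j <- S | Q j) tau j w] <=
  (size S)%:R * (Cmin * F (u k)) / v.
Proof.
move=> /andP[v0 v1]; have u0 := u_gt0 k.
pose B := [set w | v * u k < \sum_(j <- S | Q j) tau j w].
have mB : d.-measurable B by apply: measurable_lt => //; exact: measurable_sum_tau.
have vu : 0 < v * u k by exact: mulr_gt0.
rewrite ler_pdivlMr// mulrC -(ler_pM2l u0).
apply: (@le_trans _ _ (Ex P (fun w => \sum_(j <- S) Num.min (tau j w) (u k)))).
  rewrite mulrA [u k * v]mulrC -Ex_indic// -ExZ; last exact/bmf_intg/bmf_indic.
  apply: Ex_le; [exact/bmf_intg/bmfZ/bmf_indic|exact/bmf_intg/bmf_sum_min|move=> w].
  have m0 j : 0 <= Num.min (tau j w) (u k) by rewrite le_min !ltW.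
  have [h|h] := pselect (B w); last by rewrite indic_notin// mulr0 sumr_ge0.
  rewrite indic_in// mulr1.
  have [/hasP[j jS]|/hasPn nh] := boolP (has (fun j => u k < tau j w) S).
    move=> hj; rewrite (big_rem j)//= min_r ?(ltW hj)//.
    apply: ler_wpDr; first exact: sumr_ge0.
    by rewrite ler_piMl// ltW.
  apply: (le_trans (ltW h)); rewrite big_mkcond/= !big_seq; apply: ler_sum => j jS.
  case: ifP => // _; rewrite min_l//.
  by have := nh j jS; rewrite -leNgt.
rewrite Ex_sum// big_seq.
apply: (@le_trans _ _ (\sum_(j <- S | j \in S) (Cmin * (u k * F (u k))))).
  by apply: ler_sum => j _; exact: Ex_min_le.
rewrite -big_seq big_const_seq count_predT iter_addr addr0.
move: (F (u k)) => f; rewrite -[X in X <= _]mulr_natl.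
by rewrite le_eqVlt; apply/orP; left; apply/eqP; ring.
Qed.

Definition traps (S : seq int) : set tm_index := [set i | exists2 j, j \in S & i = TrapIdx j].

Definition spike_at (S : seq int) (v y : R) (i : int) : set T :=
  [set w | y < tau i w] `&` [set w | \sum_(j <- S | j != i) tau j w <= v * y].

Definition spike (S I : seq int) (v y : R) : set T :=
  \big[setU/set0]_(i <- I) spike_at S v y i.

Lemma spikeP S I v y w : spike S I v y w <-> exists2 i, i \in I & spike_at S v y i w.
Proof. by rewrite /spike -bigcup_seq; split=> -[i iI h]; exists i. Qed.

Lemma sum_tau_block (S : seq int) (Q : pred int) (J : set tm_index) :
  (forall j, j \in S -> Q j -> J (TrapIdx j)) ->
  measurable_fun (setT : set (block X J)) ((fun w => \sum_(j <- S | Q j) tau j w) : block X J -> R).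
Proof.
elim: S => [|a S IH] h.
  by under eq_fun do rewrite big_nil; exact: measurable_cst.
under eq_fun do rewrite big_cons.
have IHS := IH (fun j jS => h j (mem_behead (s := a :: S) jS)).
case Qa : (Q a) => //; apply: measurable_funD => //.
by apply: (@block_measurable_fun _ _ _ _ X J (TrapIdx a)); apply: h => //; exact: mem_head.
Qed.

Lemma spike_at_block S v y i (J : set tm_index) : i \in S -> traps S `<=` J ->
  measurable (spike_at S v y i : set (block X J)).
Proof.
move=> iS SJ; apply: measurableI.
  apply: (@measurable_lt R _ (block X J)) => //.
  by apply: (@block_measurable_fun _ _ _ _ X J (TrapIdx i)); apply: SJ; exists i.
apply: (@measurable_le R _ (block X J)) => //; apply: sum_tau_block => j jS _.
by apply: SJ; exists j.
Qed.

Lemma spike_block S I v y (J : set tm_index) : {subset I <= S} -> traps S `<=` J ->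
  measurable (spike S I v y : set (block X J)).
Proof.
move=> IS SJ; rewrite /spike big_seq; apply: bigsetU_measurable => i iI.
by apply: spike_at_block => //; exact: IS.
Qed.

Lemma measurable_spike_at S v y i : d.-measurable (spike_at S v y i).
Proof.
apply: measurableI => //; apply: measurable_le => //; exact: measurable_sum_tau.
Qed.

Lemma measurable_spike S I v y : d.-measurable (spike S I v y).
Proof. by apply: bigsetU_measurable => i _; exact: measurable_spike_at. Qed.

(** The trap at [i] is independent of the others, whose sum is at most v * u k with probability at
    least 1/2 by the size condition. *)
Lemma Pr_spike_at S v k i : 0 < v <= 1 ->
  (size S)%:R * (Cmin * F (u k)) / v <= 1 / 2 -> F (u k) / 2 <= Pr P (spike_at S v (u k) i).
Proof.
move=> v01 hS.
have -> : Pr P (spike_at S v (u k) i) =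
   F (u k) * Pr P [set w | \sum_(j <- S | j != i) tau j w <= v * u k].
  have ms := measurable_spike_at S v (u k) i.
  have ml : d.-measurable [set w | \sum_(j <- S | j != i) tau j w <= v * u k].
    by apply: measurable_le => //; exact: measurable_sum_tau.
  rewrite -(tau_tail i); apply: EFin_inj; rewrite EFinM !PrK//.
  pose J1 := [set TrapIdx i]; pose J2 := [set a | exists2 j, j != i & a = TrapIdx j].
  have disj : J1 `&` J2 = set0.
    by rewrite -subset0 => _ [->] [j ji [ij]]; move: ji; rewrite ij eqxx.
  apply: (block_indep mX indX disj).
    apply: (@measurable_lt R _ (block X J1)) => //.
    exact: (@block_measurable_fun _ _ _ _ X J1 (TrapIdx i)).
  apply: (@measurable_le R _ (block X J2)) => //; apply: sum_tau_block => j _ ji.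
  by exists j.
have mB : d.-measurable [set w | v * u k < \sum_(j <- S | j != i) tau j w].
  by apply: measurable_lt => //; exact: measurable_sum_tau.
have -> : [set w | \sum_(j <- S | j != i) tau j w <= v * u k] =
    ~` [set w | v * u k < \sum_(j <- S | j != i) tau j w].
  by apply/seteqP; split => w /=; rewrite leNgt; [move/negP|move=> h; apply/negP].
rewrite PrC// ler_wpM2l ?Pr_ge0//.
have := sum_tau_tail S (fun j => j != i) k v01; lra.
Qed.

(** As v <= 1, two sites cannot both dominate, so the events are disjoint and their probabilities
    add up. *)
Lemma Pr_spike S I v k : 0 < v <= 1 -> uniq I -> {subset I <= S} ->
  (size S)%:R * (Cmin * F (u k)) / v <= 1 / 2 ->
  (size I)%:R * (F (u k) / 2) <= Pr P (spike S I v (u k)).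
Proof.
move=> v01 + + hS; elim: I => [|i I IH]; first by rewrite /= mul0r /spike big_nil Pr0.
move=> /= /andP[iI uI] IS; rewrite /spike big_cons -/(spike S I v (u k)).
rewrite PrU_disj; last 3 first.
- exact: measurable_spike_at.
- exact: measurable_spike.
- rewrite -subset0 => w [[/= h1 h2]] /spikeP[l lI [/= h3 h4]].
  have li : l != i by apply/eqP => li; move: iI; rewrite -li lI.
  have : tau l w <= \sum_(j <- S | j != i) tau j w.
    rewrite (big_rem l)/=; last by apply: IS; rewrite inE lI orbT.
    by rewrite li lerDl sumr_ge0// => j _; exact: ltW.
  have /andP[v0 v1] := v01; have : v * u k <= u k by rewrite ler_piMl// ltW.
  lra.
rewrite -natr1 mulrDl mul1r addrC lerD//; first exact: Pr_spike_at.
by apply: IH => // j jI; apply: IS; rewrite inE jI orbT.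
Qed.


Lemma exp_small (z e : R) : 0 <= z < 1 -> 0 < e -> exists l, z ^+ l <= e.
Proof.
move=> /andP[z0 z1] e_gt0.
have iz : 0 < 1 - z by rewrite subr_gt0.
pose l := (Num.truncn ((1 - z)^-1 / e)).+1.
have hl : (1 - z)^-1 / e < l%:R by exact: truncnS_gt.
exists l; have h : z ^+ l * l%:R <= (1 - z)^-1.
  apply: le_trans (@geometric_le R z l _); last by rewrite z0.
  rewrite mulr_natr -[l in X in X <= _]subn0 -sumr_const_nat; apply: ler_sum_nat => k /andP[_ kl].
  by rewrite ler_wiXn2l ?(ltW z1) ?(ltnW kl).
rewrite ltr_pdivrMr// in hl.
have l0 : 0 < (l%:R : R) by rewrite ltr0n.
by rewrite -(ler_pM2r l0); apply: (le_trans h); rewrite mulrC ltW.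
Qed.

Lemma tail_cvg0 e : 0 < e -> exists k, F (u k) <= e.
Proof.
move=> e_gt0.
pose G k := [set w | u k < tau 0 w].
have mG k : d.-measurable (G k) by exact: mtau_gt.
have uS k : u k.+1 = 2 * u k by exact: scaleS.
have ndG : nonincreasing_seq G.
  apply/nonincreasing_seqP => k; apply/subsetPset => w; rewrite /G /= uS.
  by have := u_gt0 k; lra.
have capG : \bigcap_k G k = set0.
  rewrite -subset0 => w h.
  have [k hk] : exists k, tau 0 w / x0 <= 2 ^+ k.
    exists (Num.truncn (tau 0 w / x0)).+1; apply: (le_trans (ltW (truncnS_gt _))).
    by rewrite -natrX ler_nat ltnW// ltn_expl.
  have := h k I; rewrite /G /= /u /scale ltNge -ler_pdivrMl// mulrC hk.
  by [].
have := @nonincreasing_cvg_mu _ _ _ P G _ mG _ ndG.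
rewrite capG measure0 => /(_ _ measurable0) H.
have {}H : P \o G @ \oo --> 0%:E.
  by apply: H; rewrite (le_lt_trans (probability_le1 _ (mG 0)))// ltry.
have H2 : (fine \o (P \o G)) x @[x --> \oo] --> (0 : R) by exact: fine_cvg H.
move/cvgrPdist_le : H2 => /(_ e e_gt0)[k _ hk].
exists k; have := hk k (leqnn k); rewrite /= sub0r normrN ger0_norm//.
exact: fine_ge0.
Qed.

(** * Choice of the scales, and recurrence of dominant traps *)

Variables (K : nat) (c delta : R) (I : nat -> seq int).
Hypothesis K_gt0 : (0 < K)%N.
Hypotheses (c_gt0 : 0 < c) (delta_gt0 : 0 < delta).
Hypothesis I_uniq : forall m, uniq (I m).
Hypothesis I_size : forall m, c * (2 ^ m)%:R <= (size (I m))%:R.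
Hypothesis I_ball : forall m, {subset I m <= int_ball (K * 2 ^ m)}.

(** One half of [delta] is for the annulus and the other for the inner ball; the minimum with 1
    keeps spikes exclusive. *)
Let v : R := Num.min 1 delta / 2.
Let v01 : 0 < v <= 1.
Proof.
have h : 0 < Num.min 1 delta by rewrite lt_min ltr01.
have h2 : Num.min 1 delta <= 1 by rewrite ge_min lexx.
by rewrite /v; apply/andP; split; lra.
Qed.
Let v2 : 2 * v <= delta.
Proof. by rewrite /v mulrC divfK// ge_min lexx orbT. Qed.

(* The trap sums over disjoint annuli are independent; the traps inside the
   previous ball are negligible when the next scale is chosen large enough. *)
Definition annulus (m m' : nat) : seq int :=
  [seq j <- int_ball (K * 2 ^ m') | j \notin int_ball (K * 2 ^ m)].
Definition outer (m m' : nat) : seq int :=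
  [seq j <- I m' | j \notin int_ball (K * 2 ^ m)].
(** At least (c/2) D sites, D = 2^m', each succeed with probability at least rho * eta / 2, where
    eta = v / (6 * Cmin * K * D); D cancels. *)
Definition spike_prob : R := c * rho * v / (24 * Cmin * K%:R).

Lemma spike_prob_gt0 : 0 < spike_prob.
Proof.
have [v0 _] := andP v01; have C0 := Cmin_gt0; have r0 : 0 < rho by have := rho12; lra.
have KR : 0 < (K%:R : R) by rewrite ltr0n.
have h1 : 0 < c * rho * v by rewrite mulr_gt0// mulr_gt0.
have h2 : 0 < 24 * Cmin * K%:R by rewrite mulr_gt0// mulr_gt0.
exact: divr_gt0.
Qed.

Lemma outer_size m m' :
  (size (I m') <= size (outer m m') + size (int_ball (K * 2 ^ m)))%N.
Proof.
rewrite -(count_predC (fun j => j \notin int_ball (K * 2 ^ m)) (I m')) /outer size_filter leq_add2l.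
rewrite -size_filter; apply: uniq_leq_size; first by rewrite filter_uniq.
by move=> j; rewrite mem_filter /= negbK => /andP[].
Qed.

Lemma next_scale m k0 : exists m' k, [/\ (m < m')%N,
  spike_prob <= Pr P (spike (annulus m m') (outer m m') v (u k)) &
  Pr P [set w | v * u k < \sum_(j <- int_ball (K * 2 ^ m)) tau j w] <= 2 ^- k0].
Proof.
have [v0 v1] := andP v01; have C0 := Cmin_gt0; have r12 := rho12.
have Fx0 : 0 < F x0 by exact: F_gt0.
pose M : R := (size (int_ball (K * 2 ^ m)))%:R.
(* The three terms respectively make [F (u 0)] exceed the target [eta], leave at least half of the
   guaranteed good sites outside the inner ball, and make a heavy inner ball as unlikely as
   2^-k0. *)
pose Z : R := v / (2 * Cmin * F x0) + 2 * M / c + M * 2 ^+ k0.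
have Z1 : 0 <= v / (2 * Cmin * F x0).
  by apply: ltW; rewrite divr_gt0// mulr_gt0// mulr_gt0.
have M0 : 0 <= M by [].
have Z2 : 0 <= 2 * M / c by apply: divr_ge0; [exact: mulr_ge0|exact: ltW].
have Z3 : 0 <= M * 2 ^+ k0 by apply: mulr_ge0 => //; exact: exprn_ge0.
pose m' := (m + (Num.truncn Z).+1)%N.
have mm' : (m < m')%N by rewrite /m' addnS ltnS leq_addr.
pose D : R := (2 ^ m')%:R.
have ZD : Z < D.
  apply: (lt_le_trans (truncnS_gt Z)); rewrite /D ler_nat.
  apply: (@leq_trans m'); first by rewrite /m' leq_addl.
  by rewrite ltnW// ltn_expl.
have D0 : 0 < D by rewrite ltr0n expn_gt0.
have K1 : 1 <= (K%:R : R) by rewrite ler1n.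
pose n' : R := 3 * (K%:R * D).
have n'D : D <= n'.
  have : D <= K%:R * D by rewrite ler_peMl// ltW.
  by rewrite /n'; lra.
have n'0 : 0 < n' by exact: lt_le_trans n'D.
pose eta := v / (2 * Cmin * n').
have eta0 : 0 < eta by rewrite divr_gt0// mulr_gt0// mulr_gt0.
have exk : exists k, F (u k) <= eta by exact: tail_cvg0.
(* At the least level with [F (u k) <= eta] the doubling bound also gives [F (u k) >= rho * eta]:
   the level matches the number of sites up to a constant. *)
case: (ex_minnP exk) => k hk kmin.
have F0eta : eta < F (u 0).
  have -> : u 0 = x0 by rewrite /u /scale expr0 mulr1.
  rewrite /eta ltr_pdivrMr; last by rewrite mulr_gt0// mulr_gt0.
  have : v / (2 * Cmin * F x0) < n' by apply: lt_le_trans n'D; apply: le_lt_trans ZD; rewrite /Z; lra.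
  rewrite ltr_pdivrMr; last by rewrite mulr_gt0// mulr_gt0.
  lra.
have k_gt0 : (0 < k)%N.
  by case: k hk kmin => // hk _; move: F0eta; rewrite ltNge hk.
have Fk : rho * eta <= F (u k).
  case: k k_gt0 hk kmin => // k _ _ kmin.
  have hk1 : eta < F (u k).
    by rewrite ltNge; apply/negP => /kmin; rewrite ltnn.
  have uS : u k.+1 = 2 * u k by exact: scaleS.
  rewrite uS; apply: le_trans (F2 (u_ge k)); rewrite ler_wpM2l ?(ltW hk1)//; lra.
have szS : (size (annulus m m'))%:R <= n'.
  apply: (@le_trans _ _ (3 * (K * 2 ^ m'))%:R); last by rewrite /n' /D -!natrM.
  rewrite ler_nat /annulus size_filter (leq_trans (count_size _ _))// size_int_ball.
  by apply: doubleS_le; rewrite muln_gt0 K_gt0 expn_gt0.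
have Ceta : Cmin * eta / v = (2 * n')^-1.
  by rewrite /eta; field; rewrite !gt_eqF.
have hS : (size (annulus m m'))%:R * (Cmin * F (u k)) / v <= 1 / 2.
  apply: (@le_trans _ _ (n' * (Cmin * eta) / v)).
    rewrite ler_wpM2r ?invr_ge0 ?(ltW v0)//; apply: ler_pM => //.
      by rewrite mulr_ge0 ?Pr_ge0// ltW.
    by rewrite ler_wpM2l// ltW.
  rewrite -mulrA Ceta le_eqVlt; apply/orP; left; apply/eqP; field.
  by rewrite gt_eqF.
exists m', k; split => //.
- have IS : {subset outer m m' <= annulus m m'}.
    by move=> j; rewrite !mem_filter => /andP[-> /I_ball].
  apply: le_trans (Pr_spike v01 _ IS hS); last by rewrite filter_uniq.
  have szI : c / 2 * D <= (size (outer m m'))%:R.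
    have h1 := I_size m'; have h2 := outer_size m m'.
    rewrite -(ler_nat R) natrD -/M in h2; rewrite -/D in h1.
    have : 2 * M / c <= D by apply: ltW; apply: le_lt_trans ZD; rewrite /Z; lra.
    by rewrite ler_pdivrMr//; lra.
  apply: (@le_trans _ _ (c / 2 * D * (rho * eta / 2))); last first.
    have re0 : 0 <= rho * eta by apply: ltW; apply: mulr_gt0 => //; lra.
    apply: ler_pM => //; [|lra|lra].
    by apply: ltW; apply: mulr_gt0 => //; exact: divr_gt0.
  rewrite /spike_prob /eta /n' le_eqVlt; apply/orP; left; apply/eqP; field.
  have K0 : (K%:R : R) != 0 by rewrite gt_eqF//; lra.
  by rewrite (gt_eqF D0) K0 (gt_eqF C0).
- apply: (le_trans (sum_tau_tail (int_ball (K * 2 ^ m)) xpredT k v01)).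
  rewrite -/M; apply: (@le_trans _ _ (M * (Cmin * eta) / v)).
    rewrite ler_wpM2r ?invr_ge0 ?(ltW v0)// ler_wpM2l// ler_wpM2l//; exact: ltW.
  have n2 : 0 < 2 * n' by rewrite mulr_gt0.
  have p2 : 0 < (2 ^+ k0 : R) by rewrite exprn_gt0.
  rewrite -mulrA Ceta ler_pdivrMr// [X in _ <= X]mulrC ler_pdivlMr//.
  have : M * 2 ^+ k0 <= n' by apply: le_trans n'D; apply: ltW; apply: le_lt_trans ZD; rewrite /Z; lra.
  lra.
Qed.

Lemma ae_dominant_trap : \forall w \ae P, forall m0, exists2 m, (m0 <= m)%N &
  exists2 i, i \in I m & \sum_(j <- int_ball (K * 2 ^ m) | j != i) tau j w <= delta * tau i w.
Proof.
have [v0 v1] := andP v01; have q0 := spike_prob_gt0.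
have /choice[f hf] : forall mk : nat * nat, exists r : nat * nat, [/\ (mk.1 < r.1)%N,
    spike_prob <= Pr P (spike (annulus mk.1 r.1) (outer mk.1 r.1) v (u r.2)) &
    Pr P [set w | v * u r.2 < \sum_(j <- int_ball (K * 2 ^ mk.1)) tau j w] <= 2 ^- mk.2].
  by move=> [m k0]; have [m' [k h]] := next_scale m k0; exists (m', k).
(* Stage [k] tolerates a heavy inner ball with probability 2^-k, which is summable. *)
pose ms := fix ms k := if k is k'.+1 then (f (ms k', k')).1 else 0%N.
have msS k : ms k.+1 = (f (ms k, k)).1 by [].
pose y k := u (f (ms k, k)).2.
pose S k := annulus (ms k) (ms k.+1).
pose A k := spike (S k) (outer (ms k) (ms k.+1)) v (y k).
pose B k := [set w | v * y k < \sum_(j <- int_ball (K * 2 ^ ms k)) tau j w].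
have ms_lt k : (ms k < ms k.+1)%N by have [] := hf (ms k, k).
have PA k : spike_prob <= Pr P (A k) by have [_ + _] := hf (ms k, k).
have PB k : Pr P (B k) <= 2 ^- k by have [_ _] := hf (ms k, k).
have mA k : d.-measurable (A k) by exact: measurable_spike.
have mB k : d.-measurable (B k) by apply: measurable_lt => //; exact: measurable_sum_tau.
have ms_mono k l : (k <= l)%N -> (ms k <= ms l)%N.
  move=> kl; rewrite -(subnKC kl); elim: (l - k)%N => [|n IH]; first by rewrite addn0.
  by rewrite addnS (leq_trans IH)// ltnW.
have ms_ge k : (k <= ms k)%N.
  by elim: k => // k IH; exact: leq_ltn_trans (ms_lt k).
have q1 : spike_prob <= 1 by apply: (le_trans (PA 0%N)); exact: Pr_le1.
pose Jt l : set tm_index := [set a | exists2 k, (k < l)%N & traps (S k) a].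
have IS k : {subset outer (ms k) (ms k.+1) <= S k}.
  by move=> j; rewrite !mem_filter => /andP[-> /I_ball].
have disj l : Jt l `&` traps (S l) = set0.
  rewrite -subset0 => _ [[k kl [j + ->]] [j' + [jj']]]; rewrite -jj'.
  rewrite !mem_filter !mem_int_ball => /andP[_ h1] /andP[h2 _].
  move: h2; rewrite (leq_trans h1)// leq_mul2l leq_exp2l// ms_mono// orbT.
  by [].
(* No spike at stages n, ..., n + l - 1. This event belongs to the block of the annuli before stage
   n + l, hence is independent of the next spike. *)
pose Cap n l := [set w | forall k, (n <= k < n + l)%N -> ~ A k w].
have capE n l : Cap n l.+1 = Cap n l `&` ~` A (n + l)%N.
  apply/seteqP; split => w /=.
    by move=> h; split; [move=> k /andP[nk kl]; apply: h; lia|apply: h; lia].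
  move=> [h1 h2] k /andP[nk]; rewrite addnS ltnS leq_eqVlt => /orP[/eqP -> //|kl].
  by apply: h1; rewrite nk.
have mCapb n l : measurable (Cap n l : set (block X (Jt (n + l)%N))).
  elim: l => [|l IH].
    rewrite (_ : Cap n 0 = setT); first exact: measurableT.
    by apply/seteqP; split => w // _ k; rewrite addn0; lia.
  rewrite capE; apply: measurableI.
    apply: (block_subset _ IH) => a [k kl h]; exists k => //; lia.
  apply: measurableC; apply: spike_block => // a h; exists (n + l)%N => //; lia.
have mCap n l : d.-measurable (Cap n l) by exact: (block_measurable mX (mCapb n l)).
have PCap n l : Pr P (Cap n l) <= (1 - spike_prob) ^+ l.
  elim: l => [|l IH]; first by rewrite expr0; exact: Pr_le1.
  rewrite capE.
  have mAb : measurable (~` A (n + l)%N : set (block X (traps (S (n + l)%N)))).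
    by apply: measurableC; exact: spike_block.
  have mAC : d.-measurable (~` A (n + l)%N) by exact: measurableC.
  have -> : Pr P (Cap n l `&` ~` A (n + l)%N) = Pr P (Cap n l) * Pr P (~` A (n + l)%N).
    apply: EFin_inj; rewrite EFinM !PrK//; last exact: measurableI.
    exact: (block_indep mX indX (disj _) (mCapb n l) mAb).
  rewrite exprSr; apply: ler_pM; rewrite ?Pr_ge0// PrC//.
  by have := PA (n + l)%N; lra.
(* [W n] increases with [n] while the bound on its probability tends to 0, so
   every [W n] is negligible. *)
pose W n := \bigcap_k (if (n <= k)%N then ~` A k `|` B k else setT).
have mW n : d.-measurable (W n).
  apply: bigcapT_measurable => k; case: ifP => // _.
  by apply: measurableU => //; exact: measurableC.
have PBs n l : Pr P (\bigcup_(k < l) B (n + k)%N) <= 2 * 2 ^- n.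
  apply: (le_trans (Pr_bigcup_le _ _ (fun k => mB (n + k)%N))).
  apply: (@le_trans _ _ (\sum_(0 <= k < l) 2 ^- n * (1 / 2) ^+ k)).
    rewrite big_mkord; apply: ler_sum => k _; apply: (le_trans (PB _)).
    by rewrite exprD invfM div1r exprVn.
  rewrite -mulr_sumr mulrC ler_wpM2r//.
  apply: (le_trans (@geometric_le R _ l _)); first by apply/andP; split; lra.
  have -> : (1 - 1 / 2 : R) = 2^-1 by field.
  by rewrite invrK.
have PW n l : Pr P (W n) <= (1 - spike_prob) ^+ l + 2 * 2 ^- n.
  have mU : d.-measurable (\bigcup_(k < l) B (n + k)%N) by exact: bigcup_measurable.
  apply: (@le_trans _ _ (Pr P (Cap n l `|` \bigcup_(k < l) B (n + k)%N))).
    apply: le_Pr => //; first exact: measurableU.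
    move=> w Ww; have [h|h] := pselect ((\bigcup_(k < l) B (n + k)%N) w); first by right.
    left => k /andP[nk kl] Ak; have := Ww k Logic.I; rewrite nk => -[//|Bk].
    by apply: h; exists (k - n)%N; [rewrite /=; lia|rewrite subnKC].
  apply: (le_trans (PrU_le P (mCap n l) mU)); exact: lerD.
have PW0 n : Pr P (W n) = 0.
  apply/eqP; rewrite eq_le Pr_ge0 andbT leNgt; apply/negP => e0.
  have [l hl] : exists l, (1 - spike_prob) ^+ l <= Pr P (W n) / 4.
    by apply: exp_small; [apply/andP; split; lra|rewrite divr_gt0].
  have [n' hn'] : exists l, (1 / 2) ^+ l <= Pr P (W n) / 8.
    by apply: exp_small; [apply/andP; split; lra|rewrite divr_gt0].
  have h1 := PW (n + n')%N l.
  have h2 : Pr P (W n) <= Pr P (W (n + n')%N).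
    apply: le_Pr => // w Ww k _; have := Ww k Logic.I.
    by case: ifP => // nk; case: ifP => // nk'; move: nk; rewrite (leq_trans _ nk')// leq_addr.
  have h3 : (2 : R) ^- (n + n') <= (1 / 2) ^+ n'.
    rewrite div1r -exprVn exprD ler_piMl ?exprn_ge0// exprn_ile1//; lra.
  lra.
have nW : P.-negligible (\bigcup_n W n).
  apply: negligible_bigcup => n; exists (W n); split => //.
  by have := PrK P (mW n); rewrite PW0 => /esym.
apply: negligibleS nW => w /= hw; apply: contrapT => nw; apply: hw => m0.
have [k [mk Ak Bk]] : exists k, [/\ (m0 <= k)%N, A k w & ~ B k w].
  apply: contrapT => h; apply: nw; exists m0 => // k _; case: ifP => // mk.
  have [Ak|Ak] := pselect (A k w); last by left.
  by have [Bk|Bk] := pselect (B k w); [right|exfalso; apply: h; exists k].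
exists (ms k.+1); first by rewrite (leq_trans mk)// (leq_trans (ms_ge k))// ltnW.
have /spikeP[i iI [/= h1 h2]] := Ak.
have iO : i \notin int_ball (K * 2 ^ ms k) by move: iI; rewrite mem_filter => /andP[].
exists i; first by move: iI; rewrite mem_filter => /andP[].
(* The annulus and the inner ball, which does not contain [i], each weigh at most v * y k; together
   at most delta * y k < delta * tau i w. *)
have -> : \sum_(j <- int_ball (K * 2 ^ ms k.+1) | j != i) tau j w =
    \sum_(j <- S k | j != i) tau j w + \sum_(j <- int_ball (K * 2 ^ ms k)) tau j w.
  rewrite (bigID (fun j => j \in int_ball (K * 2 ^ ms k)))/= addrC; congr (_ + _).
    by rewrite /S /annulus big_filter_cond; apply: eq_bigl => j; rewrite andbC.
  rewrite -big_filter; apply: perm_big; apply: uniq_perm.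
  - by rewrite filter_uniq// int_ball_uniq.
  - exact: int_ball_uniq.
  move=> j; rewrite mem_filter !mem_int_ball; apply/idP/idP; first by case/andP => /andP[].
  move=> jk; rewrite jk andbT; apply/andP; split.
    by apply: contraNneq iO => <-; rewrite mem_int_ball.
  apply: (leq_trans jk); rewrite leq_mul2l leq_exp2l//.
  by apply/orP; right; exact: ltnW (ms_lt k).
have yk0 : 0 < y k by exact: u_gt0.
have h3 : \sum_(j <- int_ball (K * 2 ^ ms k)) tau j w <= v * y k.
  by rewrite leNgt; apply/negP.
have h4 : 2 * v * y k <= delta * tau i w.
  by apply: ler_pM; [apply: mulr_ge0 => //; exact: ltW|exact: ltW|exact: v2|exact: ltW].
lra.
Qed.

End environment.

(** * Regularly varying tails *)

Section regular_variation.
Context {R : realType}.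

Lemma cvg_scale2 (f : R -> R) (l : R) : f x @[x --> +oo] --> l ->
  f (2 * x) @[x --> +oo] --> l.
Proof.
move=> fl; apply: (@cvg_comp _ _ _ (fun x : R => 2 * x) f _ +oo) => //.
apply/cvgryPge => A; near=> x.
have x0 : 0 <= x by near: x; exact: nbhs_pinfty_ge.
have : A <= x by near: x; apply: nbhs_pinfty_ge; exact: num_real.
lra.
Unshelve. all: by end_near. Qed.

Lemma near_scale2 (Q : R -> Prop) : (\forall x \near +oo, Q x) ->
  \forall x \near +oo, Q (2 * x).
Proof.
move=> [M [Mr hM]]; near=> x; apply: hM.
have x0 : 0 <= x by near: x; exact: nbhs_pinfty_ge.
have : M < x by near: x; apply: nbhs_pinfty_gt.
lra.
Unshelve. all: by end_near. Qed.

(** The power contributes exactly 2^-a under doubling, while the ratios of c + g and of the slowly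
    varying factor tend to 1. *)
Lemma regular_tail_ratio (F L : R -> R) (a c : R) : 0 < c ->
  slowly_varying L -> regular_tail F a c L ->
  (\forall x \near +oo, 0 < F x) /\
  F (2 * x) / F x @[x --> +oo] --> (2 `^ (- a) : R).
Proof.
move=> c0 [_ [L0 L2]] [g [g0 FE]].
have cg : c + g x @[x --> +oo] --> c.
  by rewrite -[X in _ --> X]addr0; apply: cvgD => //; exact: cvg_cst.
have cg0 : \forall x \near +oo, 0 < c + g x by exact: (cvgr_gt _ cg).
have FN : \forall x \near +oo, 0 < F x.
  near=> x; have -> : F x = x `^ (- a) * (c + g x) * L x by near: x.
  rewrite mulr_gt0//; last by near: x.
  rewrite mulr_gt0//; last by near: x.
  by rewrite powR_gt0//; near: x; exact: nbhs_pinfty_gt.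
split => //.
have H : 2 `^ (- a) * (c + g (2 * x)) / (c + g x) * (L (2 * x) / L x) @[x --> +oo] -->
    2 `^ (- a) * c / c * (1 : R).
  apply: cvgM; last by apply: (L2 2); rewrite ltr0n.
  apply: cvgM; last by apply: cvgV => //; rewrite gt_eqF.
  by apply: cvgM; [exact: cvg_cst|exact: (@cvg_scale2 (fun x => c + g x) c cg)].
rewrite mulr1 mulfK ?gt_eqF// in H.
have FE2 := near_scale2 FE.
apply: cvg_trans H; apply: near_eq_cvg; near=> x.
have x0 : 0 < x by near: x; exact: nbhs_pinfty_gt.
have E1 : F x = x `^ (- a) * (c + g x) * L x by near: x.
have E2 : F (2 * x) = (2 * x) `^ (- a) * (c + g (2 * x)) * L (2 * x).
  by near: x; exact: FE2.
have p1 : 0 < c + g x by near: x.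
have p2 : 0 < L x by near: x.
have p3 : 0 < x `^ (- a) by exact: powR_gt0.
rewrite E1 E2 powRM ?(ltW x0)//.
by field; rewrite !gt_eqF.
Unshelve. all: by end_near. Qed.

(** This is where beta > 1 enters, and its counterpart below is where alpha < 1 does. *)
Lemma powR_half_lt (a : R) : 1 < a -> 2 `^ (- a) < 1 / 2 :> R.
Proof.
move=> a1; have -> : 1 / 2 = 2 `^ (- 1) :> R by rewrite powR_inv1// div1r.
by rewrite /powR gt_eqF// ltr_expR ltr_pM2r ?ln_gt0 ?ltr1n//; lra.
Qed.

Lemma powR_half_gt (a : R) : a < 1 -> 1 / 2 < 2 `^ (- a) :> R.
Proof.
move=> a1; have -> : 1 / 2 = 2 `^ (- 1) :> R by rewrite powR_inv1// div1r.
by rewrite /powR gt_eqF// ltr_expR ltr_pM2r ?ln_gt0 ?ltr1n//; lra.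
Qed.

End regular_variation.

(** * A starting scale from which the one-step estimates hold *)

Section increment_scale.
Context {R : realType} {d : measure_display} {T : measurableType d}.
Variables (P : probability T R) (e : T -> R).

Lemma scale_shift (x : R) k j : scale (x * 2 ^+ k) j = scale x (k + j).
Proof. by rewrite /scale exprD mulrA. Qed.

Lemma rate_shift (x : R) k j : rate P e (x * 2 ^+ k) j = rate P e x (k + j).
Proof. by rewrite /rate /trunc_var /core scale_shift. Qed.

(** [rate] decays geometrically, so its smallness conditions hold after shifting the starting scale
    far enough. An integer [x0] makes every [scale] the radius of an integer ball. *)
Lemma exists_increment_scale (a : R) : 1 < a ->
  measurable_fun setT e -> intg P e -> Ex P e = 0 ->
  (\forall x \near +oo, 0 < tail P e x) ->
  tail P e (2 * x) / tail P e x @[x --> +oo] --> (2 `^ (- a) : R) ->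
  exists (x0 : nat) (r : R), [/\ (0 < x0)%N, 1 / 4 < r & r < 1 / 2] /\
   [/\ forall x, x0%:R / 2 <= x -> tail P e (2 * x) <= r * tail P e x,
       forall j, 9 * rate P e x0%:R j <= 1,
       forall j, 32 * (1 + 2 * Cmean r) ^+ 2 * rate P e x0%:R j <= 1 &
       forall j, 0 < rate P e x0%:R j].
Proof.
move=> a1 me ie e0 F0 Fr.
have ha := powR_half_lt a1; have ha0 : 0 < 2 `^ (- a) :> R by rewrite powR_gt0.
(* The midpoint of 2^-a and 1/2 lies above 2^-a, and above 1/4 because 2^-a > 0. *)
pose r : R := (2 `^ (- a) + 1 / 2) / 2.
have r14 : 1 / 4 < r by rewrite /r; lra.
have r12 : r < 1 / 2 by rewrite /r; lra.
have ra : 2 `^ (- a) < r by rewrite /r; lra.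
have Fr2 : \forall x \near +oo, tail P e (2 * x) <= r * tail P e x.
  have h : \forall x \near +oo, tail P e (2 * x) / tail P e x < r by exact: (cvgr_lt _ Fr).
  near=> x; have p1 : 0 < tail P e x by near: x.
  rewrite -ler_pdivrMr//; apply: ltW; near: x; exact: h.
have [M [_ hM]] := filterI F0 Fr2.
(* The factor 2 is there because the doubling bound must hold from y / 2 on. *)
pose y := (Num.truncn (2 * `|M|)).+1.
have yM : 2 * `|M| < y%:R by exact: truncnS_gt.
have M1 := ler_norm M.
have y0 : 0 < (y%:R : R) by rewrite ltr0n.
have tail2 (x : R) : y%:R / 2 <= x -> tail P e (2 * x) <= r * tail P e x.
  by move=> yx; have [|_] := hM x; first lra.
have tail0 (x : R) : y%:R / 2 <= x -> 0 < tail P e x.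
  by move=> yx; have [|] := hM x; first lra.
pose B := 9 + 32 * (1 + 2 * Cmean r) ^+ 2.
have B0 : 0 < B by rewrite ltr_pwDl// mulr_ge0// sqr_ge0.
pose Q := Cdecay r * rate P e y%:R 0.
have Q0 : 0 <= Q.
  by rewrite mulr_ge0 ?rate_ge0//; have := Cdecay_ge1 r14; lra.
have [k hk] : exists k, r ^+ k <= (B * (Q + 1))^-1.
  apply: exp_small; first by apply/andP; split; lra.
  by rewrite invr_gt0 mulr_gt0//; lra.
have small j : B * rate P e y%:R (k + j) <= 1.
  have h := rate_decay me y0 r14 r12 tail2 0 (k + j); rewrite add0n in h.
  have r0 : 0 <= r by lra.
  have h2 : r ^+ (k + j) <= (B * (Q + 1))^-1.
    apply: le_trans hk; rewrite exprD ler_piMr ?exprn_ge0// exprn_ile1//; lra.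
  have h3 : rate P e y%:R (k + j) <= (Q + 1) * (B * (Q + 1))^-1.
    apply: (le_trans h).
    have -> : Cdecay r * r ^+ (k + j) * rate P e y%:R 0 = Q * r ^+ (k + j) by rewrite /Q; ring.
    by apply: ler_pM => //; [exact: exprn_ge0|lra].
  rewrite -(ler_pM2l B0) in h3; apply: (le_trans h3).
  by rewrite mulrA mulfV// gt_eqF// mulr_gt0//; lra.
have E : (y * 2 ^ k)%:R = y%:R * 2 ^+ k :> R by rewrite natrM natrX.
have k1 : 1 <= (2 ^+ k : R) by rewrite exprn_ege1// ler1n.
exists (y * 2 ^ k)%N, r; split; first by split => //; rewrite muln_gt0 expn_gt0.
rewrite E; split.
- move=> x hx; apply: tail2; apply: le_trans hx.
  by rewrite ler_wpM2r// ler_peMr// ltW.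
- move=> j; rewrite rate_shift; apply: le_trans (small j).
  by rewrite ler_wpM2r ?rate_ge0// /B lerDl mulr_ge0// sqr_ge0.
- move=> j; rewrite rate_shift; apply: le_trans (small j).
  by rewrite ler_wpM2r ?rate_ge0// /B lerDr.
- move=> j; rewrite rate_shift.
  have := tail_le_rate me y0 r12 tail2 (k + j).
  have : 0 < tail P e (scale y%:R (k + j)).
    apply: tail0; have := scale_ge y0 (k + j); lra.
  lra.
Unshelve. all: by end_near. Qed.

End increment_scale.

(** * Localization of the trap model *)

Unset Implicit Arguments.

Theorem theorem7 (R : realType) (d : measure_display) (T : measurableType d)
  (P : probability T R) (alpha beta cm cp kp : R) (h s : R -> R)
  (eps : nat -> T -> int) (E : nat -> T -> R) (tau : int -> T -> R) :
  (* parameters *)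
  0 < alpha < 1 -> 1 < beta <= 2 ->
  (* measurability of the primitive random variables *)
  (forall j, measurable_fun setT (fun w => (eps j w)%:~R : R)) ->
  (forall k, measurable_fun setT (E k)) ->
  (forall i, measurable_fun setT (tau i)) ->
  (* (eps_j)_j, (E_k)_k, (tau_i)_i are all mutually independent *)
  mutually_independent P (tm_family eps E tau) ->
  (* increments: i.i.d., integer-valued, centered, aperiodic, two-sided tails *)
  (forall j, ident_distr P (fun w => (eps j w)%:~R) (fun w => (eps 0%N w)%:~R)) ->
  P.-integrable setT (fun w => ((eps 0%N w)%:~R : R)%:E) ->
  ('E_P[fun w => (eps 0%N w)%:~R] = 0)%E ->
  (forall t : R,
     (('E_P[fun w => cos (t * (eps 0%N w)%:~R)] = 1)%E /\
      ('E_P[fun w => sin (t * (eps 0%N w)%:~R)] = 0)%E)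
     <-> exists k : int, t = 2 * pi * k%:~R) ->
  0 < cm -> 0 < cp -> slowly_varying h ->
  regular_tail (fun x => fine (P [set w | (eps 0%N w)%:~R < - x])) beta cm h ->
  regular_tail (fun x => fine (P [set w | (eps 0%N w)%:~R > x])) beta cp h ->
  (* exponential clocks: i.i.d. Exp(1) *)
  (forall k, ident_distr P (E k) (E 0%N)) ->
  (forall x : R, 0 <= x -> P [set w | E 0%N w > x] = (expR (- x))%:E) ->
  (* traps: i.i.d., positive, heavy-tailed with index alpha *)
  (forall i, ident_distr P (tau i) (tau 0)) ->
  (forall i w, 0 < tau i w) ->
  0 < kp -> slowly_varying s -> (forall x, 0 < s x) ->
  regular_tail (fun x => fine (P [set w | tau 0 w > x])) alpha kp s ->
  (* localization: for a.e. realization of tau, sup_i P(X_t = i | tau) does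
     not converge to 0 as t -> oo *)
  \forall w \ae P,
    ~ (sup (range (fun i : int => quenched_prob P (fun j => tau j w) eps E t i))
         @[t --> +oo] --> (0 : R)).
Proof.
move=> /andP[a0 a1] /andP[b1 _] meps mE mtau ind eps_id eps_int eps_mean _ cm0 cp0 sh
  tm tp E_id E_tail tau_id tau0 kp0 ss _ tt.
pose X := tm_family eps E tau.
have mX i : measurable_fun setT (X i) by case: i.
pose er (j : nat) (w : T) : R := (eps j w)%:~R.
have ie : intg P (er 0%N) by exact: eps_int.
have e0 : Ex P (er 0%N) = 0 by move: eps_mean; rewrite unlock /Ex /Rintegral => ->.
(* The two one-sided tails share the index and the slowly varying factor, so the tail of the modulus
   is regular with constant cm + cp. *)
have tail_sum : regular_tail (tail P (er 0%N)) beta (cm + cp) h.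
  have [gm [gm0 hm]] := tm; have [gp [gp0 hp]] := tp.
  exists (fun x => gm x + gp x); split.
    by rewrite -[X in _ --> X]addr0; exact: cvgD.
  near=> x; have x0 : 0 < x by near: x; exact: nbhs_pinfty_gt.
  have m1 : d.-measurable [set w | er 0%N w < - x] by apply: measurable_lt => //; exact: meps.
  have m2 : d.-measurable [set w | x < er 0%N w] by apply: measurable_lt => //; exact: meps.
  have -> : tail P (er 0%N) x = Pr P [set w | er 0%N w < - x] + Pr P [set w | x < er 0%N w].
    rewrite -PrU_disj//; last by rewrite -subset0 => w [/= h1 h2]; lra.
    congr Pr; apply/seteqP; split => w /=.
      by rewrite lter_normr => /orP[|h1]; [right|left; lra].
    by rewrite lter_normr => -[h1|->//]; apply/orP; right; lra.
  have -> : Pr P [set w | er 0%N w < - x] = x `^ (- beta) * (cm + gm x) * h x by near: x.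
  have -> : Pr P [set w | x < er 0%N w] = x `^ (- beta) * (cp + gp x) * h x by near: x.
  ring.
have [F0 Fr] := regular_tail_ratio (addr_gt0 cm0 cp0) sh tail_sum.
have [x0 [r [[x0_gt0 r14 r12] [tail2 q1 q2 q0]]]] :=
  exists_increment_scale b1 (meps 0%N) ie e0 F0 Fr.
have E_exp n x : 0 <= x -> Pr P [set w | x < E n w] = expR (- x).
  move=> x_ge0; rewrite /Pr -[expR _]/(fine (expR (- x))%:E) -(E_tail x x_ge0); congr fine.
  have mB : measurable [set z : R | x < z] by apply: measurable_lt.
  exact: (E_id n _ mB).
have [K [c [delta [p [theta [[K0 c0 d0 p0 th0] /choice[I hI]]]]]]] :=
  good_sites mX ind eps_id ie e0 x0_gt0 r14 r12 tail2 q1 q2 q0 E_exp.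
have [G0 Gr] := regular_tail_ratio kp0 ss tt.
have ha := powR_half_gt a1.
pose rho : R := (2 `^ (- alpha) + 1 / 2) / 2.
have rho12 : 1 / 2 < rho by rewrite /rho; lra.
have rho_a : rho < 2 `^ (- alpha) by rewrite /rho; lra.
have Gr2 : \forall x \near +oo, rho * Pr P [set w | x < tau 0 w] <= Pr P [set w | 2 * x < tau 0 w].
  have hh : \forall x \near +oo,
      rho < Pr P [set w | 2 * x < tau 0 w] / Pr P [set w | x < tau 0 w].
    exact: (cvgr_gt _ Gr).
  near=> x; have g0 : 0 < Pr P [set w | x < tau 0 w] by near: x.
  rewrite -ler_pdivlMr//; apply: ltW; near: x; exact: hh.
have [M [_ hM]] := filterI G0 Gr2.
have M1 := ler_norm M; have M2 := normr_ge0 M.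
have y0 : 0 < `|M| + 1 by lra.
have tau_tail j x : Pr P [set w | x < tau j w] = Pr P [set w | x < tau 0 w].
  have mB : measurable [set z : R | x < z] by apply: measurable_lt.
  by congr fine; exact: (tau_id j _ mB).
have F2 x : `|M| + 1 <= x -> rho * Pr P [set w | x < tau 0 w] <= Pr P [set w | 2 * x < tau 0 w].
  by move=> xM; have [|_] := hM x; first lra.
have F_gt0 x : `|M| + 1 <= x -> 0 < Pr P [set w | x < tau 0 w].
  by move=> xM; have [|] := hM x; first lra.
have dom := @ae_dominant_trap _ _ _ P eps E tau (`|M| + 1) rho mX ind tau0 tau_tail y0 rho12 F2 F_gt0
  K c delta I K0 c0 d0 (fun m => let: And4 h _ _ _ := hI m in h)
  (fun m => let: And4 _ h _ _ := hI m in h) (fun m => let: And4 _ _ h _ := hI m in h).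
apply: filterS dom => w dom cv0.
(* A lower bound for every dominant trap: the ball contains 0 and 1, and at least one of them
   differs from [i], so its trap is at most delta * tau i w. *)
pose sg := Num.min (tau 0 w) (tau 1 w) / delta.
have sg0 : 0 < sg by rewrite divr_gt0// lt_min !tau0.
move/cvgrPdist_lt : cv0 => /(_ p p0)[A [_ hA]].
have A2 := normr_ge0 A.
(* From scale [m0] on, the lower bound for [t] exceeds the threshold [A] given by the assumed
   convergence. *)
have [m0 hm0] : exists m0, (2 * r) ^+ m0 <= sg * theta / (`|A| + 1).
  apply: exp_small; first by apply/andP; split; lra.
  by apply: divr_gt0; [exact: mulr_gt0|lra].
have [m mm0 [i iI hi]] := dom m0.
have [_ _ _ /(_ (fun j => tau j w) i (tau0 ^~ w) iI hi)[t [t1 t2]]] := hI m.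
have inball (j : int) : (absz j <= 1)%N -> j \in int_ball (K * 2 ^ m).
  by rewrite mem_int_ball => /leq_trans; apply; rewrite muln_gt0 K0 expn_gt0.
have si : sg <= tau i w.
  rewrite ler_pdivrMr// mulrC; apply: le_trans hi.
  have one (j : int) : j != i -> j \in int_ball (K * 2 ^ m) ->
      tau j w <= \sum_(j <- int_ball (K * 2 ^ m) | j != i) tau j w.
    by move=> ji jb; rewrite (big_rem j)//= ji lerDl sumr_ge0// => l _; exact: ltW.
  have [i0|i0] := eqVneq i 0.
    by apply: le_trans (one 1 _ (inball 1 _)) => //; [rewrite ge_min lexx orbT|rewrite i0].
  by apply: le_trans (one 0 _ (inball 0 _)) => //; [rewrite ge_min lexx|rewrite eq_sym].
have At : A < t.
  apply: lt_le_trans t1; have r0 : 0 < 2 * r by lra.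
  have rm0 : 0 < (2 * r) ^+ m by rewrite exprn_gt0.
  have rm : (2 * r) ^+ m <= sg * theta / (`|A| + 1).
    by apply: le_trans hm0; rewrite ler_wiXn2l//; lra.
  rewrite ler_pdivlMr in rm; last by lra.
  rewrite mulrA ltr_pdivlMr//.
  have h1 : sg * theta <= tau i w * theta by rewrite ler_wpM2r// ltW.
  have h2 := ler_norm A.
  have h3 : A * (2 * r) ^+ m < (2 * r) ^+ m * (`|A| + 1).
    by rewrite mulrC ltr_pM2l//; lra.
  lra.
have := hA t At; rewrite sub0r normrN ltNge => /negP; apply.
(* The supremum dominates the value at [i] because the quenched probabilities are bounded by 1. *)
apply: (le_trans t2); apply: le_trans (ler_norm _); apply: ub_le_sup; last by exists i.
exists 1 => _ [j _ <-]; rewrite /quenched_prob.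
have mt := @measurable_trap_at _ _ _ eps E tau mX j (fun j => tau j w) t.
by have := Pr_le1 P mt.
Unshelve. all: by end_near. Qed.
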